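(* There is an algorithm that, given an $L$-shaped supergrid graph $L(m,n;k,l)$ and two distinct vertices $s$ and $t$ of it, computes a longest $(s,t)$-path of $L(m,n;k,l)$ in $O(mn)$ time.
   Context: The infinite supergrid graph has as vertices all points $(x,y)\in\mathbb{Z}^2$, two distinct vertices $u,v$ being adjacent iff $|u_x-v_x|\le 1$ and $|u_y-v_y|\le 1$. For integers $m,n>1$ and $k,l\ge 1$ with $m-k\ge 1$, $n-l\ge 1$, $L(m,n;k,l)$ is the subgraph of this infinite graph induced by $\{(x,y):1\le x\le m,\ 1\le y\le n\}\setminus\{(x,y): m-k+1\le x\le m,\ 1\le y\le l\}$. A longest $(s,t)$-path is a simple path from $s$ to $t$ having the maximum number of vertices among all simple paths from $s$ to $t$. *)

(* Defs.v *)
From mathcomp Require Import all_boot.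
Set Implicit Arguments. Unset Strict Implicit. Unset Printing Implicit Defensive.

Definition vertex := (nat * nat)%type.

Definition inL (m n k l : nat) (v : vertex) : bool :=
  [&& 1 <= v.1 <= m, 1 <= v.2 <= n &
      ~~ ((m - k + 1 <= v.1 <= m) && (1 <= v.2 <= l))].

Definition validL (m n k l : nat) : Prop :=
  [/\ 1 < m, 1 < n, 1 <= k & 1 <= l] /\ (k < m) /\ (l < n).

Definition absdiff (a b : nat) : nat := (a - b) + (b - a).

(* supergrid adjacency (the induced subgraph keeps all such edges) *)
Definition sg_adj (u v : vertex) : bool :=
  [&& u != v, absdiff u.1 v.1 <= 1 & absdiff u.2 v.2 <= 1].

Definition is_st_path (m n k l : nat) (s t : vertex) (p : seq vertex) : Prop :=
  [/\ p != [::], head s p = s, last s p = t & uniq p] /\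
  all (inL m n k l) p /\ path sg_adj s (behead p).

Definition is_longest_st_path m n k l s t (p : seq vertex) : Prop :=
  is_st_path m n k l s t p /\
  forall q, is_st_path m n k l s t q -> size q <= size p.

(* ---------- Cost model: a unit-cost RAM (no multiplication) ---------- *)
Inductive instr : Type :=
| IConst of nat & nat
| IAdd   of nat & nat & nat
| ISub   of nat & nat & nat    (* ISub r a b   : M[r] := M[a] - M[b] (truncated) *)
| ILoad  of nat & nat
| IStore of nat & nat
| IJlt   of nat & nat & nat
| IJmp   of nat
| IOut   of nat & nat.

Record config := Config { pc : nat; mem : nat -> nat; out : seq vertex }.

Definition upd (M : nat -> nat) (r v : nat) : nat -> nat :=
  fun i => if i == r then v else M i.

Definition step (prog : seq instr) (c : config) : option config :=
  let: Config p M o := c in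
  match nth None (map Some prog) p with
  | None => None
  | Some i =>
    Some match i with
    | IConst r v => Config p.+1 (upd M r v) o
    | IAdd r a b => Config p.+1 (upd M r (M a + M b)) o
    | ISub r a b => Config p.+1 (upd M r (M a - M b)) o
    | ILoad r a => Config p.+1 (upd M r (M (M a))) o
    | IStore a b => Config p.+1 (upd M (M a) (M b)) o
    | IJlt a b j => Config (if M a < M b then j else p.+1) M o
    | IJmp j => Config j M o
    | IOut a b => Config p.+1 M (rcons o (M a, M b))
    end
  end.

Definition halted (prog : seq instr) (c : config) : bool :=
  size prog <= pc c.

Fixpoint run (prog : seq instr) (T : nat) (c : config) : config :=
  match T with
  | 0 => c
  | T'.+1 => match step prog c with
             | None => c
             | Some c' => run prog T' c'
             end
  end.

Definition init_config (m n k l : nat) (s t : vertex) : config :=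
  Config 0 (fun i => nth 0 [:: m; n; k; l; s.1; s.2; t.1; t.2] i) [::].

(* Main.v *)
Require Import Defs.
From Stdlib Require List.
From mathcomp Require Import all_boot zify.

(** After reflecting the second coordinate and writing A = m - k, B = n - l, the graph is
    the region {x <= A or y <= B} of the m by n grid.  If an arm has width one, its part
    beyond s, t and the corner is a dead end and is cut off.

    The relative order of 0, s - 1, s, t - 1, t, A, A + 1 and the length, together with the
    information which consecutive values differ by exactly one, puts each axis into one of
    finitely many classes.  For every pair of classes there is a template: a sequence of
    rectangles with sides among these values, each traversed from corner to corner by a
    snake, that gives an (s,t)-path through every vertex of a window.  The window is the
    whole region unless some obstruction is present: s, t inside an arm of width one, s and
    t forming a cut, or a pendant vertex at the end of an arm.  In these cases no path has
    more vertices than the largest of at most two windows.  Validity of a template depends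
    only on the classes, so all pairs are checked by computation.  The algorithm determines
    the pair of classes by comparisons and outputs its template. *)

Set Implicit Arguments.
Unset Strict Implicit.
Unset Printing Implicit Defensive.

(** * A structured language for the machine *)

(** Finitely many classes suffice because diagonal steps remove the parity obstructions of ordinary
    grids: a rectangle of any size can be traversed completely between opposite corners and between
    distinct neighbouring corners. So the validity of a sequence of rectangles depends on the order
    of the cuts and on a few gaps of length one, never on residues.

    A template visits every vertex of its window, and a clause bounds all paths by the largest of
    its windows, so the two bounds meet without any separate optimality argument for a template.
    When there are two windows, the larger one is not determined by the class; the program has to
    measure both.

    The machine can neither multiply nor divide. Parities and areas are therefore computed by loops
    whose cost is charged to the vertices of the rectangle concerned. The number of pairs of classes
    does not depend on the input, so even a linear search through them costs a constant. *)

Definition memory := nat -> nat.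

(** Bounded loops and fixed register addresses make memory, output and running time total functions
    by structural recursion. Indirect loads and stores are left out: templates are constants of the
    program, so finitely many registers suffice. *)
Inductive cmd : Type :=
| CSkip
| CConst of nat & nat
| CAdd of nat & nat & nat
| CSub of nat & nat & nat
| COut of nat & nat
| CSeq of cmd & cmd
| CIf of nat & nat & cmd & cmd
| CFor of nat & nat & cmd.

Notation "c1 ;; c2" := (CSeq c1 c2) (at level 61, right associativity).

(* Holds one; loops set it before they increment their counter. *)
Definition unit_reg := 8.

Fixpoint writes (c : cmd) : seq nat :=
  match c with
  | CSkip | COut _ _ => [::]
  | CConst r _ | CAdd r _ _ | CSub r _ _ => [:: r]
  | CSeq c1 c2 | CIf _ _ c1 c2 => writes c1 ++ writes c2
  | CFor r _ c => [:: r, unit_reg & writes c]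
  end.

(** The compiled loop tests [r] against register [a] before every round. To give exactly [M a]
    rounds, as in [mem_after], the body must leave both registers alone, and the increment, which
    also writes [unit_reg], must not disturb the bound. *)
Fixpoint wf_cmd (c : cmd) : bool :=
  match c with
  | CSeq c1 c2 | CIf _ _ c1 c2 => wf_cmd c1 && wf_cmd c2
  | CFor r a c =>
    [&& wf_cmd c, r \notin writes c, r != unit_reg & a \notin [:: r, unit_reg & writes c]]
  | _ => true
  end.

(** The memory after the two instructions [IConst unit_reg 1] and [IAdd r r unit_reg] that close a
    round, written so that it matches the compiled code by conversion. *)
Definition incr (r : nat) (M : memory) : memory :=
  upd (upd M unit_reg 1) r (upd M unit_reg 1 r + upd M unit_reg 1 unit_reg).

Fixpoint mem_after (c : cmd) (M : memory) : memory :=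
  match c with
  | CSkip | COut _ _ => M
  | CConst r v => upd M r v
  | CAdd r a b => upd M r (M a + M b)
  | CSub r a b => upd M r (M a - M b)
  | CSeq c1 c2 => mem_after c2 (mem_after c1 M)
  | CIf a b c1 c2 => if M a < M b then mem_after c1 M else mem_after c2 M
  | CFor r a c => iter (M a) (fun M' => incr r (mem_after c M')) (upd M r 0)
  end.

Fixpoint output (c : cmd) (M : memory) : seq vertex :=
  match c with
  | COut a b => [:: (M a, M b)]
  | CSeq c1 c2 => output c1 M ++ output c2 (mem_after c1 M)
  | CIf a b c1 c2 => if M a < M b then output c1 M else output c2 M
  | CFor r a c =>
    flatten [seq output c (iter i (fun M' => incr r (mem_after c M')) (upd M r 0))
            | i <- iota 0 (M a)]
  | _ => [::]
  end.

(** Exact step counts. The then-branch is compiled last and falls through, so it saves the jump that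
    the else-branch needs. A loop pays 3 for initialisation, failing test and exit jump, and 4 per
    round for the test, the increment and the jump back. *)
Fixpoint time (c : cmd) (M : memory) : nat :=
  match c with
  | CSkip => 0
  | CSeq c1 c2 => time c1 M + time c2 (mem_after c1 M)
  | CIf a b c1 c2 => if M a < M b then (time c1 M).+1 else (time c2 M).+2
  | CFor r a c =>
    3 + sumn [seq time c (iter i (fun M' => incr r (mem_after c M')) (upd M r 0)) + 4
             | i <- iota 0 (M a)]
  | _ => 1
  end.

Fixpoint csize (c : cmd) : nat :=
  match c with
  | CSkip => 0
  | CSeq c1 c2 => csize c1 + csize c2
  | CIf _ _ c1 c2 => (csize c2).+2 + csize c1
  | CFor _ _ c => csize c + 6
  | _ => 1
  end.

Fixpoint compile (c : cmd) (b : nat) : seq instr :=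
  match c with
  | CSkip => [::]
  | CConst r v => [:: IConst r v]
  | CAdd r x y => [:: IAdd r x y]
  | CSub r x y => [:: ISub r x y]
  | COut x y => [:: IOut x y]
  | CSeq c1 c2 => compile c1 b ++ compile c2 (b + csize c1)
  | CIf x y c1 c2 =>
    IJlt x y (b + (csize c2).+2) :: compile c2 b.+1
      ++ IJmp (b + csize c2 + csize c1).+2 :: compile c1 (b + (csize c2).+2)
  | CFor r x c =>
    [:: IConst r 0; IJlt r x b.+3; IJmp (b + csize c + 6)]
      ++ compile c b.+3
      ++ [:: IConst unit_reg 1; IAdd r r unit_reg; IJmp b.+1]
  end.

Lemma size_compile c b : size (compile c b) = csize c.
Proof.
elim: c b => //= [c1 IH1 c2 IH2|x y c1 IH1 c2 IH2|r x c IH] b.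
- by rewrite size_cat IH1 IH2.
- by rewrite size_cat /= IH1 IH2; lia.
- by rewrite size_cat /= IH; lia.
Qed.

Lemma mem_after_frame c M x : x \notin writes c -> mem_after c M x = M x.
Proof.
elim: c M => //= [r v|r a b|r a b|c1 IH1 c2 IH2|a b c1 IH1 c2 IH2|r a c IH] M.
- by rewrite /upd inE => /negbTE->.
- by rewrite /upd inE => /negbTE->.
- by rewrite /upd inE => /negbTE->.
- by rewrite mem_cat negb_or => /andP[h1 h2]; rewrite IH2 ?IH1.
- by rewrite mem_cat negb_or => /andP[h1 h2]; case: ifP => _; rewrite ?IH2 ?IH1.
- rewrite !inE !negb_or => /and3P[h1 h2 h3].
  have: forall i, iter i (fun M' => incr r (mem_after c M')) (upd M r 0) x = M x.
    elim=> [|i IHi]; first by rewrite /= /upd (negbTE h1).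
    by rewrite iterS {1}/incr /upd (negbTE h1) (negbTE h2) IH.
  by apply.
Qed.

Lemma run_add prog a b c : run prog (a + b) c = run prog b (run prog a c).
Proof.
elim: a c => [|a IH] c //=.
case E: (step prog c) => [c'|] //=.
by case: b {IH} => //= b; rewrite E.
Qed.

Definition code_at (prog : seq instr) (b : nat) (code : seq instr) :=
  forall i, i < size code ->
    nth None (map Some prog) (b + i) = nth None (map Some code) i.

Lemma code_at_cat prog b c1 c2 :
  code_at prog b (c1 ++ c2) <-> code_at prog b c1 /\ code_at prog (b + size c1) c2.
Proof.
split=> [h|[h1 h2] i].
  split=> i hi.
    by rewrite h ?size_cat ?map_cat ?nth_cat ?size_map ?hi //; lia.
  rewrite -addnA h ?size_cat ?map_cat ?nth_cat ?size_map; last by lia.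
  by rewrite ltnNge leq_addr /= addKn.
rewrite size_cat map_cat nth_cat size_map => hi.
case: ltnP => hi1; first exact: h1.
by rewrite -h2; [congr (nth _ _ _); lia|lia].
Qed.

Lemma code_at_cons prog b x c :
  code_at prog b (x :: c) <->
  nth None (map Some prog) b = Some x /\ code_at prog b.+1 c.
Proof.
rewrite -cat1s code_at_cat addn1; split=> -[h1 h2]; split=> //.
  by have := h1 0 isT; rewrite addn0.
by case=> // _; rewrite addn0.
Qed.

Lemma compile_run prog c : wf_cmd c -> forall b M o,
  code_at prog b (compile c b) ->
  run prog (time c M) (Config b M o)
    = Config (b + csize c) (mem_after c M) (o ++ output c M).
Proof.
elim: c => [|r v|r x y|r x y|x y|c1 IH1 c2 IH2|x y c1 IH1 c2 IH2|r x c IH] /=.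
- by move=> _ b M o _; rewrite addn0 cats0.
- by move=> _ b M o /code_at_cons[-> _]; rewrite addn1 cats0.
- by move=> _ b M o /code_at_cons[-> _]; rewrite addn1 cats0.
- by move=> _ b M o /code_at_cons[-> _]; rewrite addn1 cats0.
- by move=> _ b M o /code_at_cons[-> _]; rewrite addn1 cats1.
- move=> /andP[w1 w2] b M o /code_at_cat[h1]; rewrite size_compile => h2.
  by rewrite run_add IH1 // IH2 // catA addnA.
- move=> /andP[w1 w2] b M o /code_at_cons[h0 /code_at_cat[h2]].
  rewrite size_compile => /code_at_cons[h3 h1].
  have e : (b.+1 + csize c2).+1 = b + (csize c2).+2 by lia.
  rewrite e in h1; case: ifP => hlt.
    rewrite /= h0 hlt IH1 //.
    by congr (Config _ _ _); lia.
  have -> : (time c2 M).+2 = 1 + (time c2 M + 1) by lia.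
  rewrite run_add /= h0 hlt run_add IH2 //= h3.
  by congr (Config _ _ _); lia.
- move=> /and4P[wc rc ru]; rewrite !inE !negb_or => /and3P[ar au ac] b M o.
  move=> /code_at_cons[h0 /code_at_cons[h1 /code_at_cons[h2 /code_at_cat[h3]]]].
  rewrite size_compile => /code_at_cons[h4 /code_at_cons[h5 /code_at_cons[h6 _]]].
  pose nxt M' := incr r (mem_after c M').
  rewrite -/nxt.
  have inv i : iter i nxt (upd M r 0) r = i /\ iter i nxt (upd M r 0) x = M x.
    elim: i => [|i [e1 e2]]; first by rewrite /= /upd eqxx (negbTE ar).
    rewrite iterS {1 3}/nxt {1 2}/incr /upd !eqxx (negbTE ar) (negbTE au) (negbTE ru).
    rewrite (mem_after_frame _ rc) (mem_after_frame _ ac) e1 e2.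
    by split=> //; lia.
  (* Induction on the number [i] of rounds still to come, so the counter stands at [M x - i]; the
     [+ 2] is the failing test and the exit jump. *)
  have loop i o' : i <= M x ->
    run prog (sumn [seq time c (iter j nxt (upd M r 0)) + 4 | j <- iota (M x - i) i] + 2)
      (Config b.+1 (iter (M x - i) nxt (upd M r 0)) o')
    = Config (b + (csize c + 6)) (iter (M x) nxt (upd M r 0))
        (o' ++ flatten [seq output c (iter j nxt (upd M r 0)) | j <- iota (M x - i) i]).
    elim: i o' => [|i IHi] o' hi.
      rewrite /= subn0 h1; have [-> ->] := inv (M x).
      by rewrite ltnn /= h2 cats0 addnA.
    rewrite /=; set M1 := iter (M x - i.+1) nxt _; set S := sumn _.
    have -> : time c M1 + 4 + S + 2 = 1 + (time c M1 + (3 + (S + 2))) by lia.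
    rewrite run_add /= h1; have [e1 e2] := inv (M x - i.+1).
    rewrite -/M1 in e1 e2 *; rewrite e1 e2.
    have -> : M x - i.+1 < M x by lia.
    rewrite run_add IH // run_add /= h4 /= h5 /= h6.
    have es : (M x - i.+1).+1 = M x - i by lia.
    have eM : incr r (mem_after c M1) = iter (M x - i) nxt (upd M r 0) by rewrite -es iterS.
    by rewrite -/(incr r (mem_after c M1)) eM /S es IHi ?catA //; lia.
  have := loop (M x) o (leqnn _); rewrite subnn /= => <-.
  rewrite -[LHS]/(run prog (time (CFor r x c) M) (Config b M o)).
  set S := sumn _.
  have -> : time (CFor r x c) M = 1 + (S + 2) by rewrite [LHS]/= -/nxt -/S; lia.
  by rewrite run_add /= h0.
Qed.

(** * Corner-to-corner traversals of rectangles *)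

(** Adjacency without distinctness of the ends, which [uniq] supplies at the very end. Coordinate
    changes then only have to preserve closeness. *)
Definition wadj (u v : vertex) : bool :=
  (absdiff u.1 v.1 <= 1) && (absdiff u.2 v.2 <= 1).

Definition walk (u : vertex) (p : seq vertex) (v : vertex) : Prop :=
  exists p', [/\ p = u :: p', last u p' = v & path wadj u p'].

Lemma walk_cat u p v u' p' v' :
  walk u p v -> wadj v u' -> walk u' p' v' -> walk u (p ++ p') v'.
Proof.
move=> [q [-> <- hq]] a [q' [-> <- hq']]; exists (q ++ u' :: q').
by rewrite last_cat cat_path hq /= a hq'.
Qed.

Lemma walk_map (f : vertex -> vertex) u p v :
  (forall a b, a \in p -> b \in p -> wadj a b -> wadj (f a) (f b)) ->
  walk u p v -> walk (f u) (map f p) (f v).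
Proof.
move=> hf [q [ep <- hq]]; exists (map f q); rewrite ep last_map; split=> //.
move: hf; rewrite {p}ep; elim: q u hq => //= w q IH u /andP[a hq] hf.
rewrite hf ?inE ?eqxx ?orbT //=; apply: IH => // b c hb hc.
by apply: hf; rewrite inE ?hb ?hc orbT.
Qed.

Lemma path_column i (up : bool) a b n : a + n <= b ->
  path wadj (i, if up then b - a else a)
    [seq (i, if up then b - j else j) | j <- iota a.+1 n].
Proof.
elim: n a => [|n IH] a hb //=.
rewrite IH ?andbT; last by lia.
by rewrite /wadj /absdiff /=; case: (up); lia.
Qed.

Lemma last_iota a n : last a (iota a.+1 n) = a + n.
Proof. by elim: n a => [|n IH] a /=; rewrite ?addn0 ?IH //; lia. Qed.

Definition side (h : nat) (b : bool) := if b then h.-1 else 0.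

Definition column (h i : nat) (up : bool) : seq vertex :=
  [seq (i, if up then h.-1 - j else j) | j <- iota 0 h].

Definition snake (h i w : nat) (up : bool) : seq vertex :=
  flatten [seq column h (i + j) (odd j (+) up) | j <- iota 0 w].

Definition zigzag (h : nat) : seq vertex :=
  flatten [seq [:: (0, j); (1, j)] | j <- iota 0 h].

(* Traverses the [w * h] grid from [(0, 0)] to [(w.-1, h.-1)] if [diag] and to
   [(w.-1, 0)] otherwise; a zigzag through the first two columns repairs the
   parity of the column snake. *)
Definition grid_path (diag : bool) (w h : nat) : seq vertex :=
  if (odd w != diag) && (1 < w) then zigzag h ++ snake h 2 (w - 2) true
  else snake h 0 w false.

Lemma walk_column h i up : 0 < h ->
  walk (i, side h up) (column h i up) (i, side h (~~ up)).
Proof.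
case: h => // h _; exists [seq (i, if up then h - j else j) | j <- iota 1 h].
rewrite /column /side /=; split.
- by case: up; rewrite ?subn0.
- have -> : (i, if up then h else 0) = (i, if up then h - 0 else 0) by rewrite subn0.
  rewrite (last_map (fun j => (i, if up then h - j else j))) last_iota add0n.
  by case: up; rewrite /= ?subnn.
- have := @path_column i up 0 h h (leqnn _).
  by case: up; rewrite ?subn0.
Qed.

Lemma snakeS h i w up :
  snake h i w.+1 up = snake h i w up ++ column h (i + w) (odd w (+) up).
Proof. by rewrite /snake -addn1 iotaD map_cat flatten_cat /= cats0. Qed.

Lemma walk_snake h i w up : 0 < h -> 0 < w ->
  walk (i, side h up) (snake h i w up) (i + w.-1, side h (odd w (+) up)).
Proof.
move=> h0; case: w => // w _; elim: w => [|w IH].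
  rewrite snakeS addn0 /=.
  by have := walk_column i up h0; rewrite /snake.
have e : ~~ (odd w.+1 (+) up) = odd w.+2 (+) up by rewrite /=; case: (odd w); case: (up).
rewrite snakeS -e; apply: walk_cat IH _ (walk_column _ _ h0).
by rewrite /wadj /absdiff /=; lia.
Qed.

Lemma mem_column h i up x : (x \in column h i up) = (x.1 == i) && (x.2 < h).
Proof.
apply/mapP/andP => [[j]|[/eqP e1 hx]].
  by rewrite mem_iota => hj -> /=; rewrite eqxx; split=> //; case: up; lia.
exists (if up then h.-1 - x.2 else x.2); first by rewrite mem_iota; case: up; lia.
by case: x e1 hx => a b /= -> hb; case: up => //; congr pair; lia.
Qed.

Lemma mem_snake h i w up x :
  (x \in snake h i w up) = (i <= x.1 < i + w) && (x.2 < h).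
Proof.
elim: w => [|w IH]; first by rewrite /snake /= in_nil; lia.
by rewrite snakeS mem_cat IH mem_column; lia.
Qed.

Lemma size_snake h i w up : size (snake h i w up) = w * h.
Proof.
elim: w => [|w IH]; first by [].
by rewrite snakeS size_cat IH size_map size_iota; lia.
Qed.

Lemma zigzagS h : zigzag h.+1 = zigzag h ++ [:: (0, h); (1, h)].
Proof. by rewrite /zigzag -(addn1 h) iotaD map_cat flatten_cat. Qed.

Lemma walk_zigzag h : 0 < h -> walk (0, 0) (zigzag h) (1, h.-1).
Proof.
case: h => // h _; elim: h => [|h IH]; first by exists [:: (1, 0)].
rewrite zigzagS; apply: walk_cat IH _ (_ : walk (0, h.+1) _ _).
  by rewrite /wadj /absdiff /=; lia.
by exists [:: (1, h.+1)]; split=> //=; rewrite /wadj /absdiff /=; lia.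
Qed.

Lemma mem_zigzag h x : (x \in zigzag h) = (x.1 < 2) && (x.2 < h).
Proof.
elim: h => [|h IH]; first by rewrite /zigzag /= in_nil; lia.
rewrite zigzagS mem_cat IH !inE; case: (x) => a b /=.
by rewrite !xpair_eqE; lia.
Qed.

Lemma size_zigzag h : size (zigzag h) = 2 * h.
Proof. by elim: h => // h IH; rewrite zigzagS size_cat IH /=; lia. Qed.

Lemma mem_grid_path d w h x : (x \in grid_path d w h) = (x.1 < w) && (x.2 < h).
Proof.
rewrite /grid_path; case: ifP => hd; last by rewrite mem_snake.
by rewrite mem_cat mem_zigzag mem_snake; lia.
Qed.

Lemma size_grid_path d w h : size (grid_path d w h) = w * h.
Proof.
rewrite /grid_path; case: ifP => hd; last by rewrite size_snake.
by rewrite size_cat size_zigzag size_snake -mulnDl; congr muln; lia.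
Qed.

(** The list contains all [w * h] cells and has exactly that length, so no cell can repeat. *)
Lemma uniq_grid_path d w h : uniq (grid_path d w h).
Proof.
apply: (@leq_size_uniq _ [seq (i, j) | i <- iota 0 w, j <- iota 0 h]).
- by apply: allpairs_uniq => [||[? ?] [? ?]] //; apply: iota_uniq.
- by move=> x /allpairsP[[i j] [/=]]; rewrite !mem_iota mem_grid_path => ? ? -> /=; lia.
- by rewrite size_grid_path size_allpairs !size_iota.
Qed.

(** A column snake that starts low ends high exactly for odd [w]. For the wrong parity the zigzag
    ends on the high side of the second column, and the remaining [w - 2] columns are traversed
    starting high, which reverses the final side. Only a single column of height above one cannot
    end on the side where it starts, whence the disjunction. *)
Lemma walk_grid_path d w h : 0 < w -> 0 < h -> [|| d, 1 < w | h == 1] ->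
  walk (0, 0) (grid_path d w h) (w.-1, side h d).
Proof.
move=> w0 h0 hd; rewrite /grid_path; case: ifP => hz.
  (* For [w = 2] nothing remains after the zigzag, which already ends in the required corner. *)
  case: (ltnP 2 w) => w2; last first.
    have ew : w = 2 by lia.
    move: hz; rewrite ew; case: (d) => //= _.
    by rewrite /snake /= cats0; apply: walk_zigzag.
  have := @walk_snake h 2 (w - 2) true h0 ltac:(lia).
  have -> : odd (w - 2) (+) true = d by rewrite oddB //=; case: d hz {hd}; case: (odd w).
  have -> : 2 + (w - 2).-1 = w.-1 by lia.
  by apply: walk_cat (walk_zigzag h0) _; rewrite /wadj /absdiff /side /=; lia.
have := @walk_snake h 0 w false h0 w0; rewrite addbF add0n.
suff -> : side h (odd w) = side h d by [].
move: hz => /negbT; rewrite negb_and negbK -leqNgt => /orP[/eqP-> //|w1].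
have -> : w = 1 by lia.
by case: d hd => //=; rewrite ltnNge w1 /= => /eqP->.
Qed.

Inductive kind := Diag | Horiz | Vert.

Definition flips_x k := if k is Vert then false else true.
Definition flips_y k := if k is Horiz then false else true.

(* The rectangle [x1 < x <= x2], [y1 < y <= y2]; traversed from the corner chosen
   by [ex] and [ey] ([true] for the high side) to the opposite corner, or to the
   neighbouring corner in horizontal or vertical direction. *)
Record block := Block { x1 : nat; x2 : nat; y1 : nat; y2 : nat;
                        ex : bool; ey : bool; kd : kind }.

Definition corner (lo hi : nat) (b : bool) := if b then hi else lo.+1.
Definition coord (lo hi : nat) (b : bool) (i : nat) := if b then hi - i else lo.+1 + i.

Definition entry b := (corner (x1 b) (x2 b) (ex b), corner (y1 b) (y2 b) (ey b)).
Definition exit b := (corner (x1 b) (x2 b) (flips_x (kd b) (+) ex b),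
                      corner (y1 b) (y2 b) (flips_y (kd b) (+) ey b)).

Definition in_block b (v : vertex) := (x1 b < v.1 <= x2 b) && (y1 b < v.2 <= y2 b).

Definition block_path b : seq vertex :=
  let w := x2 b - x1 b in let h := y2 b - y1 b in
  match kd b with
  | Diag => [seq (coord (x1 b) (x2 b) (ex b) c.1, coord (y1 b) (y2 b) (ey b) c.2)
            | c <- grid_path true w h]
  | Horiz => [seq (coord (x1 b) (x2 b) (ex b) c.1, coord (y1 b) (y2 b) (ey b) c.2)
             | c <- grid_path false w h]
  | Vert => [seq (coord (x1 b) (x2 b) (ex b) c.2, coord (y1 b) (y2 b) (ey b) c.1)
            | c <- grid_path false h w]
  end.

Definition nonempty b := (x1 b < x2 b) && (y1 b < y2 b).

(** The side condition of [walk_grid_path]; for [Vert] the grid is transposed, so width and height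
    change roles. *)
Definition block_wf b :=
  match kd b with
  | Diag => true
  | Horiz => (1 < x2 b - x1 b) || (y2 b - y1 b == 1)
  | Vert => (1 < y2 b - y1 b) || (x2 b - x1 b == 1)
  end.

Lemma size_block_path b : size (block_path b) = (x2 b - x1 b) * (y2 b - y1 b).
Proof. by rewrite /block_path; case: kd; rewrite size_map size_grid_path // mulnC. Qed.

Lemma mem_block_path b v : (v \in block_path b) = in_block b v.
Proof.
case: b v => a1 a2 b1 b2 e f k [x y]; rewrite /block_path /in_block /=.
have cP lo hi s z : (lo < z <= hi) = ((if s then hi - z else z - lo.+1) < hi - lo)
    && (coord lo hi s (if s then hi - z else z - lo.+1) == z).
  by rewrite /coord; case: s; lia.
have hc lo hi s i : i < hi - lo -> lo < coord lo hi s i <= hi.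
  by rewrite /coord; case: s; lia.
case: k; apply/mapP/andP => [[[i j]]|].
- by rewrite mem_grid_path /= => /andP[hi hj] [-> ->]; rewrite !hc.
- rewrite (cP _ _ e) (cP _ _ f) => -[/andP[h1 /eqP e1] /andP[h2 /eqP e2]].
  by exists (if e then a2 - x else x - a1.+1, if f then b2 - y else y - b1.+1);
    rewrite ?mem_grid_path /= ?h1 ?h2 // e1 e2.
- by rewrite mem_grid_path /= => /andP[hi hj] [-> ->]; rewrite !hc.
- rewrite (cP _ _ e) (cP _ _ f) => -[/andP[h1 /eqP e1] /andP[h2 /eqP e2]].
  by exists (if e then a2 - x else x - a1.+1, if f then b2 - y else y - b1.+1);
    rewrite ?mem_grid_path /= ?h1 ?h2 // e1 e2.
- by rewrite mem_grid_path /= => /andP[hi hj] [-> ->]; rewrite !hc.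
- rewrite (cP _ _ e) (cP _ _ f) => -[/andP[h1 /eqP e1] /andP[h2 /eqP e2]].
  by exists (if f then b2 - y else y - b1.+1, if e then a2 - x else x - a1.+1);
    rewrite ?mem_grid_path /= ?h1 ?h2 // e1 e2.
Qed.

Lemma coord_inj lo hi s i j : i < hi - lo -> j < hi - lo ->
  coord lo hi s i = coord lo hi s j -> i = j.
Proof. by rewrite /coord; case: s; lia. Qed.

Lemma coord_close lo hi s i j : i < hi - lo -> j < hi - lo ->
  absdiff i j <= 1 -> absdiff (coord lo hi s i) (coord lo hi s j) <= 1.
Proof. by rewrite /coord /absdiff; case: s; lia. Qed.

Lemma uniq_block_path b : uniq (block_path b).
Proof.
rewrite /block_path; case: kd; rewrite map_inj_in_uniq ?uniq_grid_path //;
  move=> [i j] [i' j']; rewrite !mem_grid_path /=;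
  by move=> /andP[? ?] /andP[? ?] [/coord_inj-> // /coord_inj->].
Qed.

Lemma coord0 lo hi s : coord lo hi s 0 = corner lo hi s.
Proof. by rewrite /coord /corner; case: s; lia. Qed.

Lemma coord_side lo hi s d : lo < hi ->
  coord lo hi s (side (hi - lo) d) = corner lo hi (d (+) s).
Proof. by rewrite /coord /corner /side; case: s; case: d => /=; lia. Qed.

Lemma walk_block b : nonempty b -> block_wf b -> walk (entry b) (block_path b) (exit b).
Proof.
case: b => a1 a2 b1 b2 e f k; rewrite /nonempty /block_wf /entry /exit /block_path /=.
move=> /andP[ha hb].
pose g c := (coord a1 a2 e c.1, coord b1 b2 f c.2).
pose g' c := (coord a1 a2 e c.2, coord b1 b2 f c.1).
case: k => /= hk.
- rewrite -[~~ e]addTb -[~~ f]addTb -(coord_side _ _ ha) -(coord_side _ _ hb) -!coord0.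
  apply: (@walk_map g (0, 0) _ (side (a2 - a1) true, side (b2 - b1) true)).
    move=> [i j] [i' j']; rewrite !mem_grid_path /= => /andP[? ?] /andP[? ?] /andP[/= ? ?].
    by rewrite /wadj !coord_close.
  by apply: walk_grid_path => //; lia.
- rewrite -[~~ e]addTb -(coord_side _ _ ha) -!coord0.
  apply: (@walk_map g (0, 0) _ (side (a2 - a1) true, side (b2 - b1) false)).
    move=> [i j] [i' j']; rewrite !mem_grid_path /= => /andP[? ?] /andP[? ?] /andP[/= ? ?].
    by rewrite /wadj !coord_close.
  by apply: walk_grid_path => //; lia.
- rewrite -[~~ f]addTb -(coord_side _ _ hb) -!coord0.
  apply: (@walk_map g' (0, 0) _ (side (b2 - b1) true, side (a2 - a1) false)).
    move=> [i j] [i' j']; rewrite !mem_grid_path /= => /andP[? ?] /andP[? ?] /andP[/= ? ?].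
    by rewrite /wadj !coord_close.
  by apply: walk_grid_path => //; lia.
Qed.

(** * Paths composed of rectangles *)

Definition plan_path (bs : seq block) : seq vertex := flatten (map block_path bs).

(** [cur] is the exit of the last nonempty block, and [None] before the first one. Empty blocks are
    skipped, so that a template still serves classes in which some of its cuts coincide. *)
Fixpoint linked (s t : vertex) (cur : option vertex) (bs : seq block) : Prop :=
  match bs with
  | [::] => cur = Some t
  | b :: bs =>
    if nonempty b then
      [/\ block_wf b,
          if cur is Some c then wadj c (entry b) else entry b = s
        & linked s t (Some (exit b)) bs]
    else linked s t cur bs
  end.

Lemma block_path_nil b : ~~ nonempty b -> block_path b = [::].
Proof. by rewrite /nonempty => hb; apply: size0nil; rewrite size_block_path; nia. Qed.

Lemma linked_walk s t bs : linked s t None bs -> walk s (plan_path bs) t.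
Proof.
have H c u p : walk u p c -> forall bs', linked s t (Some c) bs' ->
    walk u (p ++ plan_path bs') t.
  move=> hw bs'; elim: bs' c p hw => [|b bs' IH] c p hw /=.
    by move=> [<-]; rewrite cats0.
  rewrite /plan_path /=; case: ifP => [nb [wb ac hl]|/negbT/block_path_nil-> /=].
    rewrite catA; apply: IH hl; apply: walk_cat hw ac _; exact: walk_block.
  exact: IH.
elim: bs => //= b bs IH; case: ifP => [nb [wb es hl]|/negbT/block_path_nil eb].
  by apply: (H (exit b) s (block_path b)) hl; rewrite -es; apply: walk_block.
by rewrite /plan_path /= eb.
Qed.

Lemma mem_plan_path bs v : (v \in plan_path bs) = has (in_block^~ v) bs.
Proof.
by elim: bs => //= b bs IH; rewrite mem_cat mem_block_path -IH.
Qed.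

Definition disjoint_blocks b b' :=
  [|| x2 b <= x1 b', x2 b' <= x1 b, y2 b <= y1 b' | y2 b' <= y1 b].

Lemma uniq_plan_path bs :
  pairwise (fun b b' => [|| ~~ nonempty b, ~~ nonempty b' | disjoint_blocks b b']) bs ->
  uniq (plan_path bs).
Proof.
elim: bs => //= b bs IH /andP[hb hbs].
rewrite /plan_path /= cat_uniq uniq_block_path -/(plan_path bs) IH // andbT /=.
apply/hasPn => v; rewrite mem_plan_path mem_block_path.
elim: bs {IH hbs} hb => //= b' bs IH /andP[hb /IH{}IH] /orP[hv|//].
by move: hb hv; rewrite /nonempty /disjoint_blocks /in_block; lia.
Qed.

(** The same record has sides given by names in a template, by ranks in a class and by coordinates
    in a configuration; [place] leads from the first level to the others. *)
Definition place (f g : nat -> nat) (b : block) : block :=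
  Block (f (x1 b)) (f (x2 b)) (g (y1 b)) (g (y2 b)) (ex b) (ey b) (kd b).

(** * Classes of configurations and symbolic validity of templates *)

(* Names of the cut values on an axis: [0], [p - 1], [p], [q - 1], [q], [A], [A + 1],
   the length and [1], where [p] and [q] are the coordinates of [s] and [t]. *)
Notation nZ := 0 (only parsing).
Notation nPm := 1 (only parsing).
Notation nP := 2 (only parsing).
Notation nQm := 3 (only parsing).
Notation nQ := 4 (only parsing).
Notation nA := 5 (only parsing).
Notation nA1 := 6 (only parsing).
Notation nM := 7 (only parsing).
Notation nOne := 8 (only parsing).

Definition axis_values (p q A M : nat) : nat -> nat :=
  nth 0 [:: 0; p.-1; p; q.-1; q; A; A.+1; M; 1].

Inductive link := LEq | LSucc | LLt | LLe.

Definition link_holds l x y :=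
  match l with LEq => y == x | LSucc => y == x.+1 | LLt => x < y | LLe => x <= y end.

(* A chain lists names with nondecreasing values, each related to its predecessor. *)
Fixpoint chain_holds (v : nat -> nat) (prev : nat) (ch : seq (link * nat)) : bool :=
  if ch is (l, n) :: ch' then link_holds l (v prev) (v n) && chain_holds v n ch' else true.

(** Only [LLe] is split. A strict link says nothing more about the gap: it may still have length
    one, and a template has to work for every length. *)
Fixpoint refine (ch : seq (link * nat)) : seq (seq (link * nat)) :=
  match ch with
  | [::] => [:: [::]]
  | (LLe, n) :: ch' =>
    map (cons (LEq, n)) (refine ch') ++ map (cons (LLt, n)) (refine ch')
  | x :: ch' => map (cons x) (refine ch')
  end.

Lemma refine_complete v prev ch :
  chain_holds v prev ch -> has (chain_holds v prev) (refine ch).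
Proof.
elim: ch prev => //= -[l n] ch IH prev /andP[hl /IH{}IH].
case: l hl => /= hl; rewrite ?has_cat !has_map.
- by apply: sub_has IH => c hc /=; rewrite hl.
- by apply: sub_has IH => c hc /=; rewrite hl.
- by apply: sub_has IH => c hc /=; rewrite hl.
move: hl; rewrite leq_eqVlt eq_sym => /orP[hl|hl]; apply/orP; [left|right];
  by apply: sub_has IH => c hc /=; rewrite hl.
Qed.

(** With [p < q] the cases are: [q <= A]; [p <= A] and [q = A + 1]; [p <= A] and [q > A + 1];
    [p = A + 1]; [p > A + 1]. The width of an arm must be recognisable as one. If [p <= A], then
    [A = 1] shows as [p - 1 = 0] and [p = A]. If both ends lie beyond [A], the additional cut 1
    makes it visible, and it also gives the templates a line to cut along. *)
Definition ordered_types (pm p qm q : nat) : seq (seq (link * nat)) :=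
  [:: [:: (LLe, pm); (LSucc, p); (LLe, qm); (LSucc, q); (LLe, nA); (LSucc, nA1); (LLe, nM)];
      [:: (LLe, pm); (LSucc, p); (LLe, nA); (LEq, qm); (LSucc, q); (LEq, nA1); (LLe, nM)];
      [:: (LLe, pm); (LSucc, p); (LLe, nA); (LSucc, nA1); (LLe, qm); (LSucc, q); (LLe, nM)];
      [:: (LSucc, nOne); (LLe, nA); (LEq, pm); (LSucc, p); (LEq, nA1); (LLe, qm); (LSucc, q);
          (LLe, nM)];
      [:: (LSucc, nOne); (LLe, nA); (LSucc, nA1); (LLe, pm); (LSucc, p); (LLe, qm); (LSucc, q);
          (LLe, nM)]].

Definition axis_types : seq (seq (link * nat)) :=
  ordered_types nPm nP nQm nQ ++ ordered_types nQm nQ nPm nP ++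
  [:: [:: (LLe, nPm); (LEq, nQm); (LSucc, nP); (LEq, nQ); (LLe, nA); (LSucc, nA1); (LLe, nM)];
      [:: (LSucc, nOne); (LLe, nA); (LEq, nPm); (LEq, nQm); (LSucc, nP); (LEq, nQ); (LEq, nA1);
          (LLe, nM)];
      [:: (LSucc, nOne); (LLe, nA); (LSucc, nA1); (LLe, nPm); (LEq, nQm); (LSucc, nP); (LEq, nQ);
          (LLe, nM)]].

Lemma axis_types_complete p q A M : 0 < p <= M -> 0 < q <= M -> 0 < A < M ->
  has (chain_holds (axis_values p q A M) nZ) axis_types.
Proof.
move=> hp hq hA.
pose i := if p < q then
            if q <= A then 0 else if p <= A then if q == A.+1 then 1 else 2
            else if p == A.+1 then 3 else 4
          else if q < p then
            if p <= A then 5 else if q <= A then if p == A.+1 then 6 else 7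
            else if q == A.+1 then 8 else 9
          else if p <= A then 10 else if p == A.+1 then 11 else 12.
apply/(has_nthP [::]); exists i; rewrite /i;
  by repeat (case: ifP => ?); rewrite /= /axis_values /=; lia.
Qed.

(* [ranks] maps a name to the index of its value among the distinct values of the chain;
   [units] tells which consecutive distinct values differ by exactly one. *)
Record axis := Axis { ranks : seq nat; units : seq bool }.

(** A name that does not occur receives a rank beyond [width], so [check_from] and [atom_forced]
    reject its use. *)
Fixpoint rank_in (nm r : nat) (ch : seq (link * nat)) : nat :=
  if ch is (l, n) :: ch' then
    let r' := if l is LEq then r else r.+1 in
    if n == nm then r' else rank_in nm r' ch'
  else r.+1.

Definition is_succ l := if l is LSucc then true else false.
Definition is_eq l := if l is LEq then true else false.

Definition axis_of (ch : seq (link * nat)) : axis :=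
  Axis (0 :: [seq rank_in nm 0 ch | nm <- iota 1 8])
       [seq is_succ x.1 | x <- ch & ~~ is_eq x.1].

Definition width (X : axis) := size (units X).
Definition rk (X : axis) (nm : nat) := nth (width X).+1 (ranks X) nm.
Definition un (X : axis) (a : nat) := nth false (units X) a.

(* [(a, b)] is the first ([b = false]) or last coordinate of the [a]-th interval; in an
   interval of length one the last coordinate is represented by [(a, false)]. *)
Definition position : Type := nat * bool.

Definition corner_position X u v (sd : bool) : position :=
  let a := if sd then v.-1 else u in (a, sd && ~~ un X a).

(** Closeness that holds in every configuration of the class: equal positions of one interval, or
    the last coordinate before a cut and the first one after it. In a unit interval the first
    coordinate is also the last, hence [un]. *)
Definition close X (P Q : position) : bool :=
  if P.1 == Q.1 then P.2 == Q.2
  else if Q.1 == P.1.+1 then (P.2 || un X P.1) && ~~ Q.2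
  else if P.1 == Q.1.+1 then ~~ P.2 && (Q.2 || un X Q.1)
  else false.

Definition one_wide X u v := (v == u.+1) && un X u.

Definition wf_ranks X Y (b : block) :=
  match kd b with
  | Diag => true
  | Horiz => ((x1 b).+1 < x2 b) || one_wide Y (y1 b) (y2 b)
  | Vert => ((y1 b).+1 < y2 b) || one_wide X (x1 b) (x2 b)
  end.

(* Names of the lower and upper cuts in both directions. *)
Definition window : Type := (nat * nat) * (nat * nat).

Definition inside (X Y : axis) (w : window) (b : block) : bool :=
  [&& rk X w.1.1 <= x1 b, x2 b <= rk X w.1.2, rk Y w.2.1 <= y1 b, y2 b <= rk Y w.2.2
    & (x2 b <= rk X nA) || (y2 b <= rk Y nA)].

(** The cuts divide the window into cells and blocks are unions of cells, so coverage is tested cell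
    by cell. As [nA] is a cut on each axis, a cell lies wholly inside the region or wholly
    outside. *)
Definition covered (X Y : axis) (w : window) (bs : seq block) : bool :=
  all (fun i => all (fun j => ((i < rk X nA) || (j < rk Y nA)) ==>
         has (fun b => [&& x1 b <= i, i < x2 b, y1 b <= j & j < y2 b]) bs)
       (iota (rk Y w.2.1) (rk Y w.2.2 - rk Y w.2.1)))
    (iota (rk X w.1.1) (rk X w.1.2 - rk X w.1.1)).

(** The coordinates of [s] and [t] are the first ones after the cuts [nPm] and [nQm]; this gives
    positions such as [(rk X nQm, false)]. The list [done] keeps the earlier nonempty blocks, for
    disjointness and for the final coverage test. *)
Fixpoint check_from (X Y : axis) (w : window) (cur : option (position * position))
    (done bs : seq block) : bool :=
  match bs with
  | [::] =>
    if cur is Some (c, d) then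
      [&& c == (rk X nQm, false), d == (rk Y nQm, false) & covered X Y w done]
    else false
  | b0 :: bs' =>
    let b := place (rk X) (rk Y) b0 in
    [&& x1 b <= width X, x2 b <= width X, y1 b <= width Y, y2 b <= width Y &
    if nonempty b then
      let e := corner_position X (x1 b) (x2 b) (ex b) in
      let f := corner_position Y (y1 b) (y2 b) (ey b) in
      [&& if cur is Some (c, d) then close X c e && close Y d f
          else (e == (rk X nPm, false)) && (f == (rk Y nPm, false)),
          inside X Y w b, wf_ranks X Y b, all (disjoint_blocks b) done &
          check_from X Y w
            (Some (corner_position X (x1 b) (x2 b) (flips_x (kd b) (+) ex b),
                   corner_position Y (y1 b) (y2 b) (flips_y (kd b) (+) ey b)))
            (b :: done) bs']
    else check_from X Y w cur done bs']
  end.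

Definition check X Y w bs := check_from X Y w None [::] bs.

(** * Relations between cuts and the windows they impose *)

Inductive relation := REq | RLt | RSucc | RGe2.
Definition atom : Type := bool * relation * nat * nat.

Definition atom_holds (vx vy : nat -> nat) (a : atom) : bool :=
  let: (ax, r, u, u') := a in let v := if ax then vy else vx in
  match r with
  | REq => v u' == v u | RLt => v u < v u' | RSucc => v u' == (v u).+1
  | RGe2 => (v u).+1 < v u'
  end.

Definition atom_forced (X Y : axis) (a : atom) : bool :=
  let: (ax, r, u, u') := a in let Z := if ax then Y else X in
  [&& rk Z u <= width Z, rk Z u' <= width Z &
  match r with
  | REq => rk Z u' == rk Z u | RLt => rk Z u < rk Z u' | RSucc => one_wide Z (rk Z u) (rk Z u')
  | RGe2 => (rk Z u).+1 < rk Z u'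
  end].

Notation "u =x v" := (false, REq, u, v) (at level 70).
Notation "u <x v" := (false, RLt, u, v) (at level 70).
Notation "u +1x v" := (false, RSucc, u, v) (at level 70).
Notation "u +2x v" := (false, RGe2, u, v) (at level 70).
Notation "u =y v" := (true, REq, u, v) (at level 70).
Notation "u <y v" := (true, RLt, u, v) (at level 70).
Notation "u +1y v" := (true, RSucc, u, v) (at level 70).
Notation "u +2y v" := (true, RGe2, u, v) (at level 70).

(* If the atoms hold then no (s,t)-path has more vertices than the largest of the windows;
   no window means that the atoms are contradictory for a valid configuration. *)
Definition clause_windows : Type := seq atom * seq window.

Definition flip_atom (a : atom) : atom := let: (ax, r, u, v) := a in (~~ ax, r, u, v).
Definition flip_clause (c : clause_windows) : clause_windows :=
  (map flip_atom c.1, [seq (w.2, w.1) | w : window <- c.2]).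
Definition swap_name (n : nat) : nat := nth n [:: 0; 3; 4; 1; 2] n.
Definition swap_atom (a : atom) : atom :=
  let: (ax, r, u, v) := a in (ax, r, swap_name u, swap_name v).
Definition swap_window (w : window) : window :=
  ((swap_name w.1.1, swap_name w.1.2), (swap_name w.2.1, swap_name w.2.2)).
Definition swap_clause (c : clause_windows) : clause_windows :=
  (map swap_atom c.1, map swap_window c.2).

(** Classes are paired independently on the two axes, so some pairs belong to no configuration:
    equal ends, or an end in the removed corner. *)
Definition excluded : seq clause_windows :=
  [:: ([:: nP =x nQ; nP =y nQ], [::]);
      ([:: nA <x nP; nA <y nP], [::]);
      ([:: nA <x nQ; nA <y nQ], [::])].

(** An arm of width one that reaches beyond both ends of the path and beyond the row next to the
    corner, as trimming never leaves it. *)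
Definition untrimmed : clause_windows :=
  ([:: nZ +1x nA; nA1 <y nM; nP <y nM; nQ <y nM], [::]).

Definition halves : seq window :=
  [:: ((nZ, nP), (nZ, nM)); ((nPm, nM), (nZ, nM))].

(* [s] and [t] both lie in the arm of width one. *)
Definition segment_clause : clause_windows :=
  ([:: nZ +1x nA; nA <y nP; nP <y nQ], [:: ((nZ, nA), (nPm, nQ))]).
(* [s] and [t] fill a column of height two, left of the corner or in the right arm. *)
Definition cut_low_clause : clause_windows :=
  ([:: nP =x nQ; nZ <x nPm; nP <x nA; nA1 =y nM; nZ +1y nA], halves).
Definition cut_arm_clause : clause_windows :=
  ([:: nP =x nQ; nA <x nP; nP <x nM; nZ =y nPm; nP =y nQm; nQ =y nA], halves).
(* The only vertex beyond the corner has just two neighbours. *)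
Definition pendant_clause : clause_windows :=
  ([:: nZ +1x nA; nP =x nA; nQ =x nA1; nA1 =y nM; nZ +2y nA; nP =y nA; nQ =y nA],
   [:: ((nZ, nM), (nZ, nA))]).
(** The atoms supplied below make [B = 2] and put [s] and [t] on a diagonal of the square of side
    two at the origin. A path through the pendant vertex then either has at most five vertices or
    misses [(1, 1)], for which the pendant vertex can be exchanged. *)
Definition pendant_diag_clause (c : seq atom) : clause_windows :=
  ([:: nZ +1x nA; nP =x nA; nQ =x nA1; nA1 <x nM; nA1 =y nM] ++ c, [:: ((nZ, nM), (nZ, nA))]).

Definition one_sided_clauses : seq clause_windows :=
  [:: segment_clause; swap_clause segment_clause; cut_low_clause;
      cut_arm_clause; swap_clause cut_arm_clause;
      pendant_clause; swap_clause pendant_clause;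
      pendant_diag_clause [:: nZ =y nPm; nP =y nQm; nQ =y nA];
      pendant_diag_clause [:: nZ =y nQm; nQ =y nPm; nP =y nA];
      swap_clause (pendant_diag_clause [:: nZ =y nPm; nP =y nQm; nQ =y nA]);
      swap_clause (pendant_diag_clause [:: nZ =y nQm; nQ =y nPm; nP =y nA])].

Definition full_window : window := ((nZ, nM), (nZ, nM)).

Definition clauses : seq clause_windows :=
  excluded ++ [:: untrimmed; flip_clause untrimmed] ++ one_sided_clauses ++
  map flip_clause one_sided_clauses.

(** The first forced clause decides. Contradictory pairs come first in [clauses] and get no window,
    so no template is demanded for them. *)
Fixpoint windows_in (X Y : axis) (cs : seq clause_windows) : seq window :=
  if cs is c :: cs' then if all (atom_forced X Y) c.1 then c.2 else windows_in X Y cs'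
  else [:: full_window].

Definition windows X Y := windows_in X Y clauses.

Definition flip_block (b : block) : block :=
  Block (y1 b) (y2 b) (x1 b) (x2 b) (ey b) (ex b)
    (match kd b with Diag => Diag | Horiz => Vert | Vert => Horiz end).
Definition reverse_block (b : block) : block :=
  Block (swap_name (x1 b)) (swap_name (x2 b)) (swap_name (y1 b)) (swap_name (y2 b))
    (flips_x (kd b) (+) ex b) (flips_y (kd b) (+) ey b) (kd b).

(** [z a] is the [a]-th distinct cut of an actual configuration. A gap not marked as unit is only
    known to be positive, and a name whose rank is out of range has no prescribed value. *)
Definition fits (X : axis) (v z : nat -> nat) : Prop :=
  (forall a, a < width X -> if un X a then z a.+1 = (z a).+1 else z a < z a.+1) /\
  (forall nm, rk X nm <= width X -> v nm = z (rk X nm)).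

Definition strict (ch : seq (link * nat)) : bool :=
  all (fun x => if x.1 is LLe then false else true) ch.

Lemma refine_strict ch : all strict (refine ch).
Proof.
elim: ch => //= -[[] n] ch IH /=; rewrite ?all_cat !all_map ?andbb //;
  by apply: sub_all IH => c.
Qed.

Lemma rank_in_ge nm r ch : r <= rank_in nm r ch.
Proof.
elim: ch r => [|[l n] ch IH] r /=; first by [].
by case: ifP => _; case: l => //; apply: leq_trans (IH _).
Qed.

Definition marks (v : nat -> nat) (ch : seq (link * nat)) : seq nat :=
  [seq v x.2 | x <- ch & ~~ is_eq x.1].

Lemma rank_in_value v prev ch nm r : chain_holds v prev ch ->
  rank_in nm r ch <= r + size (marks v ch) ->
  v nm = nth 0 (v prev :: marks v ch) (rank_in nm r ch - r).
Proof.
elim: ch prev r => [|[l n] ch IH] prev r /=; first by rewrite addn0 ltnn.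
move=> /andP[hl hc]; have {}IH r' := IH n r' hc.
have ge := rank_in_ge nm r.+1 ch.
rewrite /marks /= -/(marks v ch); case: l hl => /= /eqP hl.
- case: eqP => [<-|_] h; first by rewrite subnn.
  by rewrite -hl (IH r).
all: case: eqP => [<-|_] h; first by rewrite subSnn.
all: rewrite (IH r.+1) ?addSn -?addnS //.
all: by have -> : rank_in nm r.+1 ch - r = (rank_in nm r.+1 ch - r.+1).+1 by lia.
Qed.

Lemma marks_steps v prev ch : strict ch -> chain_holds v prev ch ->
  forall a, a < size (marks v ch) ->
  let Z := nth 0 (v prev :: marks v ch) in
  if nth false [seq is_succ x.1 | x <- ch & ~~ is_eq x.1] a
  then Z a.+1 = (Z a).+1 else Z a < Z a.+1.
Proof.
elim: ch prev => //= -[l n] ch IH prev; rewrite /marks /=.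
case: l => //= hs /andP[hl hc] [|a] //=; move: (IH n hs hc); rewrite /marks.
- by move=> h ha; have := h 0 ha; rewrite /= (eqP hl).
- by move=> h ha; have := h a.+1 ha.
- by rewrite (eqP hl).
- by move=> h ha; have := h a ha.
- by move=> h ha; have := h a ha.
Qed.

Lemma axis_of_fits v ch : v 0 = 0 -> strict ch -> chain_holds v 0 ch ->
  fits (axis_of ch) v (nth 0 (v 0 :: marks v ch)).
Proof.
move=> v0 hs hc.
have ew : width (axis_of ch) = size (marks v ch) by rewrite /width /= !size_map.
split=> [a|nm]; rewrite ew; first by move=> /(marks_steps hs hc).
case: nm => [|nm] //.
have -> : rk (axis_of ch) nm.+1
    = nth (width (axis_of ch)).+1 [seq rank_in k 0 ch | k <- iota 1 8] nm by [].
case: (ltnP nm 8) => hn.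
  rewrite (nth_map 0) ?size_iota // nth_iota // => h.
  by rewrite (rank_in_value (r := 0) hc) ?subn0 ?add0n.
by rewrite nth_default; [rewrite ew ltnn|rewrite size_map size_iota].
Qed.

Section Fits.
Variables (X : axis) (v z : nat -> nat).
Hypothesis fX : fits X v z.

Lemma fits_step a : a < width X -> z a < z a.+1.
Proof. by move=> /fX.1; case: ifP => // _ ->. Qed.

Lemma fits_le a b : a <= b <= width X -> z a <= z b.
Proof.
elim: b => [|b IH] h; first by have -> : a = 0 by lia.
case: (eqVneq a b.+1) => [-> //|ne].
by apply: leq_trans (IH _) (ltnW (fits_step _)); lia.
Qed.

Lemma fits_lt a b : a <= width X -> b <= width X -> (z a < z b) = (a < b).
Proof.
move=> ha hb; case: (ltnP a b) => h.
  by apply: leq_trans (fits_step _) (fits_le _); lia.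
by have := @fits_le b a; lia.
Qed.

Lemma fits_leq a b : a <= width X -> b <= width X -> (z a <= z b) = (a <= b).
Proof. by move=> ha hb; have := fits_lt hb ha; lia. Qed.

Lemma fits_ge2 a b : b <= width X -> a.+1 < b -> (z a).+1 < z b.
Proof.
move=> hb hab; have := @fits_step a; have := @fits_lt a.+1 b; lia.
Qed.

Lemma fits_one_wide a b : b <= width X -> one_wide X a b -> z b = (z a).+1.
Proof. by move=> hb /andP[/eqP eb u]; subst b; have := fX.1 _ hb; rewrite u. Qed.

Definition position_value (P : position) := if P.2 then z P.1.+1 else (z P.1).+1.

Lemma corner_position_value a b sd : a < b <= width X ->
  position_value (corner_position X a b sd) = corner (z a) (z b) sd.
Proof.
move=> /andP[hab hb]; rewrite /position_value /corner_position /corner /=.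
case: sd => //=; have e : b.-1.+1 = b by lia.
have := fX.1 b.-1; rewrite e => /(_ hb); case: (un X b.-1) => //=.
Qed.

Lemma close_value P Q : P.1 < width X -> Q.1 < width X -> close X P Q ->
  absdiff (position_value P) (position_value Q) <= 1.
Proof.
case: P Q => [a s] [b t]; rewrite /close /position_value /absdiff /= => ha hb.
case: eqP => [->|_]; first by move/eqP->; lia.
case: eqP => [eb|_].
  move=> /andP[h1 /negbTE->]; subst b; have := fX.1 _ ha.
  by case: s h1 => /= [_|->]; lia.
case: eqP => // ea /andP[/negbTE-> h1]; subst a; have := fX.1 _ hb.
by case: t h1 => /= [_|->]; lia.
Qed.

Lemma atom_exists lo hi x : lo <= hi -> z lo < x <= z hi ->
  exists2 a, lo <= a < hi & z a < x <= z a.+1.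
Proof.
elim: hi => [|hi IH] hlo hx; first by move: hlo hx; rewrite leqn0 => /eqP->; lia.
case: (eqVneq lo hi.+1) => [e|ne]; first by subst lo; lia.
case: (leqP x (z hi)) => hxi; last by exists hi; lia.
by have [||a ha ha'] := IH; [lia|lia|exists a => //; lia].
Qed.
End Fits.

(** * From the symbolic check to an actual path *)

Section CheckSound.
Variables (X Y : axis) (vx zx vy zy : nat -> nat).
Hypotheses (fX : fits X vx zx) (fY : fits Y vy zy).

Definition bounded (b : block) :=
  [&& x1 b <= width X, x2 b <= width X, y1 b <= width Y & y2 b <= width Y].

Let ranked := place (rk X) (rk Y).
Let placed := place vx vy.

Lemma place_bounded b : bounded (ranked b) -> placed b = place zx zy (ranked b).
Proof.
case: b => a b c d e f k /and4P[/= h1 h2 h3 h4]; rewrite /placed /ranked /place /=.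
by rewrite (fX.2 _ h1) (fX.2 _ h2) (fY.2 _ h3) (fY.2 _ h4).
Qed.

Lemma nonempty_placed b : bounded (ranked b) -> nonempty (placed b) = nonempty (ranked b).
Proof.
move=> hb; rewrite place_bounded //; case/and4P: hb => h1 h2 h3 h4.
by rewrite /nonempty [x1 _]/= [x2 _]/= [y1 _]/= [y2 _]/= (fits_lt fX) // (fits_lt fY).
Qed.

Lemma disjoint_placed b b' : bounded (ranked b) -> bounded (ranked b') ->
  disjoint_blocks (ranked b) (ranked b') -> disjoint_blocks (placed b) (placed b').
Proof.
move=> hb hb'; rewrite !place_bounded //.
case/and4P: hb => h1 h2 h3 h4; case/and4P: hb' => h1' h2' h3' h4'.
rewrite /disjoint_blocks ![x1 (place _ _ _)]/= ![x2 (place _ _ _)]/= ![y1 (place _ _ _)]/=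
  ![y2 (place _ _ _)]/=.
by rewrite !(fits_leq fX) // !(fits_leq fY).
Qed.

Lemma check_from_ranked w cur done bs : check_from X Y w cur done bs ->
  let F := [seq b <- map ranked bs | nonempty b] in
  [/\ all (fun b => bounded (ranked b)) bs,
      pairwise (fun b b' => disjoint_blocks b' b) F && all (fun b => all (disjoint_blocks b)
        done) F,
      all (inside X Y w) F & covered X Y w (catrev F done)].
Proof.
elim: bs cur done => [|b0 bs IH] cur done /=.
  by case: cur => // -[c d] /and3P[].
rewrite -/(ranked b0); set b := ranked b0.
case/and5P=> h1 h2 h3 h4; have hb : bounded b by rewrite /bounded h1 h2 h3.
case: ifP => hn; last first.
  by move=> /IH[i1 i2 i3 i4]; rewrite -/ranked /= hb i1.
case/and5P=> _ hin _ hd /IH[i1 /andP[i2 i2'] i3 i4].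
rewrite /= hb i1 hin i3 hd i2 /=; split=> //.
have: all (predI (fun c => disjoint_blocks c b) (fun c => all (disjoint_blocks c) done))
       [seq b1 <- map ranked bs | nonempty b1].
  by apply: sub_all i2' => c /= /andP[-> ->].
by rewrite all_predI andbT => ->.
Qed.

Lemma wf_ranks_placed b : bounded (ranked b) -> nonempty (ranked b) ->
  wf_ranks X Y (ranked b) -> block_wf (placed b).
Proof.
move=> hb; rewrite place_bounded // /nonempty; case/and4P: hb => h1 h2 h3 h4.
case: (ranked b) h1 h2 h3 h4 => a1 a2 b1 b2 e f [] //= h1 h2 h3 h4 /andP[n1 n2];
  rewrite /block_wf /wf_ranks /= => /orP[h|h].
- by have := fits_ge2 fX h2 h; lia.
- by have := fits_one_wide fY h4 h; lia.
- by have := fits_ge2 fY h4 h; lia.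
- by have := fits_one_wide fX h2 h; lia.
Qed.

Lemma corner_position_lt Z a b sd : a < b <= width Z -> (corner_position Z a b sd).1 < width Z.
Proof. by rewrite /corner_position /=; case: sd; lia. Qed.

Lemma check_from_linked w cur done bs s t :
  s = ((vx nPm).+1, (vy nPm).+1) -> t = ((vx nQm).+1, (vy nQm).+1) ->
  rk X nPm <= width X -> rk Y nPm <= width Y -> rk X nQm <= width X -> rk Y nQm <= width Y ->
  (if cur is Some (c, d) then (c.1 < width X) && (d.1 < width Y) else true) ->
  check_from X Y w cur done bs ->
  linked s t (omap (fun c => (position_value zx c.1, position_value zy c.2)) cur)
    (map placed bs).
Proof.
move=> es et xp yp xq yq; elim: bs cur done => [|b0 bs IH] cur done /= hcur.
  case: cur hcur => // -[c d] _ /and3P[/eqP-> /eqP-> _] /=.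
  by rewrite et (fX.2 _ xq) (fY.2 _ yq).
rewrite -/(ranked b0) -/(placed b0); set b := ranked b0.
case/and5P=> h1 h2 h3 h4; have hb : bounded b by rewrite /bounded h1 h2 h3.
rewrite nonempty_placed //; case: ifP => hn; last exact: IH.
have /andP[n1 n2] := hn.
have wX : x1 b < x2 b <= width X by rewrite n1.
have wY : y1 b < y2 b <= width Y by rewrite n2.
case/and5P=> hl _ hw _ /IH{}IH; split.
- exact: wf_ranks_placed.
- rewrite place_bounded // /entry ![x1 _]/= ![x2 _]/= ![y1 _]/= ![y2 _]/= [ex _]/= [ey _]/=.
  rewrite -(corner_position_value fX) // -(corner_position_value fY) //.
  case: cur hcur hl => [[c d]|] /= => [/andP[hc hd] /andP[l1 l2]|_ /andP[/eqP-> /eqP->]].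
    by rewrite /wadj /= (close_value fX) ?(close_value fY) ?corner_position_lt.
  by rewrite es (fX.2 _ xp) (fY.2 _ yp).
- have := IH _; rewrite !corner_position_lt // => /(_ isT) /=.
  rewrite (corner_position_value fX) // (corner_position_value fY) //.
  by rewrite place_bounded.
Qed.

(** One evaluation of [check] on ranks certifies the path in every configuration of the class,
    because the cut values [zx] and [zy] increase strictly with the rank and respect the unit
    gaps. *)
Lemma check_sound w bs s t :
  s = ((vx nPm).+1, (vy nPm).+1) -> t = ((vx nQm).+1, (vy nQm).+1) ->
  all (fun nm => (rk X nm <= width X) && (rk Y nm <= width Y))
    [:: nPm; nQm; nA; w.1.1; w.1.2; w.2.1; w.2.2] ->
  check X Y w bs ->
  let P := plan_path (map placed bs) in
  [/\ walk s P t, uniq P &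
      P =i [pred v : vertex | [&& vx w.1.1 < v.1 <= vx w.1.2, vy w.2.1 < v.2 <= vy w.2.2
                              & (v.1 <= vx nA) || (v.2 <= vy nA)]]].
Proof.
move=> es et /= /and3P[/andP[xp yp] /andP[xq yq] /and5P[/andP[xA yA] /andP[x11 _]
  /andP[x12 _] /andP[_ y21] /andP[/andP[_ y22] _]]] hc; split.
- by apply: linked_walk; have := @check_from_linked w None [::] bs s t; apply.
- apply: uniq_plan_path; have [hb /andP[hp _] _ _] := check_from_ranked hc.
  elim: bs hb hp {hc} => //= b bs IH /andP[hb hbs] hp.
  apply/andP; split; last first.
    by apply: IH hbs _; move: hp; case: ifP => //= _ /andP[].
  rewrite all_map; move: hp; rewrite nonempty_placed //.
  case: ifP => hn /=; last by move=> _; apply/allT.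
  move=> /andP[hp _]; move: hp; rewrite all_filter all_map.
  elim: bs hbs {IH} => //= b' bs IH /andP[hb' /IH{}IH] /andP[hd /IH->]; rewrite andbT.
  rewrite nonempty_placed //; case: (nonempty _) hd => //= hd.
  have := disjoint_placed hb' hb hd; rewrite /disjoint_blocks; lia.
- move=> v; rewrite mem_plan_path inE.
  have [hb _ hi hcov] := check_from_ranked hc.
  apply/idP/idP.
    elim: bs hb hi {hc hcov} => //= b bs IH /andP[hb hbs] hi /orP[hv|]; last first.
      by apply: IH => //; move: hi; case: ifP => //= _ /andP[].
    have hn : nonempty (ranked b).
      by rewrite -nonempty_placed //; move: hv; rewrite /in_block /nonempty; lia.
    move: hi hv; rewrite hn => /= /andP[/and5P[i1 i2 i3 i4 i5] _].
    rewrite place_bounded // /in_block ![x1 (place zx _ _)]/= ![x2 (place zx _ _)]/=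
      ![y1 (place zx _ _)]/= ![y2 (place zx _ _)]/=.
    case/and4P: hb => b1 b2 b3 b4.
    rewrite (fX.2 _ x11) (fX.2 _ x12) (fY.2 _ y21) (fY.2 _ y22) (fX.2 _ xA) (fY.2 _ yA).
    have := fits_leq fX x11 b1; have := fits_leq fX b2 x12.
    have := fits_leq fY y21 b3; have := fits_leq fY b4 y22.
    rewrite i1 i2 i3 i4 => e1 e2 e3 e4; rewrite -!andbA => /and4P[v1 v2 v3 v4].
    rewrite (leq_ltn_trans e4) // (leq_trans v2) // (leq_ltn_trans e2) // (leq_trans v4) //=.
    case/orP: i5 => i5; apply/orP; [left|right].
      by apply: leq_trans v2 _; rewrite (fits_leq fX).
    by apply: leq_trans v4 _; rewrite (fits_leq fY).
  rewrite (fX.2 _ x11) (fX.2 _ x12) (fY.2 _ y21) (fY.2 _ y22) (fX.2 _ xA) (fY.2 _ yA).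
  case/and3P=> vx1 vy1 vA.
  have lx : rk X w.1.1 <= rk X w.1.2 by rewrite -(fits_leq fX) //; lia.
  have ly : rk Y w.2.1 <= rk Y w.2.2 by rewrite -(fits_leq fY) //; lia.
  (* Locate the cell that contains [v]; by [covered] some block contains this cell as a whole. *)
  have [i hi1 hi2] := atom_exists lx vx1.
  have [j hj1 hj2] := atom_exists ly vy1.
  have hij : (i < rk X nA) || (j < rk Y nA).
    have := @fits_leq _ _ _ fX (rk X nA) i; have := @fits_leq _ _ _ fY (rk Y nA) j; lia.
  move: hcov; rewrite catrevE cats0 => /allP/(_ i); rewrite mem_iota.
  move=> /(_ ltac:(lia)) /allP/(_ j); rewrite mem_iota => /(_ ltac:(lia)).
  rewrite hij /= has_rev {hc hi}.
  elim: bs hb => //= b bs IH /andP[hb hbs].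
  case: ifP => hn /=; last by move/(IH hbs)->; rewrite orbT.
  case/orP=> [/and4P[p1 p2 p3 p4]|/(IH hbs)->]; last by rewrite orbT.
  rewrite place_bounded // /in_block ![x1 (place zx _ _)]/= ![x2 (place zx _ _)]/=
    ![y1 (place zx _ _)]/= ![y2 (place zx _ _)]/=.
  case/and4P: hb => b1 b2 b3 b4.
  case/andP: hi2 => u1 u2; case/andP: hj2 => u3 u4.
  rewrite (leq_ltn_trans (fits_le fX (a := _) (b := i) _) u1) ?p1 /=; last by lia.
  rewrite (leq_trans u2) ?(fits_le fX) ?p2 //=.
  rewrite (leq_ltn_trans (fits_le fY (a := _) (b := j) _) u3) ?p3 /=; last by lia.
  by rewrite (leq_trans u4) ?(fits_le fY) ?p4.
Qed.
End CheckSound.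

(** * Upper bounds on the length of a path *)

Definition region (m n A B : nat) (v : vertex) : bool :=
  [&& 0 < v.1 <= m, 0 < v.2 <= n & (v.1 <= A) || (v.2 <= B)].

Definition spath (P : pred vertex) (s t : vertex) (q : seq vertex) : Prop :=
  [/\ walk s q t, uniq q & all P q].

Definition flip (v : vertex) : vertex := (v.2, v.1).

Lemma flipK : involutive flip.
Proof. by case. Qed.

Lemma wadjC u v : wadj u v = wadj v u.
Proof. by rewrite /wadj /absdiff; lia. Qed.

Lemma wadj_flip u v : wadj (flip u) (flip v) = wadj u v.
Proof. by rewrite /wadj /= andbC. Qed.

Lemma walk_rev u p v : walk u p v -> walk v (rev p) u.
Proof.
move=> [p' [-> <- hp]]; exists (rev (belast u p')); rewrite lastI rev_rcons; split=> //.
  case: p' {hp} => //= x p'; rewrite rev_cons last_rcons //.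
by rewrite rev_path; under eq_path do rewrite wadjC.
Qed.

Lemma spath_rev P s t q : spath P s t q -> spath P t s (rev q).
Proof. by case=> /walk_rev w u a; split; rewrite ?rev_uniq ?all_rev. Qed.

Lemma spath_flip m n A B s t q : spath (region m n A B) s t q ->
  spath (region n m B A) (flip s) (flip t) (map flip q).
Proof.
case=> hw hu ha; split.
- by apply: walk_map hw => a b _ _; rewrite wadj_flip.
- by rewrite map_inj_uniq //; apply: inv_inj flipK.
- by rewrite all_map; apply: sub_all ha => v; rewrite /region /=; lia.
Qed.

Lemma walk_ends u p v : walk u p v -> u \in p /\ v \in p.
Proof. by move=> [p' [-> <- _]]; rewrite mem_head mem_last. Qed.

Lemma path_enters (P D : pred vertex) z u p :
  (forall a b, P a -> P b -> wadj a b -> ~~ D a -> D b -> a = z) ->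
  path wadj u p -> all P (u :: p) -> ~~ D u -> D (last u p) -> z \in belast u p.
Proof.
move=> hz; elim: p u => [|v p IH] u /=; first by move=> _ _ /negbTE->.
move=> /andP[a hp] /and3P[Pu Pv Pp] nD hl; rewrite inE.
case Dv: (D v); first by rewrite (hz u v) ?eqxx.
by rewrite IH ?orbT ?Dv //= Pv.
Qed.

Lemma path_leaves (P D : pred vertex) z u p :
  (forall a b, P a -> P b -> wadj a b -> ~~ D a -> D b -> a = z) ->
  path wadj u p -> all P (u :: p) -> D u -> ~~ D (last u p) -> z \in p.
Proof.
move=> hz; elim: p u => [|v p IH] u /=; first by move=> _ _ ->.
move=> /andP[a hp] /and3P[Pu Pv Pp] Du hl; rewrite inE.
case Dv: (D v); first by rewrite (IH v) ?orbT //= Pv.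
by rewrite (hz v u) ?eqxx // ?Dv // wadjC.
Qed.

(* A path that enters [D] only through [z] would have to leave it through [z] again. *)
Lemma spath_avoids (P D : pred vertex) z s t q : spath P s t q ->
  ~~ D s -> ~~ D t ->
  (forall a b, P a -> P b -> wadj a b -> ~~ D a -> D b -> a = z) ->
  all (predC D) q.
Proof.
move=> [[p [eq et hp]] hu hP] Ds Dt hz; apply/allP => d hd /=; apply/negP => Dd.
move: hd hu hP; rewrite {q}eq inE => /predU1P[e|hd]; first by rewrite e (negbTE Ds) in Dd.
case/splitPr: hd et hp => p1 p2; rewrite last_cat cat_path /= => et /and3P[h1 h2 h3] hu.
rewrite all_cat /= => /and4P[Ps P1 Pd P2].
have z1 : z \in s :: p1.
  rewrite -(belast_rcons s p1 d); apply: (path_enters hz) => //.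
  - by rewrite rcons_path h1.
  - by rewrite /= all_rcons Ps Pd.
  - by rewrite last_rcons.
have z2 : z \in p2 by apply: (path_leaves hz) h3 _ Dd _; rewrite /= ?Pd ?et.
have {hu}: uniq ((s :: p1) ++ d :: p2) := hu; rewrite cat_uniq => /and3P[_ /hasPn/(_ z)].
by rewrite inE z2 orbT => /(_ isT); rewrite /= z1.
Qed.

Lemma path_stays (P D : pred vertex) s t u p :
  (forall a b, P a -> P b -> wadj a b -> (a != s) && (a != t) -> D a -> ~~ D b -> b = s \/ b = t) ->
  path wadj u p -> all P (u :: p) -> all (fun v => (v != s) && (v != t)) (u :: p) ->
  D u -> all D p.
Proof.
move=> hD; elim: p u => //= v p IH u /andP[a hp] /and3P[Pu Pv Pp] /and3P[nu nv np] Du.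
have Dv : D v.
  by apply: contraT => Dv; case: (hD u v) => // e; rewrite e eqxx ?andbF in nv.
by rewrite Dv (IH v) //= ?Pv ?nv.
Qed.

(** A simple path meets [s] and [t] only at its ends, while the hypotheses let an inner vertex
    change sides only by a step onto one of them. So the first inner vertex determines the side of
    all. *)
Lemma spath_one_side (P D : pred vertex) s t q : spath P s t q -> s != t ->
  (forall a b, P a -> P b -> wadj a b -> (a != s) && (a != t) -> D a -> ~~ D b -> b = s \/ b = t) ->
  (forall a b, P a -> P b -> wadj a b -> (a != s) && (a != t) -> ~~ D a -> D b -> b = s \/ b = t) ->
  all (fun v => [|| D v, v == s | v == t]) q \/ all (fun v => [|| ~~ D v, v == s | v == t]) q.
Proof.
move=> [[p [-> et hp]] hu hP] st hD hC.
case/lastP: p et hp hu hP => [|p x] et hp hu hP; first by rewrite -et eqxx in st.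
rewrite last_rcons in et; rewrite {x}et in hp hu hP *.
move: hp hu hP; rewrite rcons_path /= rcons_uniq mem_rcons inE all_rcons negb_or.
move=> /andP[hp _] /and3P[/andP[_ sp] tp _] /and3P[_ _ Pp]; rewrite !all_rcons !eqxx !orbT /=.
case: p hp sp tp Pp => [|v p] /=; first by left.
move=> /andP[_ hp]; rewrite !inE !negb_or => /andP[sv sp] /andP[tv tp] /andP[Pv Pp].
have hn : all (fun v => (v != s) && (v != t)) (v :: p).
  rewrite /= eq_sym sv eq_sym tv /=; apply/allP => w hw.
  by apply/andP; split; [apply: contraNneq sp => <-|apply: contraNneq tp => <-].
have Pvp : all P (v :: p) by rewrite /= Pv.
case Dv: (D v); [left|right] => /=; rewrite ?Dv /=.
  by apply: sub_all (path_stays hD hp Pvp hn Dv) => w ->.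
have hC' a b : P a -> P b -> wadj a b -> (a != s) && (a != t) ->
    predC D a -> ~~ predC D b -> b = s \/ b = t.
  by move=> Pa Pb ab na Da; rewrite /= negbK => Db; apply: (hC a b).
by apply: sub_all (path_stays hC' hp Pvp hn _) => [w /= -> //|]; rewrite /= Dv.
Qed.

(** * Windows as upper bounds *)

Definition in_window (vx vy : nat -> nat) (w : window) (v : vertex) : bool :=
  [&& vx w.1.1 < v.1 <= vx w.1.2, vy w.2.1 < v.2 <= vy w.2.2
    & (v.1 <= vx nA) || (v.2 <= vy nA)].

(** A comparison of [size q] with the cardinality of [S] that avoids finite types. The path of a
    template for the window is a suitable [P]. *)
Definition dominated (q : seq vertex) (S : pred vertex) : Prop :=
  forall P : seq vertex, uniq P -> (forall v, S v -> v \in P) -> size q <= size P.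

Lemma dominated_sub (q : seq vertex) (S : pred vertex) : uniq q -> all S q -> dominated q S.
Proof. by move=> uq /allP aq P _ SP; apply: uniq_leq_size => // v /aq/SP. Qed.

Lemma dominated_size (q r : seq vertex) (S : pred vertex) :
  uniq r -> all S r -> size q <= size r -> dominated q S.
Proof.
move=> ur /allP ar hs P _ SP; apply: leq_trans hs _.
by apply: uniq_leq_size => // v /ar/SP.
Qed.

(** The last two conditions say that arms of width one are already trimmed. The terms [B.+1] and
    [A.+1] in the bounds keep the shape an L after trimming. *)
Definition valid_conf (m n A B : nat) (s t : vertex) : Prop :=
  [/\ 0 < A < m, 0 < B < n, region m n A B s, region m n A B t & s != t] /\
  ((A = 1 -> n <= maxn (maxn s.2 t.2) B.+1) /\ (B = 1 -> m <= maxn (maxn s.1 t.1) A.+1)).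

(** For an empty list of windows the conjunct [0 < size c.2] is false, so the statement then says
    that the atoms are contradictory. *)
Definition clause_sound (c : clause_windows) : Prop :=
  forall m n A B s t, valid_conf m n A B s t ->
  let vx := axis_values s.1 t.1 A m in let vy := axis_values s.2 t.2 B n in
  all (atom_holds vx vy) c.1 ->
  0 < size c.2 /\ forall q, spath (region m n A B) s t q ->
  exists2 w, w \in c.2 & dominated q (in_window vx vy w).

Lemma region_flip m n A B v : region n m B A (flip v) = region m n A B v.
Proof. by rewrite /region /=; lia. Qed.

Lemma valid_conf_flip m n A B s t :
  valid_conf m n A B s t -> valid_conf n m B A (flip s) (flip t).
Proof.
move=> [[h1 h2 h3 h4 h5] [h6 h7]]; split=> //; split; rewrite ?region_flip //.
by apply: contraNneq h5 => e; apply/eqP; rewrite -(flipK s) e flipK.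
Qed.

Lemma valid_conf_swap m n A B s t : valid_conf m n A B s t -> valid_conf m n A B t s.
Proof.
move=> [[h1 h2 h3 h4 h5] [h6 h7]]; split; first by rewrite eq_sym.
by rewrite [maxn t.2 _]maxnC [maxn t.1 _]maxnC.
Qed.

Lemma flip_clause_sound c : clause_sound c -> clause_sound (flip_clause c).
Proof.
move=> hc m n A B s t /valid_conf_flip hv vx vy ha.
have [|h0 hq'] := hc _ _ _ _ _ _ hv.
  move: ha; rewrite /= all_map; apply: sub_all => -[[[ax r] u] v].
  by rewrite /= /atom_holds if_neg.
split=> [|q /spath_flip hq]; first by rewrite size_map.
have [w hw hd] := hq' _ hq.
exists (w.2, w.1); first exact: (map_f (fun w : window => (w.2, w.1))).
move=> P uP SP; rewrite -(size_map flip q) -(size_map flip P); apply: hd.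
  by rewrite map_inj_uniq //; apply: inv_inj flipK.
move=> v hv'; rewrite -(flipK v) map_f // SP //.
by move: hv'; rewrite /in_window /= orbC => /and3P[-> -> ->].
Qed.

Lemma axis_values_swap p q A M nm :
  axis_values p q A M (swap_name nm) = axis_values q p A M nm.
Proof.
rewrite /axis_values /swap_name; do 5 (case: nm => [|nm] //).
by rewrite [nth _ _ nm.+4.+1]nth_default.
Qed.

Lemma swap_clause_sound c : clause_sound c -> clause_sound (swap_clause c).
Proof.
move=> hc m n A B s t /valid_conf_swap hv vx vy ha.
have [|h0 hq'] := hc _ _ _ _ _ _ hv.
  move: ha; rewrite /= all_map; apply: sub_all => -[[[ax r] u] v].
  by rewrite /= /atom_holds /vx /vy; case: ax; case: r; rewrite !axis_values_swap.
split=> [|q /spath_rev hq]; first by rewrite size_map.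
have [w hw hd] := hq' _ hq.
exists (swap_window w); first exact: map_f.
move=> P uP SP; rewrite -(size_rev q); apply: hd => // v hv'; apply: SP.
by move: hv'; rewrite /in_window /vx /vy /= !axis_values_swap.
Qed.

(** * The individual obstructions *)

Lemma untrimmed_sound : clause_sound untrimmed.
Proof.
move=> m n A B s t [_ [h _]] vx vy /= /and5P[/eqP e h1 h2 h3 _]; exfalso.
by have := h e; move: h1 h2 h3; rewrite /vy /axis_values /=; lia.
Qed.

Lemma excluded_sound c : List.In c excluded -> clause_sound c.
Proof.
case=> [<-|[<-|[<-|//]]] m n A B s t [[_ _ hs ht st] _] vx vy /= /and3P[e1 e2 _];
  exfalso.
- case/negP: st; move: e1 e2; rewrite /vx /vy /axis_values /= => /eqP h1 /eqP h2.
  by case: s t h1 h2 {hs ht vx vy} => [a b] [a' b'] /= -> ->.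
- by move: hs e1 e2; rewrite /region /vx /vy /axis_values /=; lia.
- by move: ht e1 e2; rewrite /region /vx /vy /axis_values /=; lia.
Qed.

(** Beyond the corner the arm is a single column, so everything on the corner side of [s] hangs on
    [s] alone, and a path from [s] to [t] cannot go there and come back. Beyond [t] nothing is left
    by trimming. *)
Lemma segment_sound : clause_sound segment_clause.
Proof.
move=> m n A B s t [[hA hB hs ht st] [h _]] vx vy /= /and4P[/eqP e h1 h2 _].
split=> [//|q hq].
exists ((nZ, nA), (nPm, nQ)); first by rewrite inE.
have {}h := h e; move: e h1 h2 hs ht; rewrite /vx /vy /axis_values /= => e h1 h2 hs ht.
have uq : uniq q by case: hq.
have aq : all (region m n A B) q by case: hq.
apply: dominated_sub => //.
have := spath_avoids (D := fun v => ~~ ((v.1 <= A) && (s.2 <= v.2))) (z := s) hq.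
move=> /(_ _ _ _)hD; have {}hD : all (predC (fun v : vertex => ~~ ((v.1 <= A) && (s.2 <= v.2)))) q.
  apply: hD; [by move: hs; rewrite /region; lia|by move: ht; rewrite /region; lia|].
  case: (s) h1 h2 hs => [sx sy] /= h1 h2 hs [a b] [c d]; rewrite /region /wadj /absdiff /= in hs *.
  by move=> ? ? ? ? ?; congr pair; lia.
apply/allP => v hv; have := allP hD _ hv; have := allP aq _ hv.
by rewrite /in_window /vx /vy /axis_values /region /=; lia.
Qed.

(** A step changes the first coordinate by at most one, and the column of [s] consists of [s] and
    [t] only, so its two sides are connected through the ends of the path alone. *)
Lemma halves_sound m n A B s t q (vx := axis_values s.1 t.1 A m) (vy := axis_values s.2 t.2 B n) :
  valid_conf m n A B s t -> s.1 = t.1 ->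
  (forall v, region m n A B v -> v.1 = s.1 -> v = s \/ v = t) ->
  spath (region m n A B) s t q ->
  exists2 w, w \in halves & dominated q (in_window vx vy w).
Proof.
move=> [[hA hB hs ht st] _] est hcol hq.
have uq : uniq q by case: hq.
have aq : all (region m n A B) q by case: hq.
have [| |hl|hr] := spath_one_side (D := fun v => v.1 < s.1) hq st.
- move=> a b Pa Pb; rewrite /wadj /absdiff => ab _ Da Db.
  by apply: hcol => //; lia.
- move=> a b Pa Pb; rewrite /wadj /absdiff => ab /andP[/eqP as_ /eqP at_] Da Db.
  suff: a.1 <> s.1 by lia.
  by move/(hcol a Pa) => [].
- exists ((nZ, nP), (nZ, nM)); first by rewrite inE.
  apply: dominated_sub => //; apply/allP => v hv; have := allP hl _ hv; have := allP aq _ hv.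
  rewrite /in_window /vx /vy /axis_values /region /= => hr /or3P[h|/eqP h|/eqP h];
    by move: hr; rewrite ?h; lia.
- exists ((nPm, nM), (nZ, nM)); first by rewrite !inE eqxx orbT.
  apply: dominated_sub => //; apply/allP => v hv; have := allP hr _ hv; have := allP aq _ hv.
  rewrite /in_window /vx /vy /axis_values /region /= => h' /or3P[h|/eqP h|/eqP h];
    by move: h'; rewrite ?h; lia.
Qed.

Lemma cut_low_sound : clause_sound cut_low_clause.
Proof.
move=> m n A B s t hv vx vy /= /and5P[/eqP e1 e2 e3 /eqP e4 /andP[/eqP e5 _]].
split=> [//|q hq].
have [[hA hB hs ht st] _] := hv; rewrite /vx /vy /axis_values /= in e1 e2 e3 e4 e5.
apply: halves_sound => // -[x y]; case: s t e1 hs ht st {vx vy hv e2 e3 hq} => [a b] [c d].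
rewrite /region xpair_eqE /= => e1 hs ht st hr ex.
have [ey|ey] : y = b \/ y = d by lia.
  by left; congr pair.
by right; congr pair => //; rewrite ex.
Qed.

Lemma cut_arm_sound : clause_sound cut_arm_clause.
Proof.
move=> m n A B s t hv vx vy /= /and5P[/eqP e1 e2 e3 /eqP e4 /and3P[/eqP e5 /eqP e6 _]].
split=> [//|q hq].
have [[hA hB hs ht st] _] := hv; rewrite /vx /vy /axis_values /= in e1 e2 e3 e4 e5 e6.
apply: halves_sound => // -[x y]; case: s t e1 e2 hs ht st e4 e5 e6 {vx vy hv e3 hq} => [a b] [c d].
rewrite /region xpair_eqE /= => e1 e2 hs ht st e4 e5 e6 hr ex.
have [ey|ey] : y = b \/ y = d by lia.
  by left; congr pair.
by right; congr pair => //; rewrite ex.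
Qed.

(** Both neighbours of the pendant vertex [(1, n)] are ends of the path. A path through it has no
    other inner vertex, hence at most three vertices, and the window has as many because [B >= 2].
    All other paths stay in the window. *)
Lemma pendant_sound : clause_sound pendant_clause.
Proof.
move=> m n A B s t hv vx vy /= /and5P[/eqP e1 /eqP e2 /eqP e3 /eqP e4].
move=> /and4P[e5 /eqP e6 /eqP e7 _]; split=> [//|q hq].
have [[hA hB hs ht st] _] := hv.
rewrite /vx /vy /axis_values /= in e1 e2 e3 e4 e5 e6 e7.
have es : s = (1, B) by case: s e2 e6 {vx vy hv hs ht st hq e3 e7} => a b /=; move=> *;
  congr pair; lia.
have et : t = (2, B) by case: t e3 e7 {vx vy hv hs ht st hq e2 e6} => a b /=; move=> *;
  congr pair; lia.
exists ((nZ, nM), (nZ, nA)); first by rewrite inE.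
have uq : uniq q by case: hq.
have aq : all (region m n A B) q by case: hq.
have nb u : region m n A B u -> wadj u (1, n) -> u != (1, n) -> u = s \/ u = t.
  rewrite es et; case: u => x y; rewrite /region /wadj /absdiff xpair_eqE /= => h1 h2 h3.
  have [ex|ex] : x = 1 \/ x = 2 by lia.
    by left; congr pair; lia.
  by right; congr pair; lia.
have [| |hl|hr] := spath_one_side (D := pred1 (1, n)) hq st.
- by move=> a b Pa Pb ab _ /eqP ea hb; apply: nb => //; rewrite wadjC -ea.
- move=> a b Pa Pb ab /andP[/eqP as_ /eqP at_] ha /eqP eb; subst b.
  by case: (nb a Pa ab ha).
- apply: (@dominated_size _ [:: (1, 1); (2, 1); (1, 2)]) => //.
    by rewrite /= /in_window /vx /vy /axis_values /=; lia.
  rewrite /= -[3]/(size [:: (1, n); s; t]); apply: uniq_leq_size => // v /(allP hl) /=.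
  by rewrite !inE.
- apply: dominated_sub => //; apply/allP => -[x y] hv'.
  have := allP hr _ hv'; have := allP aq _ hv'.
  by rewrite es et /in_window /vx /vy /axis_values /region /= !xpair_eqE /=; lia.
Qed.

Lemma last_uniq_nil (T : eqType) (x : T) p : uniq (x :: p) -> last x p = x -> p = [::].
Proof.
case/lastP: p => // p y /=; rewrite last_rcons => /andP[h _] e; subst y.
by rewrite mem_rcons mem_head in h.
Qed.

Lemma uniq_cat_disjoint (T : eqType) (a b : seq T) x : uniq (a ++ b) -> x \in a -> x \notin b.
Proof. by rewrite cat_uniq => /and3P[_ /hasPn h _] xa; apply: contraL xa; apply: h. Qed.

Lemma corner_neighbours u : 0 < u.1 -> 0 < u.2 -> wadj u (1, 1) -> u != (1, 1) ->
  u \in [:: (1, 2); (2, 1); (2, 2)].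
Proof. by case: u => [[|[|[|x]]] [|[|[|y]]]]. Qed.

(** * Paths through the pendant vertex above two rows *)

Section PendantDiag.
Variables (m : nat) (q : seq vertex).
Let R := region m 3 1 2.

Lemma pendant_neighbours u : R u -> wadj u (1, 3) -> u != (1, 3) -> u = (1, 2) \/ u = (2, 2).
Proof.
case: u => x y; rewrite /R /region /wadj /absdiff xpair_eqE /= => h1 h2 h3.
have [ex|ex] : x = 1 \/ x = 2 by lia.
  by left; congr pair; lia.
by right; congr pair; lia.
Qed.

(** The pendant vertex is visited between [(1, 2)] and [(2, 2)], and the latter is the end. Before
    [(1, 2)] only [(1, 1)] and [(2, 1)] are free, so the longest possibility is [(1, 1)], [(2, 1)],
    [(1, 2)], [(1, 3)], [(2, 2)]. *)
Lemma pendant_diag1 : spath R (1, 1) (2, 2) q -> (1, 3) \in q -> size q <= 5.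
Proof.
move=> [[p [-> et hp]] hu hR]; rewrite inE /= => hd.
case/splitPr: hd et hp hu hR => p1 p2; rewrite last_cat cat_path /= => et /and3P[h1 h2 h3].
move=> hu hR.
have {}hu : uniq ((1, 1) :: p1 ++ (1, 3) :: p2) := hu.
have {}hR : all R ((1, 1) :: p1 ++ (1, 3) :: p2) := hR.
have RP v : v \in (1, 1) :: p1 ++ (1, 3) :: p2 -> R v by move/(allP hR).
have tp2 : (2, 2) \in p2 by case: p2 et {h3 hu hR RP} => // x p2 /= <-; apply: mem_last.
have e1 : last (1, 1) p1 = (1, 2).
  have hm : last (1, 1) p1 \in (1, 1) :: p1 by apply: mem_last.
  case: (@pendant_neighbours (last (1, 1) p1)) => //.
  - by apply: RP; rewrite -cat_cons mem_cat hm.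
  - apply: contraTneq hm => ->; move: hu; rewrite -cat_cons cat_uniq => /and3P[_ /hasPn/(_ (1, 3))].
    by rewrite mem_head => ->.
  - move=> e; move: hu; rewrite -cat_cons cat_uniq => /and3P[_ /hasPn/(_ (2, 2))].
    by rewrite inE tp2 orbT => /(_ isT); rewrite /= -e hm.
have e2 : p2 = [:: (2, 2)].
  case: p2 et tp2 h3 hu hR RP => // x p2 /= et _ /andP[ax _] hu hR RP.
  have {}hu : uniq ((1, 1) :: p1 ++ [:: (1, 3), x & p2]) := hu.
  case: (@pendant_neighbours x) => //.
  - by apply: RP; rewrite !(inE, mem_cat) eqxx !orbT.
  - by rewrite wadjC.
  - by apply: contraTneq hu => ->; rewrite -cat_cons cat_uniq [uniq ((1, 3) :: _)]cons_uniq
    mem_head !andbF.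
  - move=> ex; have := uniq_cat_disjoint (a := (1, 1) :: p1) (x := x) hu.
    by rewrite [in X in X -> _]ex -e1 mem_last in_cons mem_head orbT => /(_ isT).
  - move=> ex; congr cons => //; apply: (@last_uniq_nil _ x).
      by move: hu; rewrite -cat_cons cat_uniq => /and3P[_ _ /= /andP[]].
    by rewrite et.
subst p2 => {tp2 et h3}.
case/lastP: p1 h1 e1 h2 hu hR RP => [|p1 x] //=; rewrite last_rcons => h1 ex; subst x.
move: h1; rewrite rcons_path => /andP[h1 a1] _ hu hR RP.
have {}hu : uniq ((1, 1) :: rcons p1 (1, 2) ++ [:: (1, 3); (2, 2)]) := hu.
have hm : last (1, 1) p1 \in (1, 1) :: p1 by apply: mem_last.
have hl : last (1, 1) p1 = (1, 1) \/ last (1, 1) p1 = (2, 1).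
  have : R (last (1, 1) p1) by apply: RP; move: hm;
    rewrite !(inE, mem_cat, mem_rcons) => /orP[->|->]; rewrite ?orbT.
  have : last (1, 1) p1 \notin [:: (1, 2); (1, 3); (2, 2)].
    move: hu; rewrite cat_rcons -cat_cons cat_uniq => /and3P[_ h _].
    by apply: contraL hm => hx; apply: (hasPn h).
  move: a1; case: (last _ _) => x y; rewrite /R /region /wadj /absdiff !inE !xpair_eqE /= => g1
    g2 g3.
  have [e|e] : x = 1 \/ x = 2 by lia.
    by left; congr pair; lia.
  by right; congr pair; lia.
have up1 : uniq ((1, 1) :: p1) by move: hu; rewrite cat_rcons -cat_cons cat_uniq => /and3P[].
case: hl => el; first by rewrite (last_uniq_nil up1 el).
case: p1 h1 a1 hu hm el up1 hR RP => [|x p1] //= /andP[ax hp1] _ hu hm el up1 hR RP.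
have xin : x \in [:: (2, 1); (1, 2); (2, 2)].
  have /and3P[/andP[g1 _] /andP[g2 _] _] : R x by apply: RP; rewrite !inE eqxx orbT.
  have g3 : x != (1, 1) by move: up1; rewrite !inE negb_or eq_sym => /andP[/andP[]].
  have := corner_neighbours g1 g2 _ g3; rewrite wadjC ax => /(_ isT).
  by rewrite !inE => /or3P[]->; rewrite ?orbT.
have ex : x = (2, 1).
  move: xin; rewrite !inE => /or3P[/eqP-> //|/eqP e|/eqP e]; subst x; exfalso; move: hu;
  by rewrite !(inE, mem_cat, mem_rcons) eqxx ?orbT /= ?andbF.
have -> // : p1 = [::].
apply: (@last_uniq_nil _ x); last by rewrite el.
by case/andP: up1.
Qed.

(** The neighbours of the pendant vertex are the start and [(2, 2)], so the path begins [(1, 2)],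
    [(1, 3)], [(2, 2)]. The start is thus used up as a neighbour of [(1, 1)], which must come
    directly between [(2, 2)] and the end [(2, 1)]. *)
Lemma pendant_diag2 : spath R (1, 2) (2, 1) q -> (1, 3) \in q -> (1, 1) \in q -> size q <= 5.
Proof.
move=> [[p [-> et hp]] hu hR]; rewrite inE /= => hd hw.
case/splitPr: hd et hp hu hR hw => p1 p2; rewrite last_cat cat_path /= => et /and3P[h1 h2 h3].
move=> hu hR hw.
have {}hu : uniq ((1, 2) :: p1 ++ (1, 3) :: p2) := hu.
have {}hR : all R ((1, 2) :: p1 ++ (1, 3) :: p2) := hR.
have RP v : v \in (1, 2) :: p1 ++ (1, 3) :: p2 -> R v by move/(allP hR).
case: p2 et h3 hu hR hw RP => // c p2 /= et /andP[ac h3] hu hR hw RP.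
have {}hu : uniq ((1, 2) :: p1 ++ [:: (1, 3), c & p2]) := hu.
have ec : c = (2, 2).
  case: (@pendant_neighbours c) => //.
  - by apply: RP; rewrite !(inE, mem_cat) eqxx !orbT.
  - by rewrite wadjC.
  - by apply: contraTneq hu => ->; rewrite -cat_cons cat_uniq [uniq ((1, 3) :: _)]cons_uniq
    mem_head !andbF.
  - by move=> e; exfalso; move: hu; rewrite e cons_uniq !(inE, mem_cat) eqxx ?orbT.
subst c.
have ep1 : p1 = [::].
  have up1 : uniq ((1, 2) :: p1) by move: hu; rewrite -cat_cons cat_uniq => /and3P[].
  apply: last_uniq_nil up1 _.
  have hm : last (1, 2) p1 \in (1, 2) :: p1 by apply: mem_last.
  have hn : last (1, 2) p1 \notin [:: (1, 3), (2, 2) & p2].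
    move: hu; rewrite -cat_cons cat_uniq => /and3P[_ h _].
    by apply: contraL hm => hx; apply: (hasPn h).
  case: (@pendant_neighbours (last (1, 2) p1)) => //.
  - by apply: RP; rewrite -cat_cons mem_cat hm.
  - by apply: contraNneq hn => ->; rewrite mem_head.
  - by move=> e; rewrite e !inE eqxx orbT in hn.
subst p1; move: hw; rewrite !inE /= => hw.
case/splitPr: hw et h3 hu hR RP => p3 p4;
  rewrite last_cat cat_path /= => et /and3P[g1 g2 g3] hu hR RP.
have nb u : R u -> wadj u (1, 1) -> u != (1, 1) -> u \in [:: (1, 2); (2, 1); (2, 2)].
  by case/and3P=> /andP[? _] /andP[? _] _; apply: corner_neighbours.
have t4 : (2, 1) \in p4 by case: p4 et {g3 hu hR RP} => // x p4 /= <-; apply: mem_last.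
have {}hu : uniq ([:: (1, 2); (1, 3)] ++ ((2, 2) :: p3) ++ (1, 1) :: p4) := hu.
have u2 : uniq (((2, 2) :: p3) ++ (1, 1) :: p4) by move: hu; rewrite cat_uniq => /and3P[].
have s2 : (1, 2) \notin ((2, 2) :: p3) ++ (1, 1) :: p4.
  by apply: uniq_cat_disjoint hu _; rewrite mem_head.
have ep3 : p3 = [::].
  have up3 : uniq ((2, 2) :: p3) by move: u2; rewrite cat_uniq => /and3P[].
  apply: last_uniq_nil up3 _.
  have hm : last (2, 2) p3 \in (2, 2) :: p3 by apply: mem_last.
  have hn : last (2, 2) p3 \notin (1, 1) :: p4.
    move: u2; rewrite cat_uniq => /and3P[_ h _].
    by apply: contraL hm => hx; apply: (hasPn h).
  have := nb (last (2, 2) p3); rewrite !inE => /(_ _ g2 _) /or3P[||/eqP|/eqP|/eqP //].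
  - by apply: RP; move: hm; rewrite !(inE, mem_cat) => /orP[->|->]; rewrite ?orbT.
  - by apply: contraNneq hn => ->; rewrite mem_head.
  - by move=> e; rewrite e in hm; rewrite mem_cat hm in s2.
  - by move=> e; rewrite e inE t4 orbT in hn.
subst p3; case: p4 et g3 t4 hu u2 s2 hR RP => // x p4 /= et /andP[ax _] t4 hu u2 s2 hR RP.
have ex : x = (2, 1).
  have := nb x; rewrite wadjC !inE => /(_ _ ax _) /or3P[||/eqP|/eqP //|/eqP].
  - by apply: RP; rewrite !(inE, mem_cat) eqxx !orbT.
  - by apply: contraTneq u2 => ->; rewrite /= !inE ?eqxx /= ?andbF.
  - by move=> e; rewrite e !inE eqxx !orbT in s2.
  - by move=> e; move: u2; rewrite /= e !inE ?eqxx ?orbT.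
have -> // : p4 = [::].
apply: (@last_uniq_nil _ x); last by rewrite et.
by case/and3P: u2.
Qed.
End PendantDiag.

Lemma pendant_diag1_sound :
  clause_sound (pendant_diag_clause [:: nZ =y nPm; nP =y nQm; nQ =y nA]).
Proof.
move=> m n A B s t hv vx vy /= /and5P[/eqP e1 /eqP e2 /eqP e3 e4].
move=> /and5P[/eqP e5 /eqP e6 /eqP e7 /eqP e8 _]; split=> [//|q hq].
have [[hA hB hs ht st] _] := hv.
rewrite /vx /vy /axis_values /= in e1 e2 e3 e4 e5 e6 e7 e8.
have s2 : 0 < s.2 by move: hs; rewrite /region; lia.
have t2 : 0 < t.2 by move: ht; rewrite /region; lia.
have es : s = (1, 1) by rewrite [s]surjective_pairing; congr pair; lia.
have et : t = (2, 2) by rewrite [t]surjective_pairing; congr pair; lia.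
have eB : B = 2 by move: e8; rewrite et.
have eA : A = 1 by []; have en : n = 3 by rewrite e5 eB.
exists ((nZ, nM), (nZ, nA)); first by rewrite inE.
have uq : uniq q by case: hq.
have aq : all (region m n A B) q by case: hq.
case: (boolP ((1, 3) \in q)) => h3.
  (* As [m >= 3] and [B = 2], the window contains these six vertices, against at most five on such a
     path. *)
  apply: (@dominated_size _ [:: (1, 1); (2, 1); (3, 1); (1, 2); (2, 2); (3, 2)]) => //.
    by rewrite /= /in_window /vx /vy /axis_values /=; lia.
  apply: leq_trans (pendant_diag1 (m := m) _ h3) _ => //.
  by move: hq; rewrite es et eA eB en.
apply: dominated_sub => //; apply/allP => -[x y] hxy.
have := allP aq _ hxy; have : (x, y) != (1, 3) by apply: contraNneq h3 => <-.
by rewrite /in_window /vx /vy /axis_values /region xpair_eqE /=; lia.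
Qed.

Lemma pendant_diag2_sound :
  clause_sound (pendant_diag_clause [:: nZ =y nQm; nQ =y nPm; nP =y nA]).
Proof.
move=> m n A B s t hv vx vy /= /and5P[/eqP e1 /eqP e2 /eqP e3 e4].
move=> /and5P[/eqP e5 /eqP e6 /eqP e7 /eqP e8 _]; split=> [//|q hq].
have [[hA hB hs ht st] _] := hv.
rewrite /vx /vy /axis_values /= in e1 e2 e3 e4 e5 e6 e7 e8.
have s2 : 0 < s.2 by move: hs; rewrite /region; lia.
have t2 : 0 < t.2 by move: ht; rewrite /region; lia.
have es : s = (1, 2) by rewrite [s]surjective_pairing; congr pair; lia.
have et : t = (2, 1) by rewrite [t]surjective_pairing; congr pair; lia.
have eB : B = 2 by move: e8; rewrite es.
have eA : A = 1 by []; have en : n = 3 by rewrite e5 eB.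
exists ((nZ, nM), (nZ, nA)); first by rewrite inE.
have uq : uniq q by case: hq.
have aq : all (region m n A B) q by case: hq.
case: (boolP ((1, 3) \in q)) => h3; last first.
  apply: dominated_sub => //; apply/allP => -[x y] hxy.
  have := allP aq _ hxy; have : (x, y) != (1, 3) by apply: contraNneq h3 => <-.
  by rewrite /in_window /vx /vy /axis_values /region xpair_eqE /=; lia.
case: (boolP ((1, 1) \in q)) => h1.
  apply: (@dominated_size _ [:: (1, 1); (2, 1); (3, 1); (1, 2); (2, 2); (3, 2)]) => //.
    by rewrite /= /in_window /vx /vy /axis_values /=; lia.
  apply: leq_trans (pendant_diag2 (m := m) _ h3 h1) _ => //.
  by move: hq; rewrite es et eA eB en.
(* The pendant vertex is exchanged for the vertex [(1, 1)] that the path misses. *)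
pose f (v : vertex) : vertex := if v == (1, 3) then (1, 1) else v.
rewrite /dominated -(size_map f); apply: dominated_sub.
  rewrite map_inj_in_uniq // => u v hu hv'; rewrite /f.
  by case: eqP => [->|_]; case: eqP => [-> //|_] // e; rewrite -?e ?hu // e ?hv' in h1.
rewrite all_map; apply/allP => -[x y] hxy; have := allP aq _ hxy.
rewrite /= /f; case: eqP => [_ _|/eqP].
  by rewrite /in_window /vx /vy /axis_values /=; lia.
by rewrite /in_window /vx /vy /axis_values /region xpair_eqE /=; lia.
Qed.

Lemma one_sided_sound c : List.In c one_sided_clauses -> clause_sound c.
Proof.
have H1 := segment_sound; have H2 := swap_clause_sound H1; have H3 := cut_low_sound.
have H4 := cut_arm_sound; have H5 := swap_clause_sound H4; have H6 := pendant_sound.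
have H7 := swap_clause_sound H6; have H8 := pendant_diag1_sound.
have H9 := pendant_diag2_sound.
have H10 := swap_clause_sound H8; have H11 := swap_clause_sound H9.
case=> [<-|[<-|[<-|[<-|[<-|[<-|[<-|[<-|[<-|[<-|[<-|[]]]]]]]]]]]]; assumption.
Qed.

Lemma In_cat (T : Type) (x : T) a b : List.In x (a ++ b) -> List.In x a \/ List.In x b.
Proof. exact: List.in_app_or. Qed.

Lemma In_map (T U : Type) (f : T -> U) y a : List.In y (map f a) ->
  exists2 x, y = f x & List.In x a.
Proof. by elim: a => //= x a IH [<-|/IH[z ? ?]]; [exists x; auto|exists z; auto]. Qed.

Lemma clauses_sound c : List.In c clauses -> clause_sound c.
Proof.
move=> hc; case: (In_cat hc) => {hc} [|hc]; first exact: excluded_sound.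
case: (In_cat hc) => {hc} [[<-|[<-|[]]]|hc].
- exact: untrimmed_sound.
- exact: flip_clause_sound untrimmed_sound.
case: (In_cat hc) => {hc} [|hc]; first exact: one_sided_sound.
have [d -> hd] := In_map hc.
exact: flip_clause_sound (one_sided_sound hd).
Qed.

Lemma forced_holds X Y vx zx vy zy a : fits X vx zx -> fits Y vy zy ->
  atom_forced X Y a -> atom_holds vx vy a.
Proof.
move=> fX fY; case: a => -[[ax r] u] v /=.
have H Z vz zz : fits Z vz zz ->
  [&& rk Z u <= width Z, rk Z v <= width Z &
  match r with
  | REq => rk Z v == rk Z u | RLt => rk Z u < rk Z v | RSucc => one_wide Z (rk Z u) (rk Z v)
  | RGe2 => (rk Z u).+1 < rk Z v
  end] -> match r with
  | REq => vz v == vz u | RLt => vz u < vz v | RSucc => vz v == (vz u).+1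
  | RGe2 => (vz u).+1 < vz v
  end.
  move=> fZ /and3P[h1 h2]; rewrite (fZ.2 _ h1) (fZ.2 _ h2); case: r.
  - by move/eqP->.
  - by rewrite (fits_lt fZ).
  - by move/(fits_one_wide fZ h2)->.
  - exact: (fits_ge2 fZ).
by case: ax => h; [exact: (H _ _ _ fY h)|exact: (H _ _ _ fX h)].
Qed.

Lemma windows_sound m n A B s t X Y zx zy :
  valid_conf m n A B s t ->
  let vx := axis_values s.1 t.1 A m in let vy := axis_values s.2 t.2 B n in
  fits X vx zx -> fits Y vy zy ->
  0 < size (windows X Y) /\ forall q, spath (region m n A B) s t q ->
  exists2 w, w \in windows X Y & dominated q (in_window vx vy w).
Proof.
move=> hv vx vy fX fY; rewrite /windows.
have: forall c, List.In c clauses -> clause_sound c := clauses_sound.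
elim: clauses => [|c cs IH] hc /=.
  split=> // q hq; exists full_window; first by rewrite inE.
  by case: hq => _ uq aq; apply: dominated_sub.
case: ifP => hf; last by apply: IH => d hd; apply: hc; right.
apply: (hc c (or_introl erefl) _ _ _ _ _ _ hv).
by apply: sub_all hf => a; apply: forced_holds fX fY.
Qed.

(** * Programs that output a template *)

(** An invariant rule. The value of the counter and the constancy of the bound follow from
    well-formedness and are offered to the proof of the body; [K] bounds the time of one round and 4
    is the overhead of the loop. *)
Lemma for_rule (Inv : nat -> memory -> Prop) (F : nat -> seq vertex) (K : nat) r a c M :
  wf_cmd (CFor r a c) -> Inv 0 (upd M r 0) ->
  (forall i M', i < M a -> M' r = i -> M' a = M a -> Inv i M' ->
     [/\ Inv i.+1 (incr r (mem_after c M')), output c M' = F i & time c M' <= K]) ->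
  [/\ Inv (M a) (mem_after (CFor r a c) M),
      output (CFor r a c) M = flatten [seq F i | i <- iota 0 (M a)]
    & time (CFor r a c) M <= 3 + M a * (K + 4)].
Proof.
move=> /= /and4P[wc rc ru]; rewrite !inE !negb_or => /and3P[ar au ac] I0 step.
pose nxt M' := incr r (mem_after c M'); rewrite -/nxt.
have inv i : i <= M a -> [/\ iter i nxt (upd M r 0) r = i, iter i nxt (upd M r 0) a = M a
                          & Inv i (iter i nxt (upd M r 0))].
  elim: i => [|i IH] hi; first by rewrite /= /upd eqxx (negbTE ar).
  have [e1 e2 I1] := IH (ltnW hi).
  have [I2 _ _] := step _ _ hi e1 e2 I1; split; last by [].
    rewrite iterS /nxt {1}/incr /upd !eqxx (negbTE ru).
    by rewrite (mem_after_frame _ rc) e1 addn1.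
  rewrite iterS /nxt {1}/incr /upd (negbTE ar) (negbTE au).
  by rewrite (mem_after_frame _ ac).
split; first by case: (inv (M a)).
- congr flatten; apply/eq_in_map => i; rewrite mem_iota /= => hi.
  have [e1 e2 I1] := inv i (ltnW hi).
  by case: (step _ _ hi e1 e2 I1).
- rewrite leq_add2l.
  have: forall j, j <= M a ->
    sumn [seq time c (iter i nxt (upd M r 0)) + 4 | i <- iota 0 j] <= j * (K + 4).
    elim=> // j IH hj; rewrite -{1}[j.+1]addn1 iotaD map_cat sumn_cat /= addn0 mulSn addnC.
    apply: leq_add; last exact: IH (ltnW hj).
    have [e1 e2 I1] := inv j (ltnW hj).
    by rewrite leq_add2r; case: (step _ _ hj e1 e2 I1).
  by apply.
Qed.

(* Registers below this one hold the input and the named values. *)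
Definition scratch := 30.

(** Unlike [writes] this omits the [unit_reg] of loops: storing 1 there changes nothing once it
    holds 1. *)
Fixpoint dests (c : cmd) : seq nat :=
  match c with
  | CSkip | COut _ _ => [::]
  | CConst r _ | CAdd r _ _ | CSub r _ _ => [:: r]
  | CSeq c1 c2 | CIf _ _ c1 c2 => dests c1 ++ dests c2
  | CFor r _ c => r :: dests c
  end.

Definition local (c : cmd) := all (leq scratch) (dests c).

Definition agree (M M' : memory) := forall r, r < scratch -> M' r = M r.

Lemma agree_trans M1 M2 M3 : agree M1 M2 -> agree M2 M3 -> agree M1 M3.
Proof. by move=> h1 h2 r hr; rewrite h2 ?h1. Qed.

Lemma agree_upd M M' r v : scratch <= r -> agree M M' -> agree M (upd M' r v).
Proof.
by move=> hr h x hx; rewrite /upd; case: eqP => [e|_]; [subst x; lia|apply: h].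
Qed.

Lemma agree_incr M M' r : scratch <= r -> M unit_reg = 1 -> agree M M' -> agree M (incr r M').
Proof.
move=> hr u h; apply: agree_upd => // x hx.
by rewrite /upd; case: eqP => [->|_]; rewrite ?u ?h.
Qed.

Lemma local_agree c M : local c -> M unit_reg = 1 -> agree M (mem_after c M).
Proof.
rewrite /local; elim: c M => //= [r v|r a b|r a b|c1 IH1 c2 IH2|a b c1 IH1 c2 IH2|r a c IH] M.
- by rewrite andbT => hr _; apply: agree_upd.
- by rewrite andbT => hr _; apply: agree_upd.
- by rewrite andbT => hr _; apply: agree_upd.
- rewrite all_cat => /andP[h1 h2] u; have e := IH1 _ h1 u.
  by apply: (agree_trans e (IH2 _ h2 _)); rewrite e.
- by rewrite all_cat => /andP[h1 h2] u; case: ifP => _; auto.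
- move=> /andP[hr hc] u; elim: (M a) => [|i IHi] /=; first exact: agree_upd.
  apply: agree_incr => //; apply: (agree_trans IHi (IH _ hc _)).
  by rewrite IHi.
Qed.

Definition xreg (nm : nat) := 10 + nm.
Definition yreg (nm : nat) := 20 + nm.

Lemma xreg_lt nm : nm < 10 -> xreg nm < scratch.
Proof. by rewrite /xreg /scratch; lia. Qed.

Lemma yreg_lt nm : nm < 10 -> yreg nm < scratch.
Proof. by rewrite /yreg /scratch; lia. Qed.

Definition coord_cmd dst lo hi (sd : bool) i : cmd :=
  if sd then CSub dst hi i else CAdd dst lo i ;; CAdd dst dst unit_reg.

(* Registers: 30, 31 width and height of the grid, 32 parity of the width, 33, 34 loop
   counters, 35, 37 current cell, 36 direction, 38 number of columns of the snake,
   39 height minus one, 40, 41 output coordinates; 9 holds [n.+1] for the reflection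
   and [xreg 0] holds zero. *)
Definition cell_cmd (b : block) i j : cmd :=
  let ij := if kd b is Vert then (j, i) else (i, j) in
  coord_cmd 40 (xreg (x1 b)) (xreg (x2 b)) (ex b) ij.1 ;;
  coord_cmd 41 (yreg (y1 b)) (yreg (y2 b)) (ey b) ij.2 ;;
  CSub 41 9 41 ;; COut 40 41.

(** [xreg 0] and [unit_reg] serve as the constants 0 and 1, the indices of the two columns. *)
Definition zigzag_cmd (b : block) : cmd :=
  CFor 34 31 (cell_cmd b (xreg 0) 34 ;; cell_cmd b unit_reg 34).

Definition snake_cmd (b : block) (i0 cnt : nat) (up : bool) : cmd :=
  CConst 35 i0 ;; CConst 36 up ;;
  CFor 33 cnt
    (CFor 34 31 (CIf (xreg 0) 36 (CSub 37 39 34) (CAdd 37 34 (xreg 0)) ;; cell_cmd b 35 37) ;;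
     CAdd 35 35 unit_reg ;; CSub 36 unit_reg 36).

(** Without division, the parity of the width is found by toggling register 32 once per column. For
    [diag] the zigzag belongs to even widths, which are at least two in a nonempty block, so [1 < w]
    is tested only in the other case. *)
Definition grid_cmd (b : block) (diag : bool) : cmd :=
  let pure := snake_cmd b 0 30 false in
  let zig := zigzag_cmd b ;; CConst 38 2 ;; CSub 38 30 38 ;; snake_cmd b 2 38 true in
  CSub 39 31 unit_reg ;; CConst 32 0 ;; CFor 33 30 (CSub 32 unit_reg 32) ;;
  if diag then CIf 32 unit_reg zig pure else CIf 32 unit_reg pure (CIf unit_reg 30 zig pure).

Definition block_cmd (b : block) : cmd :=
  CIf (xreg (x1 b)) (xreg (x2 b))
    (CIf (yreg (y1 b)) (yreg (y2 b))
      (if kd b is Vert then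
         CSub 30 (yreg (y2 b)) (yreg (y1 b)) ;; CSub 31 (xreg (x2 b)) (xreg (x1 b)) ;;
         grid_cmd b false
       else
         CSub 30 (xreg (x2 b)) (xreg (x1 b)) ;; CSub 31 (yreg (y2 b)) (yreg (y1 b)) ;;
         grid_cmd b (if kd b is Diag then true else false)) CSkip) CSkip.

Definition named (b : block) := [&& x1 b < 10, x2 b < 10, y1 b < 10 & y2 b < 10].

Section BlockCmd.
Variables (b : block) (M0 : memory).
Hypotheses (nb : named b) (u0 : M0 unit_reg = 1) (z0 : M0 (xreg 0) = 0).

Definition cell_vertex (c : vertex) : vertex :=
  let cx := if kd b is Vert then c.2 else c.1 in
  let cy := if kd b is Vert then c.1 else c.2 in
  (coord (M0 (xreg (x1 b))) (M0 (xreg (x2 b))) (ex b) cx,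
   M0 9 - coord (M0 (yreg (y1 b))) (M0 (yreg (y2 b))) (ey b) cy).

Lemma coord_cmd_after dst lo hi sd i M : M unit_reg = 1 -> dst != unit_reg ->
  forall r, mem_after (coord_cmd dst lo hi sd i) M r =
    if r == dst then coord (M lo) (M hi) sd (M i) else M r.
Proof.
move=> u du r; rewrite /coord_cmd /coord; case: sd => //=.
rewrite /upd; case: eqP => // _; rewrite eqxx eq_sym (negbTE du) u; lia.
Qed.

Lemma coord_cmd_output dst lo hi sd i M : output (coord_cmd dst lo hi sd i) M = [::].
Proof. by rewrite /coord_cmd; case: sd. Qed.

Lemma coord_cmd_time dst lo hi sd i M : time (coord_cmd dst lo hi sd i) M <= 2.
Proof. by rewrite /coord_cmd; case: sd. Qed.

Lemma cell_cmd_spec i j M : agree M0 M -> i < 40 -> j < 40 ->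
  output (cell_cmd b i j) M = [:: cell_vertex (M i, M j)] /\
  time (cell_cmd b i j) M <= 6 /\
  (forall r, r < 40 -> mem_after (cell_cmd b i j) M r = M r).
Proof.
move=> ag hi hj; have /and4P[n1 n2 n3 n4] := nb.
have u : M unit_reg = 1 by rewrite ag.
have key i' j' : i' < 40 -> j' < 40 ->
  let c := coord_cmd 40 (xreg (x1 b)) (xreg (x2 b)) (ex b) i' ;;
    coord_cmd 41 (yreg (y1 b)) (yreg (y2 b)) (ey b) j' ;; CSub 41 9 41 ;; COut 40 41 in
  [/\ output c M = [:: (coord (M0 (xreg (x1 b))) (M0 (xreg (x2 b))) (ex b) (M i'),
         M0 9 - coord (M0 (yreg (y1 b))) (M0 (yreg (y2 b))) (ey b) (M j'))],
      time c M <= 6 & (forall r, r < 40 -> mem_after c M r = M r)].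
  move=> hi' hj' c.
  set M1 := mem_after (coord_cmd 40 (xreg (x1 b)) (xreg (x2 b)) (ex b) i') M.
  have M1E r : M1 r = if r == 40 then coord (M (xreg (x1 b))) (M (xreg (x2 b))) (ex b) (M i')
    else M r.
    exact: coord_cmd_after.
  have u1 : M1 unit_reg = 1 by rewrite M1E.
  set M2 := mem_after (coord_cmd 41 (yreg (y1 b)) (yreg (y2 b)) (ey b) j') M1.
  have M2E r : M2 r = if r == 41 then coord (M1 (yreg (y1 b))) (M1 (yreg (y2 b))) (ey b) (M1 j')
    else M1 r.
    exact: coord_cmd_after.
  have lt r : r < 40 -> M1 r = M r by rewrite M1E; case: eqP => // ->.
  split.
  - rewrite /c /= !coord_cmd_output /= -/M1 -/M2 /upd /= !M2E /= [M1 40]M1E /=.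
    have gx nm : nm < 10 -> M (xreg nm) = M0 (xreg nm) by move=> h; apply: ag;
      rewrite /xreg /scratch; lia.
    have gy nm : nm < 10 -> M1 (yreg nm) = M0 (yreg nm).
      by move=> h; rewrite lt ?ag // /yreg /scratch; lia.
    by rewrite !gx // !gy // (lt j') // (lt 9) // (ag 9).
  - apply: (@leq_add _ _ 2 4) (coord_cmd_time _ _ _ _ _ _) _.
    exact: (@leq_add _ _ 2 2) (coord_cmd_time _ _ _ _ _ _) _.
  - move=> r hr; rewrite /c /= -/M1 -/M2 /upd.
    case: eqP => [e|_]; first by subst r.
    rewrite M2E; case: eqP => [e|_]; first by subst r.
    exact: lt.
rewrite /cell_cmd /cell_vertex; case: (kd b);
  [have := key i j hi hj|have := key i j hi hj|have := key j i hj hi];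
  by case.
Qed.

Lemma cell_cmd_writes i j r : r < 40 -> r \notin writes (cell_cmd b i j).
Proof.
by move=> hr; rewrite /cell_cmd /coord_cmd; case: (kd b); case: (ex b); case: (ey b);
  rewrite /= !inE; lia.
Qed.

Lemma cell_cmd_wf i j : wf_cmd (cell_cmd b i j).
Proof. by rewrite /cell_cmd /coord_cmd; case: (kd b); case: (ex b); case: (ey b). Qed.

Lemma cell_cmd_local i j : local (cell_cmd b i j).
Proof. by rewrite /cell_cmd /coord_cmd; case: (kd b); case: (ex b); case: (ey b). Qed.

#[local] Opaque cell_cmd.

Definition step_cmd : cmd :=
  CIf (xreg 0) 36 (CSub 37 39 34) (CAdd 37 34 (xreg 0)) ;; cell_cmd b 35 37.

Lemma flatten_singletons (T U : Type) (f : T -> U) s : flatten [seq [:: f x] | x <- s] = map f s.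
Proof. by elim: s => //= x s ->. Qed.

Lemma agree_unit M : agree M0 M -> M unit_reg = 1.
Proof. by move=> ag; rewrite ag. Qed.

Lemma column_cmd_spec M h i (up : bool) : agree M0 M ->
  M 31 = h -> M 39 = h.-1 -> M 35 = i -> M 36 = up ->
  output (CFor 34 31 step_cmd) M = map cell_vertex (column h i up) /\
  time (CFor 34 31 step_cmd) M <= 3 + h * 13.
Proof.
move=> ag e31 e39 e35 e36.
pose Inv (k : nat) M' := [/\ agree M0 M', M' 39 = h.-1, M' 35 = i & M' 36 = up].
have wf : wf_cmd (CFor 34 31 step_cmd).
  rewrite /step_cmd /= cell_cmd_wf /= !inE !negb_or /=.
  by rewrite !(negbTE (cell_cmd_writes _ _ _)).
(* Nine steps per cell: at most three to choose the direction and six for the cell; the loop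
   overhead makes 13. *)
have [|k M' hk er ea [ag' i39 i35 i36]|_ -> ht] := for_rule (Inv := Inv)
  (F := fun j => [:: cell_vertex (i, if up then h.-1 - j else j)]) (K := 9) (M := M) wf.
- by split; rewrite /upd //; apply: agree_upd.
- have z' : M' 10 = 0 by rewrite ag' // z0.
  pose M1 := mem_after (CIf (xreg 0) 36 (CSub 37 39 34) (CAdd 37 34 (xreg 0))) M'.
  have M1E r : M1 r = if r == 37 then if up then h.-1 - k else k else M' r.
    rewrite /M1 /= z' i36; case: (up) => /=; rewrite /upd; case: eqP => // _.
      by rewrite i39 er.
    by rewrite er addn0.
  have ag1 : agree M0 M1.
    move=> r hr; rewrite M1E; case: eqP => [e|_]; last exact: ag'.
    by subst r.
  have [o1 [t1 m1]] := @cell_cmd_spec 35 37 M1 ag1 isT isT.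
  split.
  + have agc : agree M1 (mem_after (cell_cmd b 35 37) M1).
      by apply: local_agree (cell_cmd_local _ _) (agree_unit ag1).
    split; first by apply: agree_incr => //; apply: agree_trans ag1 agc.
    * by rewrite /incr /upd /= -/M1 m1 // M1E.
    * by rewrite /incr /upd /= -/M1 m1 // M1E.
    * by rewrite /incr /upd /= -/M1 m1 // M1E.
  + have -> : output step_cmd M' = output (cell_cmd b 35 37) M1.
      by rewrite /M1 /step_cmd /=; case: ifP.
    by rewrite o1 !M1E /= i35.
  + by apply: (@leq_add _ _ 3 6) _ t1; rewrite /=; case: ifP.
- by rewrite flatten_singletons e31 /column -map_comp; split=> //; rewrite e31 in ht.
Qed.

Lemma column_cmd_writes r : r \notin [:: 34; unit_reg; 37] -> r < 40 ->
  r \notin writes (CFor 34 31 step_cmd).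
Proof.
move=> h1 h2; rewrite /step_cmd /= !in_cons !negb_or (cell_cmd_writes _ _ h2) andbT.
by move: h1; rewrite !inE; lia.
Qed.

Lemma column_cmd_wf : wf_cmd (CFor 34 31 step_cmd).
Proof.
by rewrite /step_cmd /= cell_cmd_wf /= !inE !negb_or /= !(negbTE (cell_cmd_writes _ _ _)).
Qed.

Lemma column_cmd_local : local (CFor 34 31 step_cmd).
Proof. by rewrite /step_cmd /local /=; apply: cell_cmd_local. Qed.

#[local] Opaque step_cmd.

Definition snake_body : cmd :=
  CFor 34 31 step_cmd ;; CAdd 35 35 unit_reg ;; CSub 36 unit_reg 36.

Lemma snake_body_wf cnt : cnt \in [:: 30; 38] -> wf_cmd (CFor 33 cnt snake_body).
Proof.
rewrite !inE => hc; rewrite /snake_body.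
have h33 := @column_cmd_writes 33 isT isT.
have hcn : cnt \notin writes (CFor 34 31 step_cmd).
  by case/orP: hc => /eqP->; apply: column_cmd_writes.
have E : writes (CFor 34 31 step_cmd ;; CAdd 35 35 unit_reg ;; CSub 36 unit_reg 36)
   = writes (CFor 34 31 step_cmd) ++ [:: 35; 36] by [].
rewrite /wf_cmd -/wf_cmd -/(wf_cmd (CFor 34 31 step_cmd)) column_cmd_wf !andTb.
rewrite E mem_cat (negbTE h33) 2![cnt \in _]in_cons mem_cat (negbTE hcn) !inE /=.
by case/orP: hc => /eqP->.
Qed.

Lemma snake_cmd_spec M h w i0 cnt (up : bool) : agree M0 M ->
  M 31 = h -> M 39 = h.-1 -> M cnt = w -> cnt \in [:: 30; 38] ->
  output (snake_cmd b i0 cnt up) M = map cell_vertex (snake h i0 w up) /\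
  time (snake_cmd b i0 cnt up) M <= 5 + w * (h * 13 + 9).
Proof.
move=> ag e31 e39 ecnt hc.
pose M1 := upd (upd M 35 i0) 36 up.
have ec1 : M1 cnt = w by move: hc; rewrite !inE -ecnt => /orP[]/eqP->.
pose Inv (k : nat) M' := [/\ agree M0 M', M' 31 = h, M' 39 = h.-1, M' 35 = i0 + k
                          & M' 36 = (odd k (+) up)].
have -> : output (snake_cmd b i0 cnt up) M = output (CFor 33 cnt snake_body) M1 by [].
have -> : time (snake_cmd b i0 cnt up) M = 2 + time (CFor 33 cnt snake_body) M1 by [].
have [|k M' hk er ea [ag' i31 i39 i35 i36]|_ -> ht] := for_rule (Inv := Inv)
  (F := fun j => map cell_vertex (column h (i0 + j) (odd j (+) up)))
  (K := h * 13 + 5) (M := M1) (snake_body_wf hc).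
- split; rewrite /M1 /upd /= ?addn0 //.
  by do 3 apply: agree_upd => //.
- have [o1 t1] := column_cmd_spec ag' i31 i39 i35 i36.
  have fr r : r \in [:: 31; 39; 35; 36] -> mem_after (CFor 34 31 step_cmd) M' r = M' r.
    by rewrite !inE => /or4P[]/eqP->; apply: mem_after_frame; apply: column_cmd_writes.
  have agc : agree M0 (mem_after (CFor 34 31 step_cmd) M').
    by apply: agree_trans ag' (local_agree column_cmd_local (agree_unit ag')).
  have u2 := agree_unit agc.
  rewrite /snake_body; split.
  + set M2 := mem_after (CFor 34 31 step_cmd) M' in fr agc u2.
    rewrite -[mem_after _ M']/(upd (upd M2 35 (M2 35 + M2 8)) 36
       (upd M2 35 (M2 35 + M2 8) 8 - upd M2 35 (M2 35 + M2 8) 36)).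
    clearbody M2; split.
    * by apply: agree_incr => //; do 2 apply: agree_upd => //.
    * by rewrite /incr /upd /= fr.
    * by rewrite /incr /upd /= fr.
    * by rewrite /incr /upd /= fr // (u2 : M2 8 = 1) i35 addn1 addnS.
    * by rewrite /incr /upd /= (u2 : M2 8 = 1) (fr 36) // i36; case: (odd k); case: (up).
  + by rewrite -[LHS]/(output (CFor 34 31 step_cmd) M' ++ [::]) cats0.
  + by rewrite -[X in X <= _]/(time (CFor 34 31 step_cmd) M' + 2); lia.
split; first by rewrite ec1 /snake map_flatten -map_comp.
by move: ht; rewrite ec1; lia.
Qed.

Lemma zigzag_cmd_spec M h : agree M0 M -> M 31 = h ->
  [/\ output (zigzag_cmd b) M = map cell_vertex (zigzag h),
      time (zigzag_cmd b) M <= 3 + h * 16,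
      agree M0 (mem_after (zigzag_cmd b) M) &
      forall r, r \in [:: 30; 31; 39] -> mem_after (zigzag_cmd b) M r = M r].
Proof.
move=> ag e31.
have wr r : r < 40 -> r != 34 -> r != 8 -> r \notin writes (zigzag_cmd b).
  move=> h1 h2 h3; rewrite /zigzag_cmd /= !inE mem_cat !negb_or h2 h3.
  by rewrite !cell_cmd_writes.
have lo : local (zigzag_cmd b).
  rewrite /local /zigzag_cmd /= all_cat.
  by rewrite -!/(local (cell_cmd b _ _)) !cell_cmd_local.
have wf : wf_cmd (zigzag_cmd b).
  have hw r : r < 40 -> r \notin writes (cell_cmd b (xreg 0) 34 ;; cell_cmd b unit_reg 34).
    move=> hr; rewrite -[writes _]/(writes (cell_cmd b (xreg 0) 34) ++ writes (cell_cmd b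
      unit_reg 34)).
    by rewrite mem_cat negb_or !cell_cmd_writes.
  apply/and4P; split=> //; [by apply/andP; split; apply: cell_cmd_wf|exact: hw|].
  by rewrite 2!in_cons !negb_or hw.
pose Inv (k : nat) M' := agree M0 M'.
have [|k M' hk er ea ag'|_ o1 t1] := for_rule (Inv := Inv)
  (F := fun j => [:: cell_vertex (0, j); cell_vertex (1, j)]) (K := 12) (M := M) wf.
- exact: agree_upd.
- have [o1 [t1 m1]] := @cell_cmd_spec (xreg 0) 34 M' ag' isT isT.
  pose M1 := mem_after (cell_cmd b (xreg 0) 34) M'.
  have ag1 : agree M0 M1.
    by apply: agree_trans ag' (local_agree (cell_cmd_local _ _) (agree_unit ag')).
  have [o2 [t2 m2]] := @cell_cmd_spec unit_reg 34 M1 ag1 isT isT.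
  split.
  + apply: agree_incr => //=.
    by apply: agree_trans ag1 (local_agree (cell_cmd_local _ _) (agree_unit ag1)).
  + rewrite /= -/M1 o1 o2 /= (agree_unit ag1) /M1 m1 // er ag' //.
    by rewrite z0.
  + by rewrite /= -/M1; apply: (@leq_add _ _ 6 6).
- split; rewrite ?o1 -?e31 //.
  + by rewrite /zigzag map_flatten -map_comp.
  + by apply: agree_trans ag (local_agree lo (agree_unit ag)).
  + by move=> r; rewrite !inE => /or3P[]/eqP->; rewrite mem_after_frame ?wr.
Qed.

Lemma parity_cmd_spec M w h : agree M0 M -> M 30 = w -> M 31 = h -> M 32 = 0 ->
  [/\ output (CFor 33 30 (CSub 32 unit_reg 32)) M = [::],
      time (CFor 33 30 (CSub 32 unit_reg 32)) M <= 3 + w * 5 &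
      let M' := mem_after (CFor 33 30 (CSub 32 unit_reg 32)) M in
      [/\ agree M0 M', M' 30 = w, M' 31 = h, M' 39 = M 39 & M' 32 = odd w]].
Proof.
move=> ag e30 e31 e32.
pose Inv (k : nat) M' := [/\ agree M0 M', M' 30 = w, M' 31 = h, M' 39 = M 39 & M' 32 = odd k].
have [|k M' hk er ea [ag' i30 i31 i39 i32]|i o t] := for_rule (Inv := Inv)
  (F := fun _ => [::]) (K := 1) (M := M) (isT : wf_cmd (CFor 33 30 (CSub 32 unit_reg 32))).
- by split=> //; apply: agree_upd.
- have u' := agree_unit ag'; split=> //; split; rewrite /= /incr.
  + by apply: agree_incr => //; apply: agree_upd.
  + by rewrite /upd /=.
  + by rewrite /upd /=.
  + by rewrite /upd /=.
  + by rewrite /upd /= (u' : M' 8 = 1) i32; case: (odd k).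
by split; [rewrite o e30; elim: (iota 0 w)|rewrite -e30|rewrite e30 in i].
Qed.

Lemma grid_cmd_spec M w h diag : agree M0 M -> M 30 = w -> M 31 = h -> 0 < w -> 0 < h ->
  output (grid_cmd b diag) M = map cell_vertex (grid_path diag w h) /\
  time (grid_cmd b diag) M <= 70 * (w * h).
Proof.
move=> ag e30 e31 w0 h0.
pose M2 := upd (upd M 39 (M 31 - M unit_reg)) 32 0.
have ag2 : agree M0 M2 by do 2 apply: agree_upd => //.
have [o3 t3 [ag3 e30' e31' e39' e32']] := parity_cmd_spec ag2 (e30 : M2 30 = w) (e31 : M2 31 = h)
  erefl.
set M3 := mem_after _ M2 in ag3 e30' e31' e39' e32'.
have {}e39' : M3 39 = h.-1.
  by rewrite e39' /M2 /upd /= e31 (agree_unit ag) subn1.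
have u3 : M3 8 = 1 by exact: agree_unit ag3.
pose pure := snake_cmd b 0 30 false.
pose zig := zigzag_cmd b ;; CConst 38 2 ;; CSub 38 30 38 ;; snake_cmd b 2 38 true.
pose br := if diag then CIf 32 unit_reg zig pure else CIf 32 unit_reg pure (CIf unit_reg 30 zig
  pure).
have [op tp] := snake_cmd_spec 0 false ag3 e31' e39' e30' (isT : 30 \in [:: 30; 38]).
have [oz tz] : output zig M3 = map cell_vertex (zigzag h ++ snake h 2 (w - 2) true) /\
    time zig M3 <= 10 + h * 16 + w * (h * 13 + 9).
  have [oz tz agz fz] := zigzag_cmd_spec ag3 e31'.
  set M4 := mem_after _ M3 in agz fz.
  pose M5 := upd (upd M4 38 2) 38 (upd M4 38 2 30 - upd M4 38 2 38).
  have ag5 : agree M0 M5 by do 2 apply: agree_upd => //.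
  have e1 : M5 31 = h by rewrite /M5 /upd /= fz.
  have e2 : M5 39 = h.-1 by rewrite /M5 /upd /= fz.
  have e3 : M5 38 = w - 2 by rewrite /M5 /upd /= fz // e30'.
  have [os ts] := snake_cmd_spec 2 true ag5 e1 e2 e3 (isT : 38 \in [:: 30; 38]).
  split; first by rewrite map_cat -oz -os.
  have -> : time zig M3 = time (zigzag_cmd b) M3 + (2 + time (snake_cmd b 2 38 true) M5) by [].
  have hm : (w - 2) * (h * 13 + 9) <= w * (h * 13 + 9) by rewrite leq_mul2r leq_subr orbT.
  move: (_ * _) (w * (_ + 9)) hm ts => a1 a2 hm ts; lia.
have -> : output (grid_cmd b diag) M = output br M3.
  by rewrite -[LHS]/(output (CFor 33 30 (CSub 32 unit_reg 32)) M2 ++ output br M3) o3.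
have -> : time (grid_cmd b diag) M =
  2 + (time (CFor 33 30 (CSub 32 unit_reg 32)) M2 + time br M3) by [].
have [ob tb] : output br M3 = map cell_vertex (grid_path diag w h) /\
    time br M3 <= 14 + h * 16 + w * (h * 13 + 9).
  have pureE : output pure M3 = map cell_vertex (snake h 0 w false) := op.
  have tpE : time pure M3 <= 5 + w * (h * 13 + 9) := tp.
  rewrite /br /grid_path; clearbody pure zig.
  case: (diag); rewrite /= e32' u3; case ow: (odd w) => /=.
  - by split=> //; lia.
  - have -> : 1 < w by case: (w) w0 ow => [|[]].
    by split=> //; lia.
  - by rewrite e30'; case: ifP => _; split=> //; lia.
  - by split=> //; lia.
split=> //.
(* Both factors are positive, so constant and linear terms are absorbed by [w * h]; the sum of the
   coefficients stays below 70. *)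
have h1 : w <= w * h by rewrite leq_pmulr.
have h2 : h <= w * h by rewrite leq_pmull.
move: t3 tb; rewrite mulnDr mulnA [w * 5]mulnC => t3 tb; lia.
Qed.

Definition reflect_y (M : memory) (v : vertex) : vertex := (v.1, M 9 - v.2).

Let bp := place (fun nm => M0 (xreg nm)) (fun nm => M0 (yreg nm)) b.

(** The [1 +] pays for the emptiness tests of a block that outputs nothing. *)
Lemma block_cmd_spec :
  output (block_cmd b) M0 = map (reflect_y M0) (block_path bp) /\
  time (block_cmd b) M0 <= 80 * (1 + size (block_path bp)).
Proof.
have ag0 : agree M0 M0 by [].
have /and4P[n1 n2 n3 n4] := nb.
pose body := if kd b is Vert then
         CSub 30 (yreg (y2 b)) (yreg (y1 b)) ;; CSub 31 (xreg (x2 b)) (xreg (x1 b)) ;;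
         grid_cmd b false
       else
         CSub 30 (xreg (x2 b)) (xreg (x1 b)) ;; CSub 31 (yreg (y2 b)) (yreg (y1 b)) ;;
         grid_cmd b (if kd b is Diag then true else false).
have oE : output (block_cmd b) M0 = if M0 (xreg (x1 b)) < M0 (xreg (x2 b)) then
    if M0 (yreg (y1 b)) < M0 (yreg (y2 b)) then output body M0 else [::] else [::] by [].
have tE : time (block_cmd b) M0 = if M0 (xreg (x1 b)) < M0 (xreg (x2 b)) then
    (if M0 (yreg (y1 b)) < M0 (yreg (y2 b)) then (time body M0).+1 else 2).+1 else 2 by [].
rewrite oE tE.
case: (ltnP (M0 (xreg (x1 b))) (M0 (xreg (x2 b)))) => hx; last first.
  by rewrite block_path_nil // /nonempty negb_and -!leqNgt hx.
case: (ltnP (M0 (yreg (y1 b))) (M0 (yreg (y2 b)))) => hy; last first.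
  by rewrite block_path_nil // /nonempty negb_and -!leqNgt hy orbT.
pose w := M0 (xreg (x2 b)) - M0 (xreg (x1 b)).
pose h := M0 (yreg (y2 b)) - M0 (yreg (y1 b)).
have w0 : 0 < w by rewrite subn_gt0.
have h0 : 0 < h by rewrite subn_gt0.
have seqE a1 a2 a3 a4 c :
  let M := upd (upd M0 30 (M0 a1 - M0 a2)) 31 (upd M0 30 (M0 a1 - M0 a2) a3 - upd M0 30 (M0 a1 -
    M0 a2) a4) in
  output (CSub 30 a1 a2 ;; CSub 31 a3 a4 ;; c) M0 = output c M /\
  time (CSub 30 a1 a2 ;; CSub 31 a3 a4 ;; c) M0 = 2 + time c M by [].
have upx v nm : nm < 10 -> upd M0 30 v (xreg nm) = M0 (xreg nm).
  by move=> hn; rewrite /upd /xreg; case: eqP => // e; lia.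
have upy v nm : nm < 10 -> upd M0 30 v (yreg nm) = M0 (yreg nm).
  by move=> hn; rewrite /upd /yreg; case: eqP => // e; lia.
have spec (d : bool) (w' h' : nat) : 0 < w' -> 0 < h' ->
  output (grid_cmd b d) (upd (upd M0 30 w') 31 h') = map cell_vertex (grid_path d w' h') /\
  time (grid_cmd b d) (upd (upd M0 30 w') 31 h') <= 70 * (w' * h').
  by move=> w1 h1; apply: grid_cmd_spec => //; do 2 apply: agree_upd => //.
have sz : size (block_path bp) = w * h by rewrite size_block_path.
rewrite sz /body /block_path [kd bp]/=.
case ek: (kd b).
- have [-> ->] := seqE (xreg (x2 b)) (xreg (x1 b)) (yreg (y2 b)) (yreg (y1 b)) (grid_cmd b true).
  rewrite !upy // -/w -/h; have [-> ht] := spec true w h w0 h0; split; last by lia.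
  by rewrite -map_comp; apply: eq_map => c; rewrite /cell_vertex ek.
- have [-> ->] := seqE (xreg (x2 b)) (xreg (x1 b)) (yreg (y2 b)) (yreg (y1 b)) (grid_cmd b false).
  rewrite !upy // -/w -/h; have [-> ht] := spec false w h w0 h0; split; last by lia.
  by rewrite -map_comp; apply: eq_map => c; rewrite /cell_vertex ek.
- have [-> ->] := seqE (yreg (y2 b)) (yreg (y1 b)) (xreg (x2 b)) (xreg (x1 b)) (grid_cmd b false).
  rewrite !upx // -/w -/h; have [-> ht] := spec false h w h0 w0; split; last by lia.
  by rewrite -map_comp; apply: eq_map => c; rewrite /cell_vertex ek.
Qed.
End BlockCmd.

Lemma block_cmd_wf b : wf_cmd (block_cmd b).
Proof.
by rewrite /block_cmd /grid_cmd /zigzag_cmd /snake_cmd /cell_cmd /coord_cmd;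
  case: (kd b); case: (ex b); case: (ey b).
Qed.

Lemma block_cmd_local b : local (block_cmd b).
Proof.
by rewrite /block_cmd /grid_cmd /zigzag_cmd /snake_cmd /cell_cmd /coord_cmd;
  case: (kd b); case: (ex b); case: (ey b).
Qed.

#[local] Opaque block_cmd.

Definition ready (M : memory) := M unit_reg = 1 /\ M (xreg 0) = 0.

Lemma ready_agree M M' : ready M -> agree M M' -> ready M'.
Proof. by move=> [u z] ag; split; rewrite ag. Qed.

Definition at_regs (M : memory) : block -> block :=
  place (fun nm => M (xreg nm)) (fun nm => M (yreg nm)).

Lemma at_regs_agree M M' b : named b -> agree M M' -> at_regs M' b = at_regs M b.
Proof.
move=> /and4P[n1 n2 n3 n4] ag; rewrite /at_regs /place.
by rewrite !ag // /xreg /yreg /scratch; lia.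
Qed.

Definition plan_cmd (bs : seq block) : cmd := foldr (fun b c => block_cmd b ;; c) CSkip bs.

Lemma plan_cmd_wf bs : wf_cmd (plan_cmd bs).
Proof. by elim: bs => //= b bs ->; rewrite block_cmd_wf. Qed.

Lemma plan_cmd_spec M bs : ready M -> all named bs ->
  let P := plan_path (map (at_regs M) bs) in
  output (plan_cmd bs) M = map (reflect_y M) P /\
  time (plan_cmd bs) M <= 80 * (size bs + size P).
Proof.
elim: bs M => // b bs IH M rM /andP[nb nbs] P.
have [o1 t1] := block_cmd_spec nb rM.1 rM.2.
have ag := local_agree (block_cmd_local b) rM.1.
have [o2 t2] := IH _ (ready_agree rM ag) nbs.
have e : map (at_regs (mem_after (block_cmd b) M)) bs = map (at_regs M) bs.
  by elim: bs nbs {IH P o2 t2} => //= b' bs IH /andP[nb' /IH->]; rewrite (at_regs_agree nb' ag).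
rewrite e in o2 t2; rewrite /plan_cmd /= -/(plan_cmd bs) o1 o2 /P /plan_path /= map_cat.
split.
  congr cat; apply: eq_map => v; rewrite /reflect_y ag //.
have {}t1 : time (block_cmd b) M <= 80 * (1 + size (block_path (at_regs M b))) := t1.
by rewrite size_cat; move: t1 t2; rewrite /plan_path; lia.
Qed.

(** * Choosing between two templates *)

Definition count_block (dst : nat) (b : block) : cmd :=
  CIf (xreg (x1 b)) (xreg (x2 b))
    (CIf (yreg (y1 b)) (yreg (y2 b))
      (CSub 30 (yreg (y2 b)) (yreg (y1 b)) ;; CSub 31 (xreg (x2 b)) (xreg (x1 b)) ;;
       CFor 33 31 (CAdd dst dst 30)) CSkip) CSkip.

Definition count_cmd (dst : nat) (bs : seq block) : cmd :=
  CConst dst 0 ;; foldr (fun b c => count_block dst b ;; c) CSkip bs.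

(** The area is found by adding the height once per column. In a nonempty block there are at most as
    many columns as vertices, so measuring a template costs no more than its length and number of
    blocks up to a constant factor. *)
Lemma count_block_spec M dst b : ready M -> named b -> dst \in [:: 44; 45] ->
  let c := count_block dst b in
  [/\ output c M = [::], time c M <= 12 * (1 + size (block_path (at_regs M b))),
      agree M (mem_after c M),
      mem_after c M dst = M dst + size (block_path (at_regs M b)) &
      forall r, r \in [:: 44; 45] -> r != dst -> mem_after c M r = M r].
Proof.
move=> rM nb hd c; rewrite size_block_path.
have /and4P[n1 n2 n3 n4] := nb.
have wr r : r \in [:: 44; 45] -> r != dst -> r \notin writes c.
  by move=> h1 h2; rewrite /c /= /unit_reg; move: h1 h2 hd; rewrite !inE; lia.
have lc : local c by move: hd; rewrite /c !inE => /orP[]/eqP->.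
have ag := local_agree lc rM.1.
have fr r : r \in [:: 44; 45] -> r != dst -> mem_after c M r = M r.
  by move=> h1 h2; apply: mem_after_frame; apply: wr.
pose body := CFor 33 31 (CAdd dst dst 30).
pose w := M (xreg (x2 b)) - M (xreg (x1 b)); pose h := M (yreg (y2 b)) - M (yreg (y1 b)).
rewrite [x1 _]/= [x2 _]/= [y1 _]/= [y2 _]/= -/w -/h.
pose M1 := upd (upd M 30 h) 31 w.
have eM : upd (upd M 30 h) 31 (upd M 30 h (xreg (x2 b)) - upd M 30 h (xreg (x1 b))) = M1.
  rewrite /M1 /w /xreg; congr (upd _ _ (_ - _)); rewrite /upd; case: eqP => //; lia.
have oE : output c M = if M (xreg (x1 b)) < M (xreg (x2 b)) then
   if M (yreg (y1 b)) < M (yreg (y2 b)) then output body M1 else [::] else [::].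
  by rewrite -eM.
have tE : time c M = if M (xreg (x1 b)) < M (xreg (x2 b)) then
   (if M (yreg (y1 b)) < M (yreg (y2 b)) then (2 + time body M1).+1 else 2).+1 else 2.
  by rewrite -eM.
have mE : mem_after c M = if M (xreg (x1 b)) < M (xreg (x2 b)) then
   if M (yreg (y1 b)) < M (yreg (y2 b)) then mem_after body M1 else M else M.
  by rewrite -eM.
pose Inv (k : nat) M' := M' 30 = h /\ M' dst = M dst + k * h.
have wf : wf_cmd body by move: hd; rewrite /body !inE => /orP[]/eqP->.
have [|k M' hk er ea [i30 id]|[_ id] o t] := for_rule (Inv := Inv) (F := fun _ => [::])
  (K := 1) (M := M1) wf.
- split; first by [].
  by move: hd; rewrite /M1 /upd !inE => /orP[]/eqP-> /=; rewrite addn0.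
- split=> //; split; move: hd i30 id; rewrite !inE => /orP[]/eqP-> i30 id;
    by rewrite /incr /= /upd /= ?id ?i30 ?mulSn //; lia.
have eW : M1 31 = w by [].
rewrite eW in id o t.
rewrite oE tE mE; split=> //.
- by case: ifP => // _; case: ifP => // _; rewrite o; elim: (iota 0 w).
- have hp : 0 < h -> w <= w * h by move=> h0; rewrite leq_pmulr.
  have {}hp : M (yreg (y1 b)) < M (yreg (y2 b)) -> w <= w * h by rewrite -subn_gt0.
  move: (w * h) hp t => p hp t; case: (M (xreg _) < _); last by lia.
  case: ifP => hy; last by lia.
  by move: (hp hy) t; rewrite -/body; lia.
- by rewrite -mE.
- case: (ltnP (M (xreg (x1 b)))) => hx; last by rewrite (_ : w = 0) ?addn0 //; apply/eqP.
  case: (ltnP (M (yreg (y1 b)))) => hy; last by rewrite (_ : h = 0) ?muln0 ?addn0 //; apply/eqP.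
  exact: id.
- by rewrite -mE.
Qed.

Lemma count_block_wf dst b : dst \in [:: 44; 45] -> wf_cmd (count_block dst b).
Proof. by rewrite !inE => /orP[]/eqP->. Qed.

#[local] Opaque count_block.

Lemma count_cmd_spec M dst bs : ready M -> all named bs -> dst \in [:: 44; 45] ->
  let c := count_cmd dst bs in let P := plan_path (map (at_regs M) bs) in
  [/\ output c M = [::], time c M <= 12 * (1 + size bs + size P),
      agree M (mem_after c M), mem_after c M dst = size P &
      forall r, r \in [:: 44; 45] -> r != dst -> mem_after c M r = M r].
Proof.
move=> rM nbs hd c P; rewrite /c /count_cmd.
pose c' := foldr (fun b c => count_block dst b ;; c) CSkip bs.
have key M1 : ready M1 -> agree M M1 ->
  [/\ output c' M1 = [::], time c' M1 <= 12 * (size bs + size P),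
      agree M (mem_after c' M1), mem_after c' M1 dst = M1 dst + size P &
      forall r, r \in [:: 44; 45] -> r != dst -> mem_after c' M1 r = M1 r].
  rewrite /c' /P; elim: bs nbs M1 {c c' P} => [|b bs IH] nbs M1 r1 ag1.
    by split=> //; rewrite addn0.
  have /andP[nb nbs'] := nbs.
  have [o1 t1 a1 d1 f1] := count_block_spec r1 nb hd.
  have ag2 := agree_trans ag1 a1.
  have [o2 t2 a2 d2 f2] := IH nbs' _ (ready_agree r1 a1) ag2.
  rewrite (at_regs_agree nb ag1) in t1 d1.
  rewrite /= o1 o2 /plan_path /= size_cat -/(plan_path _); split=> //.
  - by move: t1 t2; rewrite /plan_path; lia.
  - by rewrite d2 d1 addnA.
  - by move=> r h1 h2; rewrite f2 ?f1.
have ag1 : agree M (upd M dst 0).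
  by apply: agree_upd => //; move: hd; rewrite !inE => /orP[]/eqP->.
have [o t a d f] := key _ (ready_agree rM ag1) ag1.
split=> //.
- rewrite -[X in X <= _]/(1 + time c' (upd M dst 0)); lia.
- by rewrite -[LHS]/(mem_after c' (upd M dst 0) dst) d /upd eqxx.
- move=> r h1 h2; rewrite -[LHS]/(mem_after c' (upd M dst 0) r) f //.
  by rewrite /upd (negbTE h2).
Qed.

Lemma count_cmd_wf dst bs : dst \in [:: 44; 45] -> wf_cmd (count_cmd dst bs).
Proof.
by move=> hd; rewrite /count_cmd /=; elim: bs => //= b bs ->; rewrite count_block_wf.
Qed.

(** With two windows the larger one depends on the actual lengths, so both templates are measured
    and the longer path is output. *)
Definition leaf_cmd (ts : seq (seq block)) : cmd :=
  match ts with
  | [::] => CSkip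
  | [:: t] => plan_cmd t
  | t1 :: t2 :: _ =>
    count_cmd 44 t1 ;; count_cmd 45 t2 ;; CIf 44 45 (plan_cmd t2) (plan_cmd t1)
  end.

#[local] Opaque count_cmd plan_cmd.

Lemma leaf_cmd_wf ts : wf_cmd (leaf_cmd ts).
Proof.
case: ts => [|t [|t' ts]] //=; first exact: plan_cmd_wf.
by rewrite !count_cmd_wf // !plan_cmd_wf.
Qed.

Lemma leaf_cmd_spec M ts : ready M -> all (all named) ts -> 0 < size ts <= 2 ->
  let P t := plan_path (map (at_regs M) t) in
  time (leaf_cmd ts) M <= 100 * (1 + sumn [seq size t + size (P t) | t <- ts]) /\
  exists2 i, i < size ts &
    output (leaf_cmd ts) M = map (reflect_y M) (P (nth [::] ts i)) /\
    forall j, j < size ts -> size (P (nth [::] ts j)) <= size (P (nth [::] ts i)).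
Proof.
case: ts => [|t1 [|t2 [|//]]] //= rM.
  rewrite andbT => nt _; have [o t] := plan_cmd_spec rM nt.
  split; first by lia.
  by exists 0 => //; split=> // -[].
move=> /and3P[nt1 nt2 _] _.
have [o1 h1 a1 d1 _] := count_cmd_spec rM nt1 (isT : 44 \in [:: 44; 45]).
set M1 := mem_after _ M in a1 d1; have r1 := ready_agree rM a1.
have [o2 h2 a2 d2 f2] := count_cmd_spec r1 nt2 (isT : 45 \in [:: 44; 45]).
set M2 := mem_after _ M1 in a2 d2 f2; have r2 := ready_agree r1 a2.
have a12 := agree_trans a1 a2.
have eqP M' t : agree M M' -> all named t -> map (at_regs M') t = map (at_regs M) t.
  by move=> ag; elim: t => //= b t IH /andP[nb /IH->]; rewrite (at_regs_agree nb ag).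
have [o3 h3] := plan_cmd_spec r2 nt2; have [o4 h4] := plan_cmd_spec r2 nt1.
rewrite (eqP M1 t2 a1 nt2) in d2 h2.
rewrite (eqP M2 t2 a12 nt2) in o3 h3; rewrite (eqP M2 t1 a12 nt1) in o4 h4.
have er v : reflect_y M2 v = reflect_y M v by rewrite /reflect_y a12.
have d1' : M2 44 = size (plan_path (map (at_regs M) t1)) by rewrite f2.
rewrite -/M1 -/M2 o1 o2 d1' d2; set p1 := plan_path _ in d1 d1' h1 o4 h4 *.
set p2 := plan_path _ in d2 h2 h3 o3 *.
case: ltnP => hlt /=; rewrite ?o3 ?o4 (eq_map er); split; try by move: h1 h2 h3 h4; lia.
  by exists 1 => //; split=> // -[|[|//]] _ //=; apply: ltnW.
by exists 0 => //; split=> // -[|[|//]] _.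
Qed.

(** * Recognising the classes at run time *)

Definition link_cmd (l : link) (a b : nat) : cmd :=
  match l with
  | LEq => CIf a b (CConst 46 0) CSkip ;; CIf b a (CConst 46 0) CSkip
  | LSucc => CAdd 47 a unit_reg ;; CIf 47 b (CConst 46 0) CSkip ;; CIf b 47 (CConst 46 0) CSkip
  | LLt => CIf a b CSkip (CConst 46 0)
  | LLe => CIf b a (CConst 46 0) CSkip
  end.

Fixpoint chain_cmd (reg : nat -> nat) (prev : nat) (ch : seq (link * nat)) : cmd :=
  if ch is (l, n) :: ch' then link_cmd l (reg prev) (reg n) ;; chain_cmd reg n ch' else CSkip.

(** Register 46 is a flag that a failing link clears and no link sets again, so a sequence of links
    computes a conjunction. Equality is tested as the failure of both strict comparisons. *)
Lemma link_cmd_spec M l a b (f : bool) : M unit_reg = 1 -> a < scratch -> b < scratch ->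
  M 46 = f ->
  let c := link_cmd l a b in
  [/\ output c M = [::], time c M <= 7, agree M (mem_after c M) &
      mem_after c M 46 = f && link_holds l (M a) (M b)].
Proof.
move=> u ha hb ef c.
have ag : agree M (mem_after c M) by apply: local_agree => //; rewrite /c; case: (l).
have e46 v r : r < scratch -> upd M 46 v r = M r.
  by move=> hr; rewrite /upd; case: eqP => // e; subst r.
have e47 v r : r < scratch -> upd M 47 v r = M r.
  by move=> hr; rewrite /upd; case: eqP => // e; subst r.
have e4746 v v' r : r < scratch -> upd (upd M 47 v) 46 v' r = M r.
  by move=> hr; rewrite /upd; case: eqP => [e|_]; [|case: eqP => // e]; subst r.
have c46 v : upd M 46 v 46 = v by rewrite /upd eqxx.
have c47 v v' : upd (upd M 47 v) 46 v' 46 = v' by rewrite /upd eqxx.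
have d47 v : upd M 47 v 46 = f by rewrite /upd.
have f47 v : upd M 47 v 47 = v by rewrite /upd eqxx.
have g47 v v' : upd (upd M 47 v) 46 v' 47 = v by rewrite /upd eqxx.
split=> //; rewrite {ag}/c; case: l => /=.
- by case: (M a < M b); rewrite ?e46 //; case: (M b < M a).
- by rewrite ?f47 ?e47 //; case: (_ < _); rewrite ?g47 ?e4746 ?f47 ?e47 //; case: (_ < _).
- by case: (M a < M b).
- by case: (M b < M a).
- by case: (M a < M b); rewrite ?e46 //; case: (M b < M a).
- by rewrite ?f47 ?e47 //; case: (_ < _); rewrite ?g47 ?e4746 ?f47 ?e47 //; case: (_ < _).
- by case: (M a < M b).
- by case: (M b < M a).
- have -> : (M b == M a) = ~~ (M a < M b) && ~~ (M b < M a) by lia.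
  case: (M a < M b); rewrite ?e46 //; case: (M b < M a);
    by rewrite ?c46 ?ef ?andbF ?andbT.
- have -> : (M b == (M a).+1) = ~~ ((M a).+1 < M b) && ~~ (M b < (M a).+1) by lia.
  rewrite (u : M 8 = 1) addn1 f47 e47 //; case: ((M a).+1 < M b);
    rewrite ?g47 ?f47 ?e4746 ?e47 //; case: (M b < (M a).+1);
    by rewrite ?c47 ?d47 ?andbF ?andbT.
- by case: (M a < M b); rewrite ?c46 ?ef ?andbT ?andbF.
- by case: ltnP => h; rewrite ?c46 ?ef ?andbT ?andbF.
Qed.

Lemma link_cmd_wf l a b : wf_cmd (link_cmd l a b).
Proof. by case: l. Qed.

Lemma chain_cmd_wf reg prev ch : wf_cmd (chain_cmd reg prev ch).
Proof. by elim: ch prev => //= -[l n] ch IH prev; rewrite /= link_cmd_wf IH. Qed.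

#[local] Opaque link_cmd.

Lemma chain_holds_agree M M' reg prev ch : agree M M' -> reg prev < scratch ->
  all (fun x => reg x.2 < scratch) ch ->
  chain_holds (fun nm => M' (reg nm)) prev ch = chain_holds (fun nm => M (reg nm)) prev ch.
Proof.
move=> ag; elim: ch prev => //= -[l n] ch IH prev hp /andP[/= h1 h2].
by rewrite !ag // IH.
Qed.

Lemma chain_cmd_spec M reg prev ch (f : bool) : M unit_reg = 1 ->
  reg prev < scratch -> all (fun x => reg x.2 < scratch) ch -> M 46 = f ->
  let c := chain_cmd reg prev ch in
  [/\ output c M = [::], time c M <= 7 * size ch, agree M (mem_after c M) &
      mem_after c M 46 = f && chain_holds (fun nm => M (reg nm)) prev ch].
Proof.
elim: ch M prev f => [|[l n] ch IH] M prev f u hp.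
  by move=> _ ef c; split=> //; rewrite /= ef andbT.
move=> /andP[/= hn hch] ef.
have [o1 t1 a1 e1] := link_cmd_spec l u hp hn ef.
have u1 : mem_after (link_cmd l (reg prev) (reg n)) M unit_reg = 1 by rewrite a1.
have [o2 t2 a2 e2] := IH _ n _ u1 hn hch e1.
split.
- by rewrite o1 o2.
- by rewrite mulnS; apply: leq_add.
- exact: agree_trans a1 a2.
by rewrite e2 -andbA (chain_holds_agree a1).
Qed.

Definition pair_entry : Type := seq (link * nat) * seq (link * nat) * seq (seq block).

(** Linear search for the first matching pair of classes; comparing the zero register [xreg 0] with
    register 46 tests the flag. *)
Fixpoint dispatch_cmd (ps : seq pair_entry) : cmd :=
  if ps is (cx, cy, ts) :: ps' then
    CConst 46 1 ;; chain_cmd xreg 0 cx ;; chain_cmd yreg 0 cy ;;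
    CIf (xreg 0) 46 (leaf_cmd ts) (dispatch_cmd ps')
  else CSkip.

Definition entry_holds (vx vy : nat -> nat) (p : pair_entry) : bool :=
  chain_holds vx 0 p.1.1 && chain_holds vy 0 p.1.2.

Definition entry_named (p : pair_entry) : bool :=
  all (fun x => x.2 < 10) p.1.1 && all (fun x => x.2 < 10) p.1.2.

Lemma dispatch_cmd_wf ps : wf_cmd (dispatch_cmd ps).
Proof. by elim: ps => //= -[[cx cy] ts] ps IH; rewrite /= !chain_cmd_wf leaf_cmd_wf IH. Qed.

Definition entry_cost (p : pair_entry) := 4 + 7 * (size p.1.1 + size p.1.2).

#[local] Opaque leaf_cmd chain_cmd.

Lemma dispatch_cmd_spec M ps : ready M -> all entry_named ps ->
  has (entry_holds (fun nm => M (xreg nm)) (fun nm => M (yreg nm))) ps ->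
  exists M' p, [/\ agree M M', List.In p ps,
    entry_holds (fun nm => M (xreg nm)) (fun nm => M (yreg nm)) p,
    output (dispatch_cmd ps) M = output (leaf_cmd p.2) M' &
    time (dispatch_cmd ps) M <= sumn (map entry_cost ps) + time (leaf_cmd p.2) M'].
Proof.
elim: ps M => // -[[cx cy] ts] ps IH M rM /andP[/andP[nx ny] nps] hh.
have sx : all (fun x : link * nat => xreg x.2 < scratch) cx.
  by apply: sub_all nx => x; apply: xreg_lt.
have sy : all (fun x : link * nat => yreg x.2 < scratch) cy.
  by apply: sub_all ny => x; apply: yreg_lt.
pose M1 := upd M 46 1.
have a1 : agree M M1 by apply: agree_upd.
have r1 := ready_agree rM a1.
have [o2 t2 a2 e2] := chain_cmd_spec r1.1 (isT : xreg 0 < scratch) sx (erefl : M1 46 = true).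
set M2 := mem_after _ M1 in a2 e2.
have r2 := ready_agree r1 a2.
have [o3 t3 a3 e3] := chain_cmd_spec r2.1 (isT : yreg 0 < scratch) sy e2.
set M3 := mem_after _ M2 in a3 e3.
have r3 := ready_agree r2 a3.
have a13 : agree M M3 := agree_trans a1 (agree_trans a2 a3).
have hE : M3 46 = entry_holds (fun nm => M (xreg nm)) (fun nm => M (yreg nm)) (cx, cy, ts).
  by rewrite e3 /entry_holds /= !(chain_holds_agree a1) // (chain_holds_agree (agree_trans a1 a2)).
have z3 : M3 (xreg 0) = 0 := r3.2.
have oE : output (dispatch_cmd ((cx, cy, ts) :: ps)) M =
    if M3 (xreg 0) < M3 46 then output (leaf_cmd ts) M3 else output (dispatch_cmd ps) M3.
  rewrite -[LHS]/(output (chain_cmd xreg 0 cx) M1 ++ (output (chain_cmd yreg 0 cy) M2 ++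
    (if M3 (xreg 0) < M3 46 then output (leaf_cmd ts) M3 else output (dispatch_cmd ps) M3))).
  by rewrite o2 o3.
have tE : time (dispatch_cmd ((cx, cy, ts) :: ps)) M = 1 + (time (chain_cmd xreg 0 cx) M1 +
    (time (chain_cmd yreg 0 cy) M2 +
    (if M3 (xreg 0) < M3 46 then (time (leaf_cmd ts) M3).+1 else (time (dispatch_cmd ps) M3).+2))).
  by [].
rewrite oE tE z3 hE.
rewrite [has _ _]/= in hh.
case he: (entry_holds _ _ _) hh => /=.
  move=> _; exists M3, (cx, cy, ts); split=> //; first by left.
  by move: t2 t3; rewrite /= /entry_cost /=; clear; lia.
move=> hh.
have ex nm : nm < 10 -> M3 (xreg nm) = M (xreg nm).
  by move=> h; apply: a13; apply: xreg_lt.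
have ey nm : nm < 10 -> M3 (yreg nm) = M (yreg nm).
  by move=> h; apply: a13; apply: yreg_lt.
have eh p : entry_named p -> entry_holds (fun nm => M3 (xreg nm)) (fun nm => M3 (yreg nm)) p =
    entry_holds (fun nm => M (xreg nm)) (fun nm => M (yreg nm)) p.
  move=> /andP[px py].
  have px' : all (fun x : link * nat => xreg x.2 < scratch) p.1.1.
    by apply: sub_all px => x; apply: xreg_lt.
  have py' : all (fun x : link * nat => yreg x.2 < scratch) p.1.2.
    by apply: sub_all py => x; apply: yreg_lt.
  by rewrite /entry_holds !(chain_holds_agree a13).
have hh3 : has (entry_holds (fun nm => M3 (xreg nm)) (fun nm => M3 (yreg nm))) ps.
  elim: ps nps hh {IH oE tE} => //= p ps IH /andP[np /IH{}IH] /orP[h|/IH->]; last by rewrite orbT.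
  by rewrite eh ?h.
have [M' [p [ag' hin hp oL tL]]] := IH M3 r3 nps hh3.
exists M', p; split=> //.
- exact: agree_trans a13 ag'.
- by right.
- rewrite -eh //; elim: ps nps hin {IH hh hh3 oE tE oL tL} => //= p' ps IH /andP[np /IH{}IH]
  [<-|/IH] //.
- by move: t2 t3 tL; rewrite /= /entry_cost /=; clear; lia.
Qed.

(** * Reading the input: reflection, cut values and trimming *)

Definition trim_cmd (small start p q dst : nat) : cmd :=
  CConst 30 2 ;;
  CIf small 30
    (CAdd dst start 10 ;; CIf dst p (CAdd dst p 10) CSkip ;; CIf dst q (CAdd dst q 10) CSkip)
    CSkip.

Lemma trim_cmd_spec small start p q dst M : M 10 = 0 ->
  10 < dst < 30 -> small < 30 -> start < 30 -> p < 30 -> q < 30 ->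
  p != dst -> q != dst ->
  output (trim_cmd small start p q dst) M = [::] /\
  time (trim_cmd small start p q dst) M <= 10 /\
  forall r, r < 30 -> mem_after (trim_cmd small start p q dst) M r =
    if (r == dst) && (M small < 2) then maxn (maxn (M start) (M p)) (M q) else M r.
Proof.
move=> z hd hs hst hp hq pd qd.
have u30 r v : r < 30 -> upd M 30 v r = M r by rewrite /upd; case: eqP => // ->.
pose M1 := upd M 30 2.
have m1 r : r < 30 -> M1 r = M r by apply: u30.
have e30 : M1 30 = 2 by [].
have ud (N : memory) v r : upd N dst v r = if r == dst then v else N r by [].
have d10 : (10 == dst) = false by lia.
have pd' := negbTE pd; have qd' := negbTE qd.
rewrite /trim_cmd /= -/M1 e30 (m1 small) //.
case: (M small < 2) => /=; last by split=> //; split=> // r hr; rewrite andbF m1.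
rewrite !ud eqxx !d10 pd' !m1 // z !addn0.
have fin N v : (forall r, r < 30 -> r != dst -> N r = M r) -> N dst = v ->
    forall r, r < 30 -> N r = if (r == dst) && true then v else M r.
  by move=> h e r hr; rewrite andbT; case: (eqVneq r dst) => [->|/h->].
have N1 r : r < 30 -> r != dst -> M1 r = M r by move=> hr _; apply: m1.
have updd (N : memory) v : upd N dst v dst = v by rewrite ud eqxx.
case: (ltnP (M start) (M p)) => h1.
  rewrite !ud !eqxx ?qd' ?d10 ?pd' ?m1 // ?z ?addn0.
  case: (ltnP (M p) (M q)) => h2; (split; first by []); (split; first by []).
    by apply: fin; [move=> r hr hd'; rewrite !ud (negbTE hd') N1|exact: updd].
  by apply: fin; [move=> r hr hd'; rewrite !ud (negbTE hd') N1|exact: updd].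
rewrite !ud !eqxx ?qd' ?d10 ?m1 // ?z ?addn0.
case: (ltnP (M start) (M q)) => h2; (split; first by []); (split; first by []).
  by apply: fin; [move=> r hr hd'; rewrite !ud (negbTE hd') N1|exact: updd].
by apply: fin; [move=> r hr hd'; rewrite !ud (negbTE hd') N1|exact: updd].
Qed.

(** Registers 0 to 7 hold the input and all others start at zero. Register 10 is never written, so
    adding it is a copy. Register 9 holds [n + 1], and subtracting from it reflects the second
    coordinates of [s] and [t]. *)
Definition names_cmd : cmd :=
  CConst unit_reg 1 ;; CAdd 9 1 unit_reg ;;
  CAdd 12 4 10 ;; CAdd 14 6 10 ;; CSub 22 9 5 ;; CSub 24 9 7 ;;
  CSub 11 12 unit_reg ;; CSub 13 14 unit_reg ;; CSub 21 22 unit_reg ;; CSub 23 24 unit_reg ;;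
  CSub 15 0 2 ;; CSub 25 1 3 ;; CAdd 16 15 unit_reg ;; CAdd 26 25 unit_reg ;;
  CAdd 17 0 10 ;; CAdd 27 1 10 ;; CConst 18 1 ;; CConst 28 1.

(** The first trimming may shorten [n], the second [m]; neither reads the register that the other
    changes. *)
Definition setup_cmd : cmd :=
  names_cmd ;; trim_cmd 15 26 22 24 27 ;; trim_cmd 25 16 12 14 17.

Lemma mem_after_seq c1 c2 M : mem_after (c1 ;; c2) M = mem_after c2 (mem_after c1 M).
Proof. by []. Qed.

Lemma output_seq c1 c2 M : output (c1 ;; c2) M = output c1 M ++ output c2 (mem_after c1 M).
Proof. by []. Qed.

Lemma time_seq c1 c2 M : time (c1 ;; c2) M = time c1 M + time c2 (mem_after c1 M).
Proof. by []. Qed.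

Lemma names_cmd_output M : output names_cmd M = [::].
Proof. by []. Qed.

Lemma names_cmd_time M : time names_cmd M = 18.
Proof. by []. Qed.

Definition trimmed (small start p q whole : nat) : nat :=
  if small < 2 then maxn (maxn start p) q else whole.

Lemma names_values m n k l sx sy tx ty
  (M1 := mem_after names_cmd (fun i => nth 0 [:: m; n; k; l; sx; sy; tx; ty] i)) :
  M1 8 = 1 /\ M1 9 = n + 1 /\ M1 10 = 0 /\ M1 11 = sx + 0 - 1 /\
  M1 12 = sx + 0 /\ M1 13 = tx + 0 - 1 /\ M1 14 = tx + 0 /\ M1 15 = m - k /\
  M1 16 = m - k + 1 /\ M1 17 = m + 0 /\ M1 18 = 1 /\ M1 19 = 0 /\
  M1 20 = 0 /\ M1 21 = n + 1 - sy - 1 /\ M1 22 = n + 1 - sy /\ M1 23 = n + 1 - ty - 1 /\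
  M1 24 = n + 1 - ty /\ M1 25 = n - l /\ M1 26 = n - l + 1 /\ M1 27 = n + 0 /\
  M1 28 = 1 /\ M1 29 = 0.
Proof.
repeat (split; first by lazy -[addn subn]).
by lazy -[addn subn].
Qed.

Lemma trim_values sx tx A m sy ty B n N (M1 M2 M : memory) :
  M1 unit_reg = 1 -> M1 9 = N ->
  (forall nm, nm < 10 ->
   M1 (10 + nm) = axis_values sx tx A m nm /\ M1 (20 + nm) = axis_values sy ty B n nm) ->
  (forall r, r < 30 -> M2 r =
    if (r == 27) && (M1 15 < 2) then maxn (maxn (M1 26) (M1 22)) (M1 24) else M1 r) ->
  (forall r, r < 30 -> M r =
    if (r == 17) && (M2 25 < 2) then maxn (maxn (M2 16) (M2 12)) (M2 14) else M2 r) ->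
  [/\ ready M, M 9 = N & forall nm, nm < 10 ->
        M (xreg nm) = axis_values sx tx A (trimmed B A.+1 sx tx m) nm /\
        M (yreg nm) = axis_values sy ty B (trimmed A B.+1 sy ty n) nm].
Proof.
move=> u1 n1 v1 m2 m3.
have xv nm : nm < 10 -> M1 (10 + nm) = axis_values sx tx A m nm by case/v1.
have yv nm : nm < 10 -> M1 (20 + nm) = axis_values sy ty B n nm by case/v1.
split.
- by split; rewrite m3 //= m2 //= (xv 0).
- by rewrite m3 //= m2.
move=> nm hnm; have [x1 y1] := v1 _ hnm.
have [hx hy] : xreg nm < 30 /\ yreg nm < 30 by clear -hnm; rewrite /xreg /yreg; lia.
have y27 : (xreg nm == 27) = false by clear -hnm; rewrite /xreg; lia.
have y17 : (yreg nm == 17) = false by clear -hnm; rewrite /yreg; lia.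
rewrite m3 // m3 // !m2 // y27 y17 /=.
rewrite (yv 5) // (xv 5) // (xv 6) // (xv 2) // (xv 4) // (yv 6) // (yv 2) // (yv 4) //.
rewrite [M1 (xreg nm)]x1 [M1 (yreg nm)]y1 /xreg /yreg.
case: (eqVneq nm 7) => [->|ne] /=.
  by rewrite /axis_values /= /trimmed; split; case: ifP.
have [-> ->] : (10 + nm == 17) = false /\ (20 + nm == 27) = false by clear -ne; lia.
by case: nm ne {hnm x1 y1 hx hy y27 y17} => [|[|[|[|[|[|[|[|nm]]]]]]]].
Qed.

Lemma setup_cmd_spec m n k l sx sy tx ty
    (M0 := fun i => nth 0 [:: m; n; k; l; sx; sy; tx; ty] i) (M := mem_after setup_cmd M0)
    (A := m - k) (B := n - l) (sy' := n.+1 - sy) (ty' := n.+1 - ty) :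
  [/\ output setup_cmd M0 = [::], time setup_cmd M0 <= 40,
      ready M, M 9 = n.+1 &
      forall nm, nm < 10 ->
        M (xreg nm) = axis_values sx tx A (trimmed B A.+1 sx tx m) nm /\
        M (yreg nm) = axis_values sy' ty' B (trimmed A B.+1 sy' ty' n) nm].
Proof.
have [u1 [n1 vs]] := names_values m n k l sx sy tx ty.
have v1 nm : nm < 10 -> mem_after names_cmd M0 (10 + nm) = axis_values sx tx A m nm /\
    mem_after names_cmd M0 (20 + nm) = axis_values sy' ty' B n nm.
  rewrite /A /B /sy' /ty' /M0; move: (mem_after _ _) vs {u1 n1} => M1 vs hn.
  decompose [and] vs => {vs}.
  by case: nm hn => [|[|[|[|[|[|[|[|[|[|//]]]]]]]]]] _; split;
    match goal with
    | h : M1 ?r = ?v |- M1 ?r' = _ => rewrite (h : M1 r' = v)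
    end; rewrite /axis_values /=; lia.
have eM : M = mem_after (trim_cmd 25 16 12 14 17)
    (mem_after (trim_cmd 15 26 22 24 27) (mem_after names_cmd M0)).
  by rewrite /M /setup_cmd (mem_after_seq names_cmd) (mem_after_seq (trim_cmd 15 26 22 24 27)).
have oE : output setup_cmd M0 = output (trim_cmd 15 26 22 24 27) (mem_after names_cmd M0) ++
    output (trim_cmd 25 16 12 14 17)
      (mem_after (trim_cmd 15 26 22 24 27) (mem_after names_cmd M0)).
  rewrite /setup_cmd (output_seq names_cmd) (output_seq (trim_cmd 15 26 22 24 27)).
  rewrite names_cmd_output cat0s; exact: erefl.
have tE : time setup_cmd M0 = 18 + (time (trim_cmd 15 26 22 24 27) (mem_after names_cmd M0) +
    time (trim_cmd 25 16 12 14 17)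
      (mem_after (trim_cmd 15 26 22 24 27) (mem_after names_cmd M0))).
  rewrite /setup_cmd (time_seq names_cmd) (time_seq (trim_cmd 15 26 22 24 27)).
  rewrite names_cmd_time; exact: erefl.
rewrite oE tE eM; move: {oE tE eM M} (mem_after names_cmd M0) u1 n1 v1 {vs} => M1 u1 n1 v1.
have [o2 [t2 m2]] := @trim_cmd_spec 15 26 22 24 27 M1 (v1 0 isT).1 isT isT isT isT isT isT isT.
move: (mem_after _ M1) m2 => M2 m2.
have z2 : M2 10 = 0 by rewrite m2 //= (v1 0 isT).1.
have [o3 [t3 m3]] := @trim_cmd_spec 25 16 12 14 17 M2 z2 isT isT isT isT isT isT isT.
move: (mem_after _ M2) m3 => M m3.
have [r9 n9 vv] := trim_values u1 n1 v1 m2 m3.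
split=> //; first by rewrite o2 o3.
  by move: t2 t3; lia.
by rewrite n9 addn1.
Qed.

(** * The table of templates *)

(** The capital is the kind of traversal; the small letters tell whether it starts on the low or the
    high side, in [x] and then in [y]. *)
Notation Dll a b c d := (Block a b c d false false Diag) (only parsing).
Notation Dlh a b c d := (Block a b c d false true Diag) (only parsing).
Notation Dhl a b c d := (Block a b c d true false Diag) (only parsing).
Notation Dhh a b c d := (Block a b c d true true Diag) (only parsing).
Notation Hll a b c d := (Block a b c d false false Horiz) (only parsing).
Notation Hlh a b c d := (Block a b c d false true Horiz) (only parsing).
Notation Hhl a b c d := (Block a b c d true false Horiz) (only parsing).
Notation Hhh a b c d := (Block a b c d true true Horiz) (only parsing).
Notation Vll a b c d := (Block a b c d false false Vert) (only parsing).
Notation Vlh a b c d := (Block a b c d false true Vert) (only parsing).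
Notation Vhl a b c d := (Block a b c d true false Vert) (only parsing).
Notation Vhh a b c d := (Block a b c d true true Vert) (only parsing).

(* Indexed by positions in [axis_types]; found by computer search.  Missing pairs arise by
   exchanging the axes or the ends of the path. *)
Definition template_table : seq ((nat * nat) * seq (seq block)) :=
  [:: ((0, 0),
    [:: [:: Hhh 0 2 0 2; Vll 0 2 2 4; Dll 0 4 4 7; Vlh 4 5 5 7; Vlh 4 7 0 5; Vhl 2 4 0 4];
      [:: Hhh 0 2 0 2; Dll 0 2 2 7; Dlh 2 4 5 7; Vhh 2 3 0 5; Dll 3 7 0 3; Hhl 3 7 3 5];
      [:: Vhh 0 2 0 2; Dll 2 7 0 2; Dhl 5 7 2 5; Hhh 0 5 2 3; Dll 0 3 3 7; Vlh 3 5 3 7];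
      [:: Hhh 0 3 0 2; Dll 0 3 2 7; Vlh 2 5 5 7; Dlh 2 7 4 5; Hhh 2 7 0 4];
      [:: Vhl 0 2 1 7; Dlh 2 5 4 7; Vlh 5 7 0 5; Dhl 4 5 1 4; Vhl 2 4 0 4];
      [:: Dlh 0 4 0 2; Dll 4 6 0 5; Dhl 4 5 5 7; Dhh 1 4 4 7; Hlh 0 4 2 4];
      [:: Vhh 0 2 0 3; Dll 2 7 0 3; Hhl 5 7 2 5; Dhl 4 5 2 7; Vhh 0 4 2 7];
      [:: Vhh 0 2 0 3; Dll 2 7 0 2; Dhl 5 7 2 5; Hhl 0 4 5 7; Dlh 0 5 2 5];
      [:: Dhl 0 2 1 4; Dll 0 5 4 7; Dlh 5 7 4 5; Dhh 4 7 1 4; Vhl 2 4 0 4];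
      [:: Vhl 0 2 1 3; Hlh 2 7 1 3; Dhl 5 7 3 5; Dhl 4 5 3 7; Vhh 0 4 3 7];
      [:: Hlh 1 7 0 2; Vhl 4 7 2 4; Hhl 5 7 4 5; Hhl 1 5 4 7; Hlh 1 4 2 4];
      [:: Hlh 1 7 0 2; Dhl 0 7 2 3; Dll 0 3 3 7; Dhh 3 4 5 7; Dhh 3 7 3 5];
      [:: Vlh 1 7 0 2; Dhl 0 1 0 4; Dll 0 5 4 6; Dlh 5 7 4 5; Dhh 4 7 2 4; Vhl 1 4 2 4];
      [:: Vll 1 3 0 4; Vhl 0 1 1 7; Vlh 1 5 5 7; Dlh 1 7 4 5; Hhh 3 7 1 4];
      [:: Vlh 1 4 0 3; Dhl 0 1 0 5; Hll 0 5 5 7; Hhh 4 6 0 5; Vhh 1 4 2 5]]);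
   ((0, 1),
    [:: [:: Vhh 0 2 0 2; Dll 2 7 0 2; Dhl 5 7 2 5; Hhh 0 5 2 3; Dll 0 3 3 7; Vlh 3 5 3 7];
      [:: Vhl 0 2 1 7; Dlh 2 3 0 7; Hll 3 5 1 5; Vll 5 7 1 3; Hhl 3 5 5 7];
      [:: Hhl 0 2 1 7; Dlh 0 5 0 1; Vll 5 7 0 5; Dhh 4 5 1 6; Vhl 2 4 1 4];
      [:: Vlh 1 7 0 2; Dhl 0 1 0 2; Dll 0 3 2 7; Vlh 3 5 3 7];
      [:: Hlh 1 7 1 2; Hhl 1 7 2 5; Dhl 0 1 1 3; Dll 0 3 3 7; Vlh 3 5 3 7];
      [:: Hll 0 2 1 5; Dlh 0 5 0 1; Vll 5 7 0 3; Dhh 4 5 1 4; Dhl 2 4 1 5; Hll 0 4 3 7];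
      [:: Dhl 0 2 1 2; Hll 0 3 2 7; Hll 3 5 0 3; Vll 5 7 1 5; Hhl 2 5 5 7];
      [:: Hlh 0 7 0 2; Dhl 5 7 2 5; Dhh 4 5 2 4; Vhl 1 4 2 7];
      [:: Dlh 1 5 0 2; Vll 5 7 0 2; Dhl 4 5 5 7; Vhh 1 4 5 7];
      [:: Vhl 0 2 1 7; Dlh 2 5 4 7; Vhh 2 3 0 6; Hll 3 6 1 5; Hhl 3 4 3 6];
      [:: Dhh 0 3 1 5; Dll 0 1 3 7; Dlh 1 4 6 7; Hhl 1 3 5 6; Dlh 2 7 1 3; Hlh 2 5 5 6];
      [:: Hlh 0 5 1 3; Hll 0 4 3 7]]);
   ((0, 2),
    [:: [:: Vhh 0 2 0 2; Dll 2 7 0 2; Dhl 5 7 2 5; Hhh 0 5 2 3; Dll 0 3 3 7; Vlh 3 5 3 7];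
      [:: Dlh 1 4 0 2; Vll 4 7 0 5; Vll 4 5 5 4; Hhh 1 4 2 3; Hll 0 4 3 7];
      [:: Vhl 0 2 1 5; Dlh 2 5 1 5; Vll 5 7 1 5; Dhl 0 5 5 3; Hll 0 5 3 7];
      [:: Dlh 1 5 0 5; Vll 5 7 0 5; Dhl 0 5 2 3; Dll 1 3 3 7; Vlh 3 5 3 7];
      [:: Hhh 0 2 0 2; Vll 0 2 2 4; Dll 0 4 4 7; Vlh 4 5 5 7; Vlh 4 7 0 5; Vhl 2 4 0 4];
      [:: Hll 1 4 1 3; Hll 4 7 1 5; Hhh 0 7 0 1; Vll 0 1 1 3; Hll 0 5 3 7];
      [:: Hhh 0 2 0 2; Hll 0 3 2 7; Vhh 2 3 0 2; Vll 3 7 0 5; Vll 3 5 5 7];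
      [:: Hlh 0 7 0 2; Dhl 0 7 2 5; Vll 1 5 5 3; Dll 0 3 3 7; Vlh 3 5 3 7];
      [:: Dll 1 7 1 5; Hhl 1 5 2 3; Dhl 0 1 1 3; Dll 0 3 3 7; Vlh 3 5 3 7];
      [:: Hhl 0 3 1 7; Dlh 0 2 0 1; Vll 2 7 0 5; Vll 3 5 5 7];
      [:: Vhl 0 2 1 7; Dlh 2 3 0 7; Vll 3 7 1 5; Vll 3 5 5 7];
      [:: Vhl 0 2 0 7; Vlh 2 3 5 4; Hlh 2 7 1 5; Dhl 3 5 5 4];
      [:: Hll 1 6 1 5; Dhh 1 6 0 1; Dhl 0 1 0 5; Vll 0 4 5 3; Hll 0 4 3 7];
      [:: Dll 1 6 0 2; Dhl 4 5 5 4; Hhh 1 4 2 3; Hll 1 4 3 4];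
      [:: Dhl 0 3 0 2; Hll 0 2 5 4; Dlh 2 7 1 5; Dhl 2 5 2 4]]);
   ((0, 3),
    [:: [:: Vll 1 3 1 4; Dhh 0 1 1 7; Dlh 0 5 0 1; Vll 5 7 0 5; Dhl 3 5 1 4];
      [:: Hll 1 5 5 3; Dhh 1 6 0 1; Dhl 0 1 0 3; Dll 0 3 3 7; Vlh 3 5 3 7];
      [:: Vhh 0 2 0 6; Vll 2 7 0 5; Dll 2 5 5 2; Dhl 0 5 6 3; Hll 0 5 3 7];
      [:: Dlh 1 3 0 2; Dll 3 6 0 5; Hhl 3 5 5 3; Vhl 0 3 2 7; Vlh 3 5 3 7];
      [:: Dhl 1 2 1 7; Vlh 2 3 1 7; Dlh 0 5 0 1; Vll 5 7 0 5; Dhl 3 5 1 7];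
      [:: Vhh 0 2 0 6; Vll 2 7 0 5; Hll 2 4 5 3; Vhl 0 3 3 7; Vhh 3 4 6 7];
      [:: Vhh 0 2 0 2; Vll 2 7 0 5; Dll 2 5 1 2; Dhl 4 5 6 7; Vhh 0 4 3 7];
      [:: Dlh 0 4 0 6; Vll 4 7 0 5; Vll 4 5 5 7; Dhh 1 4 4 7; Hlh 0 4 2 4];
      [:: Dlh 1 3 0 6; Hll 3 6 0 5; Hll 3 5 8 2; Dhl 0 4 6 3; Hll 1 4 3 7];
      [:: Hhh 0 2 0 2; Vll 0 2 2 4; Dll 0 4 4 7; Vlh 4 5 5 7; Vlh 4 7 0 5; Vhl 2 4 0 4];
      [:: Dlh 0 4 0 6; Vll 4 7 0 1; Vll 4 5 5 7; Hhh 0 4 6 3; Dlh 1 4 3 4];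
      [:: Vlh 0 3 0 6; Vll 3 7 0 5; Vll 4 5 1 7; Dll 3 4 5 6; Hlh 1 4 6 7];
      [:: Vhl 1 2 5 4; Dlh 3 4 1 3; Hlh 1 6 0 1; Dhl 4 5 1 7; Dll 3 4 3 7]]);
   ((0, 4),
    [:: [:: Dhh 0 2 5 2; Hlh 0 6 0 5; Vhl 2 4 5 2; Dhl 0 5 2 3; Hll 0 5 3 7];
      [:: Vhh 0 2 0 2; Vll 2 7 0 5; Dll 2 5 5 2; Dhl 0 4 2 3; Hll 0 4 3 7];
      [:: Vhl 0 2 1 4; Dlh 2 3 1 7; Dhh 0 3 5 1; Hlh 0 7 0 5; Dhl 3 5 5 7];
      [:: Vlh 1 2 0 2; Vll 2 7 0 5; Dll 2 5 5 1; Dhl 4 5 1 4; Dhl 2 4 1 2; Hll 0 4 2 7];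
      [:: Hhl 0 3 1 7; Dlh 0 3 0 1; Dll 3 6 0 5; Vhl 3 5 5 3; Hhl 3 5 3 7];
      [:: Dlh 1 5 5 3; Dhh 1 7 0 5; Dhl 0 1 0 3; Dll 0 3 3 7; Vlh 3 5 3 7];
      [:: Hhl 0 2 1 7; Dlh 0 3 0 1; Vll 2 7 0 5; Dll 2 5 5 3; Hhl 3 5 3 7];
      [:: Vlh 1 5 5 3; Vlh 1 7 0 5; Dhl 0 1 0 3; Dll 0 3 2 7; Vlh 3 5 2 7];
      [:: Hhh 0 2 0 2; Hll 0 3 2 7; Vhh 2 3 0 2; Vll 3 7 0 5; Vll 3 5 5 7];
      [:: Dlh 1 4 0 2; Vll 4 7 0 5; Vll 4 5 5 7; Dhh 0 4 4 7; Hlh 0 4 2 4];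
      [:: Dlh 1 4 0 2; Dll 4 7 0 5; Vhl 4 5 5 4; Hhl 0 5 4 7; Hlh 1 4 2 4];
      [:: Hhl 0 2 1 7; Dlh 0 4 0 1; Dll 4 7 0 5; Dhl 4 5 5 7; Dhh 2 4 4 7; Hlh 2 4 1 4];
      [:: Hhh 0 2 0 2; Vll 0 2 2 4; Dll 0 4 4 7; Vlh 4 5 5 7; Vlh 4 7 0 5; Vhl 2 4 0 4];
      [:: Dlh 1 4 0 2; Vll 4 7 0 5; Vll 4 5 5 7; Hhh 1 4 2 3; Dll 1 4 3 7];
      [:: Dhh 1 2 0 3; Hll 2 7 0 5; Dhl 2 5 8 3; Hll 1 4 2 7];
      [:: Dlh 1 4 5 2; Hlh 1 7 0 5; Dhl 4 5 5 7; Hhh 1 4 2 3; Hlh 1 4 3 7];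
      [:: Dhl 1 3 1 3; Dlh 1 4 0 1; Hll 4 7 0 5; Dhl 4 5 8 7; Vlh 3 4 1 2; Dll 1 4 2 7]]);
   ((0, 5),
    [:: [:: Vhl 0 2 4 7; Dlh 2 5 4 7; Hll 5 7 4 5; Dhh 4 7 0 1; Vhl 0 4 0 1];
      [:: Hhh 0 3 0 2; Dll 0 3 2 7; Vlh 2 5 5 7; Dlh 2 7 4 5; Hhh 2 7 0 4];
      [:: Hlh 1 3 0 2; Vhl 1 3 2 7; Vlh 3 5 5 7; Dlh 3 7 4 5; Hhh 3 7 0 4];
      [:: Vhl 0 2 1 7; Dlh 2 5 1 7; Hll 5 7 1 5; Hhh 4 7 3 1; Vhh 0 4 3 1];
      [:: Hhh 0 2 0 2; Hll 0 5 2 7; Vhh 2 5 4 2; Hll 5 7 4 5; Dhh 4 7 0 4; Vhl 2 4 0 4];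
      [:: Hhh 0 2 4 2; Dll 0 2 2 7; Vlh 2 5 5 7; Hlh 2 4 4 5; Vlh 4 7 0 5; Vhl 0 4 0 4];
      [:: Vlh 1 3 0 2; Vhl 0 1 3 7; Hlh 1 3 2 7; Vlh 3 5 5 7; Vlh 3 7 0 5];
      [:: Hll 0 5 1 7; Hll 5 7 1 5; Vhh 4 7 3 1; Hhh 1 7 0 3; Hll 0 4 3 1];
      [:: Vlh 1 3 3 2; Vhl 0 1 3 6; Hlh 1 5 2 6; Dlh 5 7 2 5; Dhh 3 7 0 2];
      [:: Vll 1 4 1 5; Hll 1 5 5 7; Vhh 4 6 3 5; Hhh 0 6 0 3; Hll 1 4 3 1];
      [:: Hhh 0 2 0 2; Dll 0 5 2 6; Vlh 5 7 3 5; Dhh 4 5 0 2; Vhh 2 4 0 2];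
      [:: Dll 1 6 1 5; Dhl 1 5 5 7; Dhh 0 1 4 7; Dlh 0 3 0 1; Vll 3 7 0 1];
      [:: Hhl 0 2 1 7; Dlh 0 2 4 1; Dll 2 4 4 7; Dlh 4 5 5 7; Dhh 4 6 0 5; Vhl 0 4 0 4];
      [:: Vlh 0 3 3 2; Dlh 2 5 1 2; Dhl 1 5 2 5; Hll 1 5 5 7; Dlh 5 7 4 5; Hhh 2 7 3 1];
      [:: Vhh 0 2 3 2; Vll 2 3 3 2; Dll 0 5 2 6; Dlh 5 7 2 5; Dhh 3 7 3 2];
      [:: Vhl 1 3 4 7; Dlh 2 5 5 7; Vlh 5 7 3 5; Dhl 4 5 3 5; Dlh 3 4 4 5; Hll 1 4 0 1];
      [:: Dll 0 4 1 5; Hll 1 5 5 7; Dhh 4 7 3 5; Hhl 0 4 4 1; Hll 1 4 0 4];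
      [:: Dlh 1 2 0 2; Vll 2 3 0 2; Hlh 1 5 2 6; Vlh 5 7 0 2; Dhh 3 5 3 5]]);
   ((0, 6),
    [:: [:: Vhh 0 2 0 7; Vll 2 3 0 4; Dll 2 5 4 7; Vlh 5 7 0 1; Dhl 3 5 0 4];
      [:: Vll 0 2 1 7; Vlh 2 5 1 7; Dlh 1 3 0 1; Dll 3 7 0 3; Hhl 3 7 3 5];
      [:: Vll 1 5 1 7; Dhh 0 1 1 7; Dlh 0 3 0 1; Dll 3 7 0 3; Hhl 3 7 3 5];
      [:: Vhh 0 2 0 2; Dll 2 7 0 3; Dhl 5 7 3 5; Dhh 3 5 3 6];
      [:: Hhl 0 2 1 7; Dlh 0 2 3 5; Dll 2 3 3 7; Dlh 3 5 1 7; Dhh 3 6 3 5];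
      [:: Vhh 0 2 3 7; Dll 2 3 3 7; Dlh 3 5 4 2; Hll 5 7 4 5; Hhh 3 7 0 4];
      [:: Vhl 0 2 1 7; Vlh 2 5 5 7; Vlh 4 7 0 5; Hhl 0 4 4 1; Dlh 0 4 3 4];
      [:: Vll 1 5 1 7; Vhh 0 1 3 7; Dll 1 3 0 1; Vlh 3 7 3 1];
      [:: Dlh 0 2 3 2; Vll 2 3 3 6; Dll 1 3 6 7; Dlh 3 5 4 7; Dhl 3 6 0 1];
      [:: Dhl 0 2 5 7; Vlh 2 5 5 7; Hlh 1 3 3 5; Vlh 3 7 0 1];
      [:: Dlh 1 2 3 2; Hlh 3 4 4 2; Dll 1 4 6 7; Dlh 4 5 5 7; Dhl 3 6 3 4];
      [:: Hhh 0 2 3 2; Dll 0 3 2 7; Dlh 3 5 1 7; Hhl 2 6 0 4];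
      [:: Hll 0 5 1 7; Dll 1 5 3 5]]);
   ((0, 7),
    [:: [:: Hll 0 5 1 7; Dhh 0 5 5 1; Dlh 1 3 0 5; Dll 3 7 0 3; Hhl 3 7 3 5];
      [:: Vhl 0 2 1 7; Dlh 2 5 1 7; Dhh 0 5 5 1; Hlh 0 4 4 5; Vlh 4 7 0 5; Vhl 0 4 0 4];
      [:: Hhl 0 2 1 7; Dlh 0 2 4 1; Dll 2 4 4 7; Vlh 4 5 5 7; Vlh 4 7 0 5; Vhl 0 4 0 4];
      [:: Vhl 0 2 1 7; Dlh 2 5 1 7; Dhh 0 5 5 1; Hlh 0 3 0 5; Vlh 3 7 3 5];
      [:: Hll 1 5 1 7; Dhh 1 5 5 1; Dlh 1 3 0 5; Hll 3 7 4 5; Hhh 3 7 0 4];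
      [:: Vhh 0 2 0 2; Dll 2 3 0 7; Dlh 3 5 5 7; Dlh 3 7 4 5; Hhh 3 7 0 4];
      [:: Dhh 0 3 1 7; Hlh 0 3 0 1; Vlh 2 5 5 2; Dlh 3 7 4 5; Hhh 3 7 0 4];
      [:: Vhh 0 2 0 7; Dll 2 3 0 7; Vlh 3 5 5 7; Vlh 3 7 3 5];
      [:: Vlh 1 3 0 2; Dhl 0 1 0 2; Hll 0 5 2 7; Vhh 3 5 5 2; Dhh 3 7 0 5];
      [:: Vhh 0 2 0 7; Hll 2 5 5 2; Dhh 3 6 0 5];
      [:: Dlh 1 5 1 7; Hhh 1 4 5 1; Dhh 0 1 5 2; Dlh 0 3 0 5; Vll 3 7 0 4];
      [:: Hhh 0 2 5 2; Dll 0 2 2 7; Dlh 2 5 5 7; Vhh 0 3 0 4; Vll 3 7 0 4];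
      [:: Dhl 0 2 1 7; Vlh 2 5 1 7; Dlh 1 3 3 1; Hll 3 5 4 1; Hhh 3 7 3 5];
      [:: Hll 1 5 1 7; Dhh 1 4 6 1; Dlh 1 3 3 6; Vhh 3 5 5 6; Hhl 3 7 3 4]]);
   ((0, 8),
    [:: [:: Hhl 0 2 1 7; Dlh 0 2 0 1; Dll 2 6 0 3; Dhl 4 5 3 7; Vhh 2 4 3 7];
      [:: Dll 1 4 1 7; Dlh 4 5 3 7; Vlh 5 7 0 3; Dhl 1 5 0 5; Hll 1 4 3 1];
      [:: Hhl 0 2 1 7; Dlh 0 2 0 1; Vll 2 7 0 3; Dll 2 3 5 7; Vlh 3 5 5 7];
      [:: Hll 1 5 1 7; Dhh 1 5 4 1; Dlh 0 3 0 4; Dll 3 7 0 5; Dhl 3 5 5 4];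
      [:: Vhl 0 2 1 7; Dlh 2 5 4 7; Hhl 0 3 5 1; Hlh 0 7 0 5; Vll 3 5 3 4];
      [:: Hll 1 5 1 7; Dhh 0 5 4 1; Dlh 1 3 0 4; Vll 3 7 0 5; Vll 3 5 5 4];
      [:: Dll 1 2 1 7; Vlh 2 4 1 7; Dlh 1 2 0 1; Vll 2 7 0 3; Hll 2 5 3 1];
      [:: Dhh 0 2 1 2; Dlh 0 1 0 1; Vll 1 7 0 5; Dhl 1 2 3 1; Vlh 2 5 5 7];
      [:: Dhh 1 3 5 2; Vlh 1 7 0 3; Dhl 0 1 0 2; Dll 0 3 2 7; Vlh 3 5 3 7];
      [:: Hlh 1 5 1 7; Vlh 3 5 6 1; Dhl 1 3 3 1; Dhh 0 1 5 7; Dll 0 6 0 5; Vhh 3 5 8 4];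
      [:: Hhh 0 2 0 2; Hll 0 5 2 7; Dhh 2 5 6 2; Dlh 2 3 0 4; Dll 3 7 0 5; Dll 3 4 5 6]]);
   ((0, 9),
    [:: [:: Hll 1 5 1 7; Dhh 0 5 4 1; Dlh 1 3 0 4; Vll 3 7 0 5; Vll 3 5 5 4];
      [:: Hll 0 5 1 7; Dhh 1 5 4 1; Dlh 0 3 0 4; Dll 3 6 0 5; Dhl 3 5 5 4];
      [:: Hhl 0 2 1 7; Dlh 0 2 4 1; Dll 2 4 4 7; Vlh 4 5 5 7; Vlh 4 7 0 5; Vhl 0 4 0 4];
      [:: Hhl 0 2 1 7; Dlh 0 2 4 1; Dll 2 4 4 7; Dlh 4 5 5 7; Dhh 4 7 0 5; Vhl 0 4 0 4];
      [:: Vhl 0 2 1 7; Dlh 2 5 1 7; Vhh 4 5 5 1; Hhh 0 6 0 5; Dll 0 4 5 4];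
      [:: Hhl 0 3 1 7; Dlh 0 3 0 1; Vll 3 7 0 5; Dll 3 5 5 3; Hhl 3 5 3 7];
      [:: Dhh 0 2 5 2; Dlh 0 4 0 5; Vll 5 7 0 5; Dhl 2 5 5 3; Hll 2 4 3 2];
      [:: Vhl 0 2 4 7; Dlh 2 5 4 7; Dhh 4 5 5 1; Vlh 4 7 0 5; Vhl 0 4 0 1];
      [:: Hlh 1 5 4 2; Hhl 0 5 2 7; Dlh 0 1 0 2; Vll 1 7 0 5; Dll 1 5 5 4];
      [:: Vll 1 4 1 7; Dhh 0 1 5 7; Hlh 0 6 0 5; Dhl 1 5 5 3; Hll 1 4 3 1];
      [:: Hll 1 5 4 7; Vhh 1 3 0 4; Vll 3 7 0 5; Dll 3 4 5 4];
      [:: Hll 0 5 4 7; Dhh 1 3 5 4; Hlh 1 7 0 5; Dll 3 4 5 4];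
      [:: Vhh 0 2 0 7; Vll 2 7 0 5; Dll 2 3 5 7; Dll 3 5 1 7; Hhh 3 5 5 1];
      [:: Hll 1 4 4 2; Dlh 4 5 5 7; Hhh 0 7 0 5; Dll 0 1 5 7; Hlh 1 4 5 4];
      [:: Hhh 1 3 1 7; Vhh 0 1 0 7; Vll 1 7 0 5; Dhl 1 4 5 3; Vhl 1 2 3 1; Vlh 2 5 3 2];
      [:: Dhl 1 3 1 7; Dhh 0 1 5 7; Dlh 0 6 0 5; Dhl 1 4 8 3; Vll 1 2 3 1; Dhh 3 5 3 2]]);
   ((0, 10),
    [:: [:: Vlh 1 3 0 4; Dhl 0 1 0 2; Dll 0 5 4 6; Vlh 5 7 0 5; Dhl 3 5 0 4];
      [:: Vlh 1 3 0 4; Dhl 0 1 0 4; Hll 0 5 2 7; Vlh 5 7 0 4; Dhl 3 5 0 2];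
      [:: Hlh 0 3 0 2; Vhl 1 3 4 7; Vlh 3 5 5 7; Dlh 3 7 4 5; Hhh 3 7 0 2];
      [:: Vhl 0 2 0 7; Dlh 2 3 0 6; Dll 3 5 2 6; Vlh 5 7 0 5; Dhl 3 5 1 2];
      [:: Vhh 1 2 0 2; Vll 2 3 0 4; Dll 0 5 2 7; Vlh 5 7 0 5; Dhl 3 5 0 4];
      [:: Vhl 0 2 1 7; Vlh 2 5 5 7; Dlh 2 3 0 5; Hll 3 7 2 5; Hhl 3 7 3 4];
      [:: Dhh 1 3 1 2; Dlh 0 5 0 1; Vll 5 7 0 5; Hhl 1 5 5 7; Dlh 0 5 4 5; Dhh 2 5 3 2];
      [:: Vlh 1 3 0 4; Vhl 0 1 0 7; Vlh 1 5 5 7; Dlh 1 7 4 5; Hhh 3 7 0 4];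
      [:: Vhl 0 2 3 4; Hll 0 5 4 7; Vlh 5 7 0 5; Dhl 4 5 0 5; Hhh 1 4 0 1; Dll 2 4 1 2];
      [:: Dhl 1 2 1 7; Dlh 2 5 5 7; Hlh 5 7 1 5; Hhh 1 7 0 1; Hll 2 4 1 2];
      [:: Vll 1 3 3 6; Dhl 0 1 1 6; Dll 0 3 6 7; Dlh 3 5 5 7; Hhl 3 6 3 2]]);
   ((0, 11),
    [:: [:: Dhh 0 2 5 6; Dlh 0 5 0 5; Vll 5 7 0 3; Dhh 3 5 3 4];
      [:: Vhh 0 2 0 4; Dll 2 3 0 6; Dlh 3 5 0 3; Vll 5 7 0 5; Dhh 3 5 1 6];
      [:: Vll 1 3 5 7; Dhh 0 1 3 7; Dlh 0 5 0 3; Vll 5 7 0 5; Hhl 3 5 5 7];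
      [:: Hlh 1 2 1 2; Hlh 1 7 0 1; Dhl 4 5 1 7; Dhh 0 4 2 7; Hlh 2 4 5 4];
      [:: Vhl 1 2 3 7; Dlh 2 5 6 7; Vhh 3 5 5 6];
      [:: Vhl 1 2 5 7; Dlh 2 5 4 7; Dhl 2 3 3 6; Dlh 1 5 0 3; Vll 4 7 0 1; Vlh 3 5 1 4];
      [:: Hlh 1 3 1 2; Hhl 0 5 2 7; Dlh 0 1 0 2; Dll 1 7 0 1; Vhl 3 5 3 2];
      [:: Vhh 1 2 5 6; Vlh 1 7 0 1; Dhl 0 1 0 2; Dll 0 2 6 7; Dlh 2 4 1 7];
      [:: Dll 1 3 1 7; Dlh 3 5 4 7; Dhh 4 5 5 4; Vlh 4 7 0 5; Vhl 1 4 0 3; Vhl 3 4 3 4]]);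
   ((0, 12),
    [:: [:: Dhh 0 2 5 4; Hlh 0 7 0 5; Vhl 2 4 5 2];
      [:: Vhh 0 2 0 2; Vll 2 7 0 5; Dll 2 3 5 4; Hlh 3 5 5 1; Dhl 3 5 1 4];
      [:: Vhh 0 2 0 4; Vll 2 7 0 5; Dll 2 5 5 4];
      [:: Hhl 0 2 1 7; Dlh 0 4 0 1; Vll 4 7 0 5; Vll 4 5 5 7; Vhh 2 4 3 7];
      [:: Hhl 0 2 3 7; Dlh 0 4 0 3; Dll 4 7 0 5; Dhl 4 5 5 7; Vhh 2 4 1 7];
      [:: Hll 1 5 1 7];
      [:: Vhh 0 2 0 4; Hlh 2 6 0 5; Dhl 4 5 5 2; Hhh 2 4 5 3; Hlh 2 4 3 2];
      [:: Dll 1 3 1 7; Dlh 3 5 4 7; Dhh 4 5 5 4; Vlh 4 7 0 5; Vhl 1 4 0 3; Vhl 3 4 3 4];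
      [:: Vlh 0 2 0 2; Vll 2 7 0 5; Dll 2 5 5 3; Hhl 2 3 3 2; Dll 0 3 2 7; Dlh 3 4 3 7];
      [:: Hhl 0 2 1 7; Dlh 0 1 0 1; Hlh 1 7 0 5; Dhl 1 4 5 3; Hll 2 4 3 7];
      [:: Vhh 1 2 3 2; Hll 1 5 4 7; Hhl 2 3 3 2; Dlh 0 3 0 1; Hlh 3 7 0 5; Vhl 3 4 8 4];
      [:: Dll 1 3 3 7; Dlh 3 5 2 7; Vhh 4 5 5 2; Hhl 4 7 0 8; Vhl 1 4 0 1; Vlh 3 4 3 2];
      [:: Hhh 0 2 0 4; Hll 0 4 2 7; Vhh 2 3 0 2; Vll 3 7 0 5; Dhl 3 5 5 2];
      [:: Hhl 1 3 1 4; Dlh 1 5 5 3; Dhh 1 6 0 5; Dhl 0 1 0 2; Hll 0 4 2 7; Dhl 3 4 3 4];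
      [:: Vll 1 2 3 4; Dhh 1 5 5 3; Vlh 1 7 0 5; Dhl 0 1 0 2; Dll 0 2 2 7; Dhh 2 4 3 7]]);
   ((1, 6),
    [:: [:: Hhl 0 2 1 7; Dlh 0 2 0 1; Dll 2 7 0 3; Hhl 5 7 3 5];
      [:: Vhl 0 2 1 7; Dlh 2 5 1 7; Dhh 0 7 4 1; Hlh 0 4 0 4];
      [:: Vhl 0 2 1 7; Vlh 2 3 3 7; Hhl 0 2 3 1; Hlh 0 7 0 3; Hhl 5 7 3 5];
      [:: Vhh 0 2 0 2; Dll 2 3 0 7; Dlh 3 7 4 5; Hhh 3 7 0 4];
      [:: Vll 1 5 1 7; Dhh 0 1 1 7; Hlh 0 3 3 1; Vlh 3 7 3 5];
      [:: Hhl 0 5 5 7; Dlh 0 1 0 1; Dll 1 6 0 3; Hll 1 7 3 5];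
      [:: Vhh 0 2 0 7; Dll 2 7 0 3; Vhl 2 5 3 6; Dlh 5 6 3 5];
      [:: Vhl 1 2 1 7; Vlh 2 5 1 7; Dlh 1 3 0 1; Dll 3 7 0 3; Hhl 3 7 3 5];
      [:: Hhl 0 2 1 7; Hlh 0 2 0 1; Dlh 2 5 4 2; Vhh 2 3 0 4; Vll 3 7 0 4];
      [:: Hll 0 3 1 7; Vhh 1 5 3 1; Hll 5 7 4 5; Dhl 5 7 0 4]]);
   ((1, 7),
    [:: [:: Vll 1 3 1 7; Dhh 0 1 1 7; Dlh 0 5 0 1; Dll 3 7 0 3; Hhl 3 7 3 5];
      [:: Hll 1 5 1 7; Vhh 1 3 0 1; Dll 3 7 0 3; Hhl 5 7 3 5];
      [:: Vll 1 5 1 7; Dhh 0 1 1 7; Dlh 0 5 5 1; Dhh 0 6 4 5; Hlh 0 7 0 4];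
      [:: Hll 1 5 1 7; Hhh 1 5 5 1; Dhh 0 1 5 7; Hlh 0 5 0 5; Vlh 3 7 3 5];
      [:: Vll 1 5 1 7; Dhh 0 1 1 7; Dlh 0 5 0 1; Hll 5 7 4 5; Dhh 5 7 3 4];
      [:: Dhl 0 2 1 7; Hlh 0 2 5 1; Dlh 2 3 5 7; Dhh 0 4 4 5; Hlh 0 6 0 4];
      [:: Hll 0 3 1 7; Dhh 0 3 5 1; Dlh 0 4 4 5; Vhh 0 5 0 4; Dll 5 7 0 4];
      [:: Hhh 0 2 1 2; Hlh 0 2 0 1; Dlh 2 5 0 7; Dll 5 7 0 3; Hhl 5 7 3 5];
      [:: Hll 1 5 1 7; Dhh 1 5 6 1; Hlh 0 5 3 6; Vlh 5 7 0 5]]);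
   ((1, 10),
    [:: [:: Vll 1 3 3 7; Vhh 0 1 0 7; Dll 1 7 0 3; Hhl 5 7 1 5];
      [:: Dhl 0 2 1 5; Hll 0 2 5 7; Vlh 2 7 3 5];
      [:: Vhl 0 2 1 7; Dlh 2 3 1 7; Hll 3 7 2 5; Dhl 5 7 0 2];
      [:: Vhh 1 2 0 2; Vhl 0 1 0 7; Dlh 1 3 5 7; Dhh 1 7 2 5; Hlh 2 7 0 4];
      [:: Dll 0 3 1 7; Dlh 3 7 2 5; Dhh 6 7 0 2; Dhl 0 6 0 1; Vll 5 6 3 2];
      [:: Vhl 1 2 3 7; Vlh 2 3 3 7; Hlh 1 7 0 3; Hhl 3 7 1 5];
      [:: Hlh 1 3 3 4; Hhh 0 6 0 1; Hlh 0 1 1 2; Dhl 0 3 4 5; Hll 0 5 5 7; Dhh 5 6 3 5];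
      [:: Hhl 0 3 1 4; Dlh 0 5 0 1; Vll 2 7 0 4];
      [:: Dhl 1 2 1 2; Hlh 1 7 0 1; Hhl 2 5 3 2; Dll 0 3 2 7; Vhh 5 6 3 5];
      [:: Dhl 0 2 3 7; Vlh 2 3 5 7; Dlh 2 6 4 5; Hhh 2 3 3 4; Dlh 1 3 0 3; Vll 5 6 0 2]]);
   ((2, 7),
    [:: [:: Vhl 0 2 1 7; Dlh 2 5 1 7; Dhh 0 5 5 1; Hlh 0 3 0 5; Vlh 3 7 3 5];
      [:: Vhl 0 2 1 7; Dlh 2 5 1 7; Dhh 0 5 5 1; Dlh 0 3 0 4; Vll 3 7 0 5];
      [:: Hhl 0 5 1 7; Dlh 0 5 0 1; Dll 5 3 0 5; Dlh 3 7 4 5; Hhh 3 7 0 4];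
      [:: Hll 1 5 1 7; Vhh 1 5 0 1; Dll 5 4 0 3; Vhl 5 3 3 5; Vhh 3 7 3 5];
      [:: Hhl 0 2 1 7; Hlh 0 2 0 1; Vlh 2 5 4 7; Dlh 2 3 0 5; Vll 3 7 0 5];
      [:: Hhl 0 2 1 7; Vlh 0 5 4 1; Dlh 0 3 0 5; Vll 3 7 0 4];
      [:: Dlh 1 5 1 2; Hhh 1 5 5 1; Vhh 0 1 0 7; Dll 1 3 0 5; Vlh 3 7 0 5];
      [:: Hhl 0 5 1 7; Dlh 0 5 4 1; Hll 2 7 4 5; Vhh 0 3 0 4; Vhl 3 4 0 4];
      [:: Vhl 0 2 1 7; Dlh 2 5 1 7; Dhh 0 5 5 1; Hlh 0 4 4 5; Vlh 4 7 0 5; Vhl 0 4 0 4];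
      [:: Dhl 0 2 1 7; Hlh 0 2 0 1; Dlh 2 5 0 7; Dll 5 7 0 3; Vhl 5 3 3 5; Dlh 3 4 3 5];
      [:: Dlh 1 5 1 7; Hhh 1 5 5 1; Dhh 0 1 5 7; Hlh 0 4 4 5; Vlh 4 7 0 5; Vhl 0 4 0 4];
      [:: Hhh 0 2 0 2; Hll 0 5 2 7; Vhh 2 5 0 2; Dll 5 7 0 3; Vhl 5 3 3 5; Dlh 3 7 3 5]]);
   ((2, 10),
    [:: [:: Vhl 0 2 3 7; Dlh 2 5 1 7; Dll 5 3 1 5; Vlh 3 7 3 5];
      [:: Hhh 0 2 0 2; Hll 0 5 4 7; Hll 5 4 4 5; Vhh 2 3 0 4; Vll 3 7 0 2];
      [:: Hhh 0 2 0 2; Hll 0 5 2 7; Dll 5 3 0 5; Dlh 3 7 4 5; Hhh 3 7 0 4];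
      [:: Vll 1 5 1 7; Vhh 0 1 0 7; Dll 1 5 0 3; Dlh 5 3 0 5; Vll 3 7 0 5];
      [:: Vll 1 2 3 7; Vlh 2 5 1 7; Hlh 1 5 0 3; Dlh 5 3 0 4; Vll 3 7 0 2];
      [:: Vlh 1 3 0 2; Vhl 0 1 0 7; Dlh 1 5 4 7; Hll 5 7 4 5; Hhh 3 7 0 4];
      [:: Vhl 0 2 0 7; Hlh 2 3 0 5; Vlh 3 7 1 5];
      [:: Dll 0 2 1 7; Dlh 2 7 2 5; Dhl 2 3 1 4; Hlh 1 7 0 3; Dll 3 7 3 4];
      [:: Dhl 1 2 3 7; Vlh 2 5 1 7; Hlh 1 7 0 1; Vhl 5 3 3 5; Vlh 3 7 3 5];
      [:: Vll 1 2 3 7; Vlh 2 5 5 7; Vlh 2 3 3 5; Hlh 0 7 0 3; Hhl 3 7 1 5];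
      [:: Dlh 0 2 0 2; Vll 2 3 0 4; Dll 0 5 4 6; Dlh 5 7 2 5; Hhh 3 7 0 2];
      [:: Vll 1 5 1 6; Vhl 2 6 3 2; Hlh 1 6 0 1; Dlh 6 3 0 4; Vll 3 7 0 4]]);
   ((3, 10),
    [:: [:: Vlh 5 3 0 2; Dhl 0 1 0 5; Hll 0 1 5 7; Dlh 5 7 2 5; Hhh 3 7 0 4];
      [:: Dll 1 3 3 2; Hhl 5 7 2 5; Hhl 0 1 1 7; Dlh 0 3 0 1; Vll 3 7 0 4];
      [:: Dll 1 7 3 4];
      [:: Dhl 5 2 3 2; Dhl 0 1 0 5; Hll 0 1 5 7; Dhh 5 6 4 5; Dll 2 3 1 5; Vlh 3 7 1 5];
      [:: Vhh 5 6 1 2; Dhh 0 5 3 7; Hlh 0 2 0 1; Dlh 2 3 0 4; Vll 3 7 0 2];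
      [:: Dlh 1 6 1 2; Hhl 0 1 1 7; Hlh 0 2 0 3; Dlh 2 3 0 5; Vll 3 7 0 5];
      [:: Dlh 8 3 3 2; Dhl 5 4 2 5; Vlh 0 5 0 7; Dll 1 7 0 3; Dhl 3 7 1 4]]);
   ((4, 10),
    [:: [:: Hhh 0 2 0 2; Dll 0 5 2 7; Dlh 5 7 2 5; Dhh 4 7 0 4; Vhl 2 4 0 2];
      [:: Vll 1 3 1 5; Dhh 5 1 1 5; Hhl 0 5 3 7; Hlh 0 7 0 1; Hhl 3 7 1 5];
      [:: Hlh 1 2 3 2; Hhl 1 4 4 5; Dhl 5 1 1 5; Dhh 0 5 1 7; Dlh 0 2 0 3; Dll 2 4 0 2];
      [:: Hlh 1 7 0 5];
      [:: Hhh 0 2 0 2; Hll 0 5 2 7; Hll 5 7 4 5; Vhh 2 3 0 2; Dhl 3 7 0 2];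
      [:: Hhh 5 2 1 2; Hhl 0 5 1 7; Hlh 0 2 0 1; Dlh 2 3 0 2; Vll 3 7 0 5];
      [:: Dhh 0 2 1 4; Hll 0 5 4 7; Hll 5 2 2 5; Dll 2 3 1 5; Vlh 3 7 1 5];
      [:: Dhl 8 2 1 5; Dlh 0 8 0 7; Dll 5 7 0 3; Vhl 2 3 3 5; Dhh 3 7 3 5];
      [:: Dhl 0 2 1 4; Dhl 0 8 2 6; Dlh 5 2 2 5; Dll 2 3 1 5; Vlh 3 7 0 5];
      [:: Hhh 1 3 3 4; Hhl 5 7 4 5; Hhl 0 5 4 7; Dlh 0 1 0 4; Dll 1 7 0 3; Dll 3 4 1 2];
      [:: Dhh 8 2 1 5; Dlh 0 5 0 7; Dll 8 2 0 1; Dlh 2 3 0 4; Vll 3 7 0 2]])].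

(** Exchanging [s] and [t] interchanges the five types with [p < q] and the five with [q < p], and
    fixes the three with [p = q]. *)
Definition type_swap (i : nat) := if i < 5 then i + 5 else if i < 10 then i - 5 else i.

(** No symmetry of templates has to be proved: transformed templates go through the same check as
    those in the table. *)
Definition templates_for (tx ty : nat) : seq (seq block) :=
  let flip := map flip_block in let reverse t := rev (map reverse_block t) in
  flatten [seq (if e.1 == (tx, ty) then e.2 else [::]) ++
               (if e.1 == (ty, tx) then map flip e.2 else [::]) ++
               (if e.1 == (type_swap tx, type_swap ty) then map reverse e.2 else [::]) ++
               (if e.1 == (type_swap ty, type_swap tx) then map (flip \o reverse) e.2 else [::])
          | e : (nat * nat) * seq (seq block) <- template_table].

Definition chain : Type := seq (link * nat).

Definition axes_of_type (i : nat) : seq (chain * axis) :=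
  [seq (c, axis_of c) | c <- refine (nth [::] axis_types i)].

(** The [let] shares what depends on the two types only, in particular the list of templates, among
    all their refinements during evaluation. *)
Definition over_pairs (T : Type) (f : nat -> nat -> chain * axis -> chain * axis -> T) : seq T :=
  flatten [seq flatten [seq let g := f i j in
                            [seq g c d | c <- axes_of_type i, d <- axes_of_type j]
                       | j <- iota 0 13] | i <- iota 0 13].

Definition solvable (i j : nat) : chain * axis -> chain * axis -> bool :=
  let ts := templates_for i j in
  fun c d => let ws := windows c.2 d.2 in
    (size ws <= 2) && all (fun w => has (check c.2 d.2 w) ts) ws.

Definition axis_ok (X : axis) := all (fun nm => rk X nm <= width X) (iota 0 8).

Lemma axes_ok : all (fun i => all (fun c : chain * axis => axis_ok c.2 &&
  all (fun x => x.2 < 10) c.1) (axes_of_type i)) (iota 0 13).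
Proof. by vm_compute. Qed.

Lemma windows_named : all (fun c : clause_windows => all (fun w : window =>
  all (fun nm => nm < 8) [:: w.1.1; w.1.2; w.2.1; w.2.2]) c.2) clauses.
Proof. by vm_compute. Qed.

Lemma templates_named :
  all (fun i => all (fun j => all (all (fun b => [&& x1 b < 10, x2 b < 10, y1 b < 10 & y2 b < 10]))
    (templates_for i j)) (iota 0 13)) (iota 0 13).
Proof. by vm_compute. Qed.

(** The whole existence part rests on this evaluation: a gap in the table or a missing clause would
    make it false. The cast leaves the work to the kernel, so that it is done once. *)
Lemma all_solvable : all id (over_pairs solvable).
Proof. by vm_cast_no_check (erefl true). Qed.

(** * The algorithm *)

Lemma In_all (T : Type) (p : pred T) s x : all p s -> List.In x s -> p x.
Proof. by elim: s => //= y s IH /andP[py ps] [<-|/IH->]. Qed.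

Lemma In_flatten (T : Type) (x : T) ss : List.In x (flatten ss) ->
  exists2 s, List.In s ss & List.In x s.
Proof.
elim: ss => //= s ss IH h; case: (In_cat h) => [hx|/IH[s' h1 h2]].
  by exists s; [left|].
by exists s'; [right|].
Qed.

Lemma In_iota i a n : List.In i (iota a n) -> a <= i < a + n.
Proof. by elim: n a => //= n IH a [<-|/IH]; lia. Qed.

Lemma has_In (T : Type) (p : pred T) s : has p s -> exists2 x, List.In x s & p x.
Proof. by elim: s => //= y s IH /orP[py|/IH[x h1 h2]]; [exists y|exists x]; auto. Qed.

Lemma In_has (T : Type) (p : pred T) s x : List.In x s -> p x -> has p s.
Proof. by elim: s => //= y s IH [->|/IH h] px; rewrite ?px ?h ?orbT. Qed.

Lemma map_In (T U : Type) (f : T -> U) s x : List.In x s -> List.In (f x) (map f s).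
Proof. exact: List.in_map. Qed.

Lemma flatten_In (T : Type) (x : T) s ss : List.In s ss -> List.In x s -> List.In x (flatten ss).
Proof. by elim: ss => //= s' ss IH [->|/IH h] hx; apply: List.in_or_app; auto. Qed.

Lemma iota_In i a n : a <= i < a + n -> List.In i (iota a n).
Proof.
elim: n a => [|n IH] a h /=; first by lia.
by case: (eqVneq a i) => [->|ne]; [left|right; apply: IH; lia].
Qed.

Lemma over_pairs_In (T : Type) (f : nat -> nat -> chain * axis -> chain * axis -> T) i j c d :
  i < 13 -> j < 13 -> List.In c (axes_of_type i) -> List.In d (axes_of_type j) ->
  List.In (f i j c d) (over_pairs f).
Proof.
move=> hi hj hc hd; apply: (flatten_In (s := flatten [seq let g := f i k in
  [seq g c d | c <- axes_of_type i, d <- axes_of_type k] | k <- iota 0 13])).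
  by apply: (map_In (fun i => flatten _)); apply: iota_In.
apply: (flatten_In (s := [seq f i j c d | c <- axes_of_type i, d <- axes_of_type j])).
  by apply: (map_In (fun k => let g := f i k in _)); apply: iota_In.
apply: (flatten_In (s := [seq f i j c d | d <- axes_of_type j])).
  exact: (map_In (fun c => [seq f i j c d | d <- axes_of_type j])).
exact: map_In.
Qed.

Lemma In_over_pairs (T : Type) (f : nat -> nat -> chain * axis -> chain * axis -> T) x :
  List.In x (over_pairs f) -> exists i j c d,
  [/\ i < 13, j < 13, List.In c (axes_of_type i), List.In d (axes_of_type j) & x = f i j c d].
Proof.
move=> h; have [s hs {}h] := In_flatten h; have [i es hi] := In_map hs.
rewrite es in h; have [s' hs' {}h] := In_flatten h; have [j es' hj] := In_map hs'.
rewrite es' in h; have [s'' hs'' {}h] := In_flatten h; have [c es'' hc] := In_map hs''.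
rewrite es'' in h; have [d -> hd] := In_map h.
by exists i, j, c, d; split=> //; [have := In_iota hi|have := In_iota hj].
Qed.

Lemma axes_of_typeP i c : i < 13 -> List.In c (axes_of_type i) ->
  [/\ c.2 = axis_of c.1, strict c.1, axis_ok c.2 & all (fun x => x.2 < 10) c.1].
Proof.
move=> hi hc.
have := In_all (In_all axes_ok (iota_In (hi : 0 <= i < 0 + 13))) hc => /andP[h1 h2].
have [c' ec hc'] := In_map hc; split=> //; first by rewrite ec.
by have := In_all (refine_strict _) hc'; rewrite ec.
Qed.

Lemma chain_holds_eq v v' prev ch : (forall nm, nm < 10 -> v nm = v' nm) -> prev < 10 ->
  all (fun x => x.2 < 10) ch -> chain_holds v prev ch = chain_holds v' prev ch.
Proof.
move=> e; elim: ch prev => //= -[l n] ch IH prev hp /andP[/= h1 h2].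
by rewrite !e // IH.
Qed.

Lemma windows_names X Y w nm : w \in windows X Y -> nm \in [:: w.1.1; w.1.2; w.2.1;
  w.2.2] -> nm < 8.
Proof.
rewrite /windows => hw hnm; move: hw windows_named.
elim: clauses => [|c cs IH] /=.
  by rewrite inE => /eqP ew _; move: hnm; rewrite ew !inE => /or4P[] /eqP->.
case: ifP => _ hw /andP[h1 h2]; last exact: IH.
have h3 : all (fun nm => nm < 8) [:: w.1.1; w.1.2; w.2.1; w.2.2] := allP h1 _ hw.
exact: (allP h3 _ hnm).
Qed.

Lemma axis_values_le p q A M nm : p <= M -> q <= M -> A < M -> nm < 8 ->
  axis_values p q A M nm <= M.
Proof.
move=> hp hq hA; rewrite /axis_values.
by do 8 (case: nm => [_|nm] /=; first by lia).
Qed.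

Lemma size_grid_bound (P : seq vertex) m n : uniq P ->
  (forall v, v \in P -> (0 < v.1 <= m) && (0 < v.2 <= n)) -> size P <= m * n.
Proof.
move=> uP hP.
have -> : m * n = size [seq (i, j) | i <- iota 1 m, j <- iota 1 n].
  by rewrite size_allpairs !size_iota.
apply: uniq_leq_size => // -[x y] /hP /= h.
by apply/allpairsP; exists (x, y); rewrite !mem_iota /=; split=> //; lia.
Qed.

(** Templates are selected here, outside the machine, and the program contains only the selected
    ones. In [entries] the default [[::]] does not occur as a failed search, since [all_solvable]
    provides a hit for [find]. *)
Definition class_entry (i j : nat) : chain * axis -> chain * axis -> pair_entry :=
  let ts := templates_for i j in fun c d =>
  (c.1, d.1, [seq nth [::] ts (find (check c.2 d.2 w) ts) | w <- windows c.2 d.2]).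

Definition entries : seq pair_entry := over_pairs class_entry.

(* Conversion must not evaluate these closed terms. *)
#[local] Opaque templates_for windows axes_of_type check.

Definition good_entry (p : pair_entry) : Prop :=
  let X := axis_of p.1.1 in let Y := axis_of p.1.2 in
  [/\ entry_named p, strict p.1.1 /\ axis_ok X, strict p.1.2 /\ axis_ok Y &
    exists tm, [/\ p.2 = map tm (windows X Y), size (windows X Y) <= 2 &
      forall w, w \in windows X Y -> check X Y w (tm w) /\ all named (tm w)]].

Lemma good_entries p : List.In p entries -> good_entry p.
Proof.
move=> /(In_over_pairs (f := class_entry))[i [j [[c X] [[d Y] [hi hj hc hd ->]]]]].
have [/= eX sX okX nX] := axes_of_typeP hi hc; have [/= eY sY okY nY] := axes_of_typeP hj hd.
have := In_all all_solvable (over_pairs_In solvable hi hj hc hd).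
rewrite /solvable /id -[(c, X).2]/X -[(d, Y).2]/Y => /andP[ws2 wsol].
have tsn := In_all (In_all templates_named (iota_In (hi : 0 <= i < 0 + 13)))
  (iota_In (hj : 0 <= j < 0 + 13)).
rewrite /good_entry /class_entry /entry_named -[(c, X).2]/X -[(d, Y).2]/Y.
rewrite -[(c, X).1]/c -[(d, Y).1]/d.
move: (templates_for i j) tsn wsol => ts tsn wsol.
rewrite -eX -eY; split=> //; first by rewrite /= nX nY.
exists (fun w => nth [::] ts (find (check X Y w) ts)); split=> // w hw.
have hf : has (check X Y w) ts by apply: (allP wsol).
split; first exact: nth_find.
by have /(all_nthP [::])/(_ _ _) := tsn; apply; rewrite -has_find.
Qed.

Lemma axis_class p q A M : 0 < p <= M -> 0 < q <= M -> 0 < A < M ->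
  exists i c, [/\ i < 13, List.In c (axes_of_type i) & chain_holds (axis_values p q A M) 0 c.1].
Proof.
#[local] Transparent axes_of_type.
move=> h1 h2 h3; have /(has_nthP [::])[i hi hc] := axis_types_complete h1 h2 h3.
have [c hc1 hc2] := has_In (refine_complete hc).
exists i, (c, axis_of c); split=> //.
exact: (map_In (fun c => (c, axis_of c))).
Qed.
#[local] Opaque axes_of_type.

Lemma entries_complete p q A M p' q' A' M' : 0 < p <= M -> 0 < q <= M -> 0 < A < M ->
  0 < p' <= M' -> 0 < q' <= M' -> 0 < A' < M' ->
  exists2 e, List.In e entries & entry_holds (axis_values p q A M) (axis_values p' q' A' M') e.
Proof.
move=> h1 h2 h3 h4 h5 h6.
have [i [c [hi hc cc]]] := axis_class h1 h2 h3; have [j [d [hj hd dd]]] := axis_class h4 h5 h6.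
exists (class_entry i j c d); first exact: over_pairs_In.
by rewrite /entry_holds cc dd.
Qed.

Lemma in_window_region s t m n A B w v :
  0 < s.1 <= m -> 0 < t.1 <= m -> 0 < A < m -> 0 < s.2 <= n -> 0 < t.2 <= n -> 0 < B < n ->
  (forall nm, nm \in [:: w.1.1; w.1.2; w.2.1; w.2.2] -> nm < 8) ->
  v \in in_window (axis_values s.1 t.1 A m) (axis_values s.2 t.2 B n) w -> region m n A B v.
Proof.
move=> s1 t1 hA s2 t2 hB h8.
have l1 : axis_values s.1 t.1 A m w.1.2 <= m.
  by apply: axis_values_le; rewrite ?h8 ?inE ?eqxx ?orbT //; lia.
have l2 : axis_values s.2 t.2 B n w.2.2 <= n.
  by apply: axis_values_le; rewrite ?h8 ?inE ?eqxx ?orbT //; lia.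
rewrite unfold_in /in_window => /and3P[/andP[a1 a2] /andP[b1 b2] c].
rewrite /region (leq_ltn_trans _ a1) // (leq_ltn_trans _ b1) // (leq_trans a2) // (leq_trans b2) //.
Qed.

Lemma region_bounds m n A B v : region m n A B v -> (0 < v.1 <= m) && (0 < v.2 <= n).
Proof. by rewrite /region; lia. Qed.

Definition leaf_cost (p : pair_entry) := 100 * (1 + sumn (map size p.2) + size p.2).

Lemma sumn_In (T : Type) (f : T -> nat) s x : List.In x s -> f x <= sumn (map f s).
Proof. by elim: s => //= y s IH [->|/IH]; lia. Qed.

Lemma sumn_bound (T : eqType) (f g : T -> nat) K (s : seq T) :
  (forall x, x \in s -> f x <= g x + K) -> sumn (map f s) <= sumn (map g s) + size s * K.
Proof.
elim: s => //= x s IH h; have h1 := h x (mem_head _ _).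
have h2 := IH (fun y hy => h y (mem_behead (s := x :: s) hy)); lia.
Qed.

Lemma cost_bound a b c K : a <= b + c * K -> 1 + a <= (1 + b + c) * (1 + K).
Proof. by nia. Qed.

(** The table is a variable [ps] with its two properties as hypotheses, so that the large closed
    term never takes part in conversion. *)
Lemma dispatch_longest ps m n A B s t M : (forall p, List.In p ps -> good_entry p) ->
  (forall p q A M p' q' A' M', 0 < p <= M -> 0 < q <= M -> 0 < A < M ->
     0 < p' <= M' -> 0 < q' <= M' -> 0 < A' < M' ->
     exists2 e, List.In e ps & entry_holds (axis_values p q A M) (axis_values p' q' A' M') e) ->
  valid_conf m n A B s t -> ready M ->
  (forall nm, nm < 10 -> M (xreg nm) = axis_values s.1 t.1 A m nm /\
                         M (yreg nm) = axis_values s.2 t.2 B n nm) ->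
  exists P, [/\ output (dispatch_cmd ps) M = map (reflect_y M) P,
    spath (region m n A B) s t P,
    forall q, spath (region m n A B) s t q -> size q <= size P &
    time (dispatch_cmd ps) M <=
      (sumn (map entry_cost ps) + sumn (map leaf_cost ps)) * (1 + m * n)].
Proof.
move=> good comp hv rM hM; have [[hA hB hs ht st] _] := hv.
set vx := axis_values s.1 t.1 A m; set vy := axis_values s.2 t.2 B n.
have hMx nm : nm < 10 -> M (xreg nm) = vx nm by case/hM.
have hMy nm : nm < 10 -> M (yreg nm) = vy nm by case/hM.
have hs1 : 0 < s.1 <= m by move: hs; rewrite /region; lia.
have ht1 : 0 < t.1 <= m by move: ht; rewrite /region; lia.
have hs2 : 0 < s.2 <= n by move: hs; rewrite /region; lia.
have ht2 : 0 < t.2 <= n by move: ht; rewrite /region; lia.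
have es : s = ((vx nPm).+1, (vy nPm).+1).
  by rewrite /vx /vy -[_ nPm]/s.1.-1 -[_ nPm]/s.2.-1 !prednK -?surjective_pairing;
    case/andP: hs1 hs2 => + _ /andP[].
have et : t = ((vx nQm).+1, (vy nQm).+1).
  by rewrite /vx /vy -[_ nQm]/t.1.-1 -[_ nQm]/t.2.-1 !prednK -?surjective_pairing;
    case/andP: ht1 ht2 => + _ /andP[].
have holdsE p : entry_named p ->
    entry_holds (fun nm => M (xreg nm)) (fun nm => M (yreg nm)) p = entry_holds vx vy p.
  by move=> /andP[h1 h2]; rewrite /entry_holds (chain_holds_eq hMx) // (chain_holds_eq hMy).
have hh : has (entry_holds (fun nm => M (xreg nm)) (fun nm => M (yreg nm))) ps.
  have [e he ee] := comp _ _ _ _ _ _ _ _ hs1 ht1 hA hs2 ht2 hB.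
  by apply: (In_has he); rewrite holdsE //; case: (good _ he).
have nE : all entry_named ps.
  have H : forall l : seq pair_entry, (forall p, List.In p l -> entry_named p) -> all entry_named l.
    by elim=> //= p l IH h; rewrite h ?IH //; [move=> p' hp'; apply: h; right|left].
  by apply: H => p /good[].
have [M' [p [ag hp hold oD tD]]] := dispatch_cmd_spec rM nE hh.
have [np [sX okX] [sY okY] [tm [ep2 ws2 tmP]]] := good p hp.
set X := axis_of _ in okX ep2 ws2 tmP; set Y := axis_of _ in okY ep2 ws2 tmP.
move: hold; rewrite holdsE // => /andP[cX cY].
have fX := axis_of_fits (erefl : vx 0 = 0) sX cX.

have fY := axis_of_fits (erefl : vy 0 = 0) sY cY.
have [ws0 wsP] := windows_sound hv fX fY.
have okN nm : nm < 8 -> (rk X nm <= width X) && (rk Y nm <= width Y).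
  by move=> h; rewrite (allP okX) ?(allP okY) ?mem_iota.
have chk w : w \in windows X Y -> check X Y w (tm w) by case/tmP.
have tn w : w \in windows X Y -> all named (tm w) by case/tmP.
have rM' := ready_agree rM ag.
pose Pw w := plan_path (map (place vx vy) (tm w)).
have ePw w : w \in windows X Y -> plan_path (map (at_regs M') (tm w)) = Pw w.
  move=> /tn; rewrite /Pw; elim: (tm w) => //= b bs IH /andP[nb /IH].
  rewrite /plan_path /= => ->; congr cat; rewrite (at_regs_agree nb ag).
  by case/and4P: nb => n1 n2 n3 n4; rewrite /at_regs /place (hMx _ n1) (hMx _ n2) (hMy _ n3) (hMy
    _ n4).
have snd w : w \in windows X Y -> [/\ walk s (Pw w) t, uniq (Pw w) & Pw w =i in_window vx vy w].
  move=> hw; have := check_sound fX fY es et _ (chk w hw); apply.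
  apply/allP => nm; rewrite !inE => hnm; apply: okN.
  case/or3P: hnm => [/eqP-> //|/eqP-> //|/orP[/eqP-> //|hnm]].
  by apply: windows_names hw _; rewrite !inE.
have sub w v : w \in windows X Y -> v \in Pw w -> region m n A B v.
  move=> hw; have [_ _ ->] := snd w hw.
  exact: (in_window_region hs1 ht1 hA hs2 ht2 hB (fun nm => windows_names hw)).
have sz w : w \in windows X Y -> size (Pw w) <= m * n.
  move=> hw; apply: size_grid_bound => [|v /(sub w v hw)]; first by case: (snd w hw).
  exact: region_bounds.
have ap : all (all named) p.2.
  by rewrite ep2 all_map; apply/allP => w /tn.
have sp : 0 < size p.2 <= 2 by rewrite ep2 size_map ws0.
have [tL [k hk [oL mL]]] := leaf_cmd_spec rM' ap sp.
rewrite ep2 size_map in hk.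
have wk k' : k' < size (windows X Y) -> nth full_window (windows X Y) k' \in windows X Y.
  exact: mem_nth.
have nthP k' : k' < size (windows X Y) ->
    plan_path (map (at_regs M') (nth [::] p.2 k')) = Pw (nth full_window (windows X Y) k').
  by move=> hk'; rewrite ep2 (nth_map full_window) // ePw // wk.
exists (Pw (nth full_window (windows X Y) k)); have hw := wk k hk; split.
- rewrite oD oL nthP //; apply: eq_map => v; by rewrite /reflect_y ag.
- have [w1 w2 w3] := snd _ hw; split=> //.
  by apply/allP => v; apply: sub.
(* [q] is no longer than the template path of a window that dominates it, and the program outputs a
   longest of the template paths. *)
- move=> q /wsP[w hw' hdom]; have [_ u e] := snd w hw'.
  apply: leq_trans (hdom (Pw w) u _) _; first by move=> v; rewrite e.
  have hi' : index w (windows X Y) < size (windows X Y) by rewrite index_mem.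
  have := mL (index w (windows X Y)); rewrite ep2 size_map => /(_ hi').
  by rewrite -ep2 !nthP // nth_index.
- apply: leq_trans tD _.
  have hc' : leaf_cost p <= sumn (map leaf_cost ps) by apply: sumn_In.
  have hl : time (leaf_cmd p.2) M' <= leaf_cost p * (1 + m * n).
    apply: leq_trans tL _; rewrite /leaf_cost -mulnA leq_mul2l orFb.
    have : sumn [seq size t0 + size (plan_path (map (at_regs M') t0)) | t0 <- p.2]
       <= sumn (map size p.2) + size p.2 * (m * n).
      rewrite ep2 -!map_comp size_map; apply: sumn_bound => w hw' /=.
      by rewrite ePw // leq_add2l sz.
    exact: cost_bound.
  rewrite mulnDl; apply: leq_add (leq_trans hl _); first exact: leq_pmulr.
  by rewrite leq_mul2r hc' orbT.
Qed.

(** * Trimming dead ends and undoing the reflection *)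

Lemma spath_trim_y m n A B s t q : 0 < A -> spath (region m n A B) s t q ->
  region m n A B s -> region m n A B t ->
  spath (region m (trimmed A B.+1 s.2 t.2 n) A B) s t q.
Proof.
move=> hA hq hs ht; rewrite /trimmed; case: ifP => // hA2.
set n' := maxn _ _; have [w u a] := hq; split=> //.
(* Since [A = 1] and [n' > B], the rows from [n'] on contain only vertices of the first column. The
   part above is entered through [(1, n')] alone, so a path that goes there cannot return. *)
have hD : all (predC (fun v : vertex => n' < v.2)) q.
  apply: (spath_avoids (z := (1, n')) hq); rewrite /n'; try lia.
  by move=> [x y] [x' y']; rewrite /region /wadj /absdiff /= => h1 h2 h3 h4 h5; congr pair; lia.
apply/allP => v hv; have := allP hD _ hv; have := allP a _ hv; rewrite /region /=; lia.
Qed.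

Lemma spath_trim m n A B s t q : 0 < A -> 0 < B -> spath (region m n A B) s t q ->
  spath (region (trimmed B A.+1 s.1 t.1 m) (trimmed A B.+1 s.2 t.2 n) A B) s t q.
Proof.
move=> hA hB hq.
have ends P : spath P s t q -> P s /\ P t.
  by move=> [w _ a]; have [h1 h2] := walk_ends w; split; apply: (allP a).
have [hs ht] := ends _ hq; have hq1 := spath_trim_y hA hq hs ht.
have [hs1 ht1] := ends _ hq1; have hq2 := spath_flip hq1.
have := spath_trim_y hB hq2; rewrite !region_flip => /(_ hs1 ht1) /spath_flip.
by rewrite !flipK mapK //; apply: flipK.
Qed.

Lemma region_trim m n A B m' n' v :
  m' <= m -> n' <= n -> region m' n' A B v -> region m n A B v.
Proof. by rewrite /region; lia. Qed.

Lemma trimmed_bounds m n A B s t : 0 < A < m -> region m n A B s -> region m n A B t ->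
  A < trimmed B A.+1 s.1 t.1 m <= m.
Proof. by rewrite /trimmed /region; case: ifP; lia. Qed.

Lemma trimmed_region m n A B s t : 0 < A < m -> 0 < B < n ->
  region m n A B s -> region m n A B t ->
  region (trimmed B A.+1 s.1 t.1 m) (trimmed A B.+1 s.2 t.2 n) A B s /\
  region (trimmed B A.+1 s.1 t.1 m) (trimmed A B.+1 s.2 t.2 n) A B t.
Proof. by rewrite /trimmed /region; do 2 case: ifP; lia. Qed.

Lemma trimmed_valid m n A B s t : 0 < A < m -> 0 < B < n ->
  region m n A B s -> region m n A B t -> s != t ->
  valid_conf (trimmed B A.+1 s.1 t.1 m) (trimmed A B.+1 s.2 t.2 n) A B s t.
Proof.
move=> hA hB hs ht st; have [hs' ht'] := trimmed_region hA hB hs ht.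
have /andP[h1 _] := trimmed_bounds hA hs ht.
have h2 : B < trimmed A B.+1 s.2 t.2 n.
  by move: hs ht; rewrite -2!(region_flip m n) => hs ht; have /andP[] := trimmed_bounds hB hs ht.
split; last by split=> e; rewrite /trimmed e /=; lia.
by split=> //; apply/andP; split=> //; [case/andP: hA|case/andP: hB].
Qed.

Definition mirror (n : nat) (v : vertex) : vertex := (v.1, n.+1 - v.2).

Lemma mirrorK n v : 0 < v.2 <= n -> mirror n (mirror n v) = v.
Proof. by case: v => x y h; rewrite /mirror /=; congr pair; move: h => /=; lia. Qed.

Lemma mirror_wadj n u v : 0 < u.2 <= n -> 0 < v.2 <= n -> wadj u v ->
  wadj (mirror n u) (mirror n v).
Proof. by rewrite /wadj /absdiff /=; lia. Qed.

Lemma inL_region m n k l v : k < m -> l < n -> inL m n k l v ->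
  region m n (m - k) (n - l) (mirror n v).
Proof. by rewrite /inL /region /=; lia. Qed.

Lemma region_inL m n k l v : k < m -> l < n -> region m n (m - k) (n - l) v ->
  inL m n k l (mirror n v).
Proof. by rewrite /inL /region /=; lia. Qed.

Lemma inL_bounds m n k l v : inL m n k l v -> 0 < v.2 <= n.
Proof. by rewrite /inL; lia. Qed.

Lemma wadj_sg_path u p : uniq (u :: p) -> path wadj u p -> path sg_adj u p.
Proof.
elim: p u => //= v p IH u /andP[h1 h2] /andP[a hp].
rewrite IH // andbT /sg_adj; move: h1; rewrite inE negb_or => /andP[-> _] /=.
exact: a.
Qed.

Lemma sg_wadj u v : sg_adj u v -> wadj u v.
Proof. by case/and3P=> _ h1 h2; apply/andP. Qed.

Lemma mirror_uniq n (p : seq vertex) : (forall v, v \in p -> 0 < v.2 <= n) ->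
  uniq p -> uniq (map (mirror n) p).
Proof.
move=> hp up; rewrite map_inj_in_uniq // => u v /hp hu /hp hv e.
by rewrite -(mirrorK hu) e mirrorK.
Qed.

Lemma mirror_st_path m n k l s t P : k < m -> l < n -> inL m n k l s -> inL m n k l t ->
  spath (region m n (m - k) (n - l)) (mirror n s) (mirror n t) P ->
  is_st_path m n k l s t (map (mirror n) P).
Proof.
move=> km ln hs ht [wP uP aP].
have inP v : v \in P -> 0 < v.2 <= n by move=> /(allP aP)/region_bounds/andP[].
have hw u v : u \in P -> v \in P -> wadj u v -> wadj (mirror n u) (mirror n v).
  by move=> hu hv; apply: mirror_wadj; apply: inP.
have [p [ep el hp]] := walk_map hw wP.
rewrite !mirrorK ?(inL_bounds hs) ?(inL_bounds ht) // in ep el hp.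
have up := mirror_uniq inP uP.
have aL : all (inL m n k l) (map (mirror n) P).
  by rewrite all_map; apply/allP => v /(allP aP); apply: region_inL.
rewrite ep in up aL *; split; first by split.
by split=> //; apply: wadj_sg_path.
Qed.

Lemma st_path_mirror m n k l s t q : k < m -> l < n -> is_st_path m n k l s t q ->
  spath (region m n (m - k) (n - l)) (mirror n s) (mirror n t) (map (mirror n) q).
Proof.
move=> km ln [[q0 qh ql qu] [qa qp]].
have ha v : v \in q -> inL m n k l v by apply: (allP qa).
have hb v : v \in q -> 0 < v.2 <= n by move=> /ha/inL_bounds.
split; [|exact: mirror_uniq|].
- case: q q0 qh ql qu qa qp ha hb => // x q _ /= -> ql qu qa qp ha hb.
  exists (map (mirror n) q); split=> //; first by rewrite last_map ql.
  elim: q s qp hb {ql qu qa ha} => //= y q IH x' /andP[a qp] hb.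
  rewrite IH ?andbT //; last by move=> v hv'; apply: hb; rewrite inE hv' orbT.
  by apply: mirror_wadj (sg_wadj a); apply: hb; rewrite !inE eqxx ?orbT.
- by rewrite all_map; apply/allP => v /ha; apply: inL_region.
Qed.

Definition solver (ps : seq pair_entry) : cmd := setup_cmd ;; dispatch_cmd ps.

Lemma solver_wf ps : wf_cmd (solver ps).
Proof. by rewrite /solver /= dispatch_cmd_wf. Qed.

(** [1 + m' * n'] is at most [2 * (m * n)], whence the factor 2; the 40 steps are those of the
    setup. *)
Lemma solver_time_bound T m n m' n' K : 1 < m -> 1 < n -> m' <= m -> n' <= n ->
  T <= K * (1 + m' * n') -> 40 + T <= (40 + 2 * K) * (m * n).
Proof.
move=> hm hn hm' hn' hT; have mn' := leq_mul hm' hn'.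
have mn : 0 < m * n by rewrite muln_gt0; lia.
move: (m * n) (m' * n') mn mn' hT => {hm hn hm' hn'} a b; nia.
Qed.

#[local] Opaque setup_cmd dispatch_cmd.

Definition solver_cost (ps : seq pair_entry) : nat :=
  40 + 2 * (sumn (map entry_cost ps) + sumn (map leaf_cost ps)).

Lemma solver_spec m n k l s t (M0 := Defs.mem (init_config m n k l s t)) :
  validL m n k l -> inL m n k l s -> inL m n k l t -> s != t ->
  time (solver entries) M0 <= solver_cost entries * (m * n) /\
  is_longest_st_path m n k l s t (output (solver entries) M0).
Proof.
have := entries_complete; have := good_entries; move: entries => ps good comp.
move=> [[m1 n1 k1 l1] [km ln]] hs ht st.
have [o1 t1 rM n9 vM] := setup_cmd_spec m n k l s.1 s.2 t.1 t.2.
rewrite -/M0 in o1 t1 rM n9 vM.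
rewrite [time _ _]time_seq [output _ _]output_seq o1; move: (mem_after _ _) rM n9 vM => M rM n9 vM.
set A := m - k in vM; set B := n - l in vM.
have hA : 0 < A < m by rewrite /A; lia.
have hB : 0 < B < n by rewrite /B; lia.
have rs : region m n A B (mirror n s) := inL_region km ln hs.
have rt : region m n A B (mirror n t) := inL_region km ln ht.
have st' : mirror n s != mirror n t.
  by apply: contraNneq st => e; rewrite -(mirrorK (inL_bounds hs)) e mirrorK ?(inL_bounds ht).
have hv := trimmed_valid hA hB rs rt st'.
have [P [oP sP longP tP]] := dispatch_longest good comp hv rM vM.
have /andP[_ hm'] := trimmed_bounds hA rs rt.
have /andP[_ hn'] : B < trimmed A B.+1 (mirror n s).2 (mirror n t).2 n <= n.
  by move: rs rt; rewrite -2!(region_flip m n) => rs rt; have := trimmed_bounds hB rs rt.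
split; first by apply: leq_trans (leq_add t1 _) (solver_time_bound m1 n1 hm' hn' tP).
rewrite cat0s oP (_ : map _ P = map (mirror n) P); last first.
  by apply: eq_map => v; rewrite /reflect_y n9.
split.
  apply: mirror_st_path => //; case: sP => wP uP aP; split=> //.
  by apply: sub_all aP => v; apply: region_trim.
(* A competing path keeps its length under reflection and never enters the trimmed parts, so it
   competes in the trimmed region as well. *)
move=> q hq; rewrite size_map -(size_map (mirror n) q); apply: longP.
by apply: spath_trim; [case/andP: hA|case/andP: hB|apply: st_path_mirror].
Qed.

Theorem theorem4 :
  exists (prog : seq instr) (c : nat),
    forall (m n k l : nat) (s t : vertex),
      validL m n k l -> inL m n k l s -> inL m n k l t -> s != t ->
      exists T : nat,
        T <= c * (m * n) /\
        halted prog (run prog T (init_config m n k l s t)) /\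
        is_longest_st_path m n k l s t (out (run prog T (init_config m n k l s t))).
Proof.
exists (compile (solver entries) 0).
have := solver_wf entries; have := solver_spec;
  move: (solver entries) (solver_cost entries) => c K hc wf.
exists K => m n k l s t hL hs ht st; have [hT hp] := hc m n k l s t hL hs ht st.
exists (time c (Defs.mem (init_config m n k l s t))); split=> //.
have hat : code_at (compile c 0) 0 (compile c 0) by move=> i hi; rewrite add0n.
rewrite (compile_run wf _ _ hat) add0n cat0s; split=> //.
by rewrite /halted /= size_compile.
Qed.
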